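(* Let $d,N\ge1$ be integers, $p\ge1$, $\varepsilon>0$, and let $\mu$ be a Borel probability measure on $(\mathbb{R}^d)^N$ such that $\mu_j\in\mathcal{P}^{1,p}(\mathbb{R}^d)$ for every $j=1,\dots,N$. Then $\Theta^\varepsilon[\mu]\in\mathcal{P}^{1,p}((\mathbb{R}^d)^N)$, and for every $j=1,\dots,N$ $$\nabla_{x_j}\big(\Theta^\varepsilon[\mu]^{\frac1p}\big)(X)=\frac1p\,\Theta^\varepsilon[\mu](X)^{\frac{1-p}{p}}\,\nabla_{x_j}\Theta^\varepsilon[\mu](X)$$ for a.e. $X\in(\mathbb{R}^d)^N$.
   Context: $\mathcal{P}^{1,p}(\mathbb{R}^m)$ is the set of Borel probability measures on $\mathbb{R}^m$ that are absolutely continuous with respect to Lebesgue measure and whose density (denoted by the same symbol as the measure) has $p$-th root in $W^{1,p}(\mathbb{R}^m)$. The space $(\mathbb{R}^d)^N$ is identified with $\mathbb{R}^{dN}$. $\mu_j=\pi^j_\#\mu$ is the $j$-th marginal, $\pi^j(x_1,\dots,x_N)=x_j$. $\nabla_{x_j}$ is the weak gradient with respect to the $j$-th $\mathbb{R}^d$-variable. For $\varepsilon>0$ let $\eta^\varepsilon(z)=(2\pi\varepsilon)^{-d/2}\exp(-|z|^2/(2\varepsilon))$ for $z\in\mathbb{R}^d$ (Euclidean norm). Let $\Lambda^\varepsilon[\mu](Y)=\int\prod_{k=1}^N\eta^\varepsilon(y_k-x_k)\,d\mu(X)$ and $(\mu_k*\eta^\varepsilon)(y)=\int\eta^\varepsilon(y-x)\,d\mu_k(x)$.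 When the marginals have densities $\mu_k(x_k)$, $\Theta^\varepsilon[\mu]$ is the probability measure on $(\mathbb{R}^d)^N$ with density $\Theta^\varepsilon[\mu](X)=\int P^\varepsilon[\mu](X,Y)\,dY$, where $$P^\varepsilon[\mu](X,Y)=\prod_{k=1}^N\frac{\eta^\varepsilon(y_k-x_k)}{(\mu_k*\eta^\varepsilon)(y_k)}\,\mu_k(x_k)\;\Lambda^\varepsilon[\mu](Y).$$ Its weak gradient in the $j$-th variable is $$\nabla_{x_j}\Theta^\varepsilon[\mu](X)=\frac{\nabla\mu_j(x_j)}{\mu_j(x_j)}\Theta^\varepsilon[\mu](X)-\int\frac{\nabla\eta^\varepsilon(y_j-x_j)}{\eta^\varepsilon(y_j-x_j)}P^\varepsilon[\mu](X,Y)\,dY.$$ Convention: expressions in which $\nabla u$ is multiplied by a negative power of a non-negative function $u$ are taken to be $0$ on $\{u=0\}$ (where $\nabla u=0$ a.e.). In particular $\frac{\nabla\mu_j(x_j)}{\mu_j(x_j)}\Theta^\varepsilon[\mu](X)$ is $0$ where $\mu_j(x_j)=0$. *)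

(* Defs.v *)
From HB Require Import structures.
From mathcomp Require Import all_boot all_order all_algebra.
From mathcomp Require Import all_classical all_reals all_analysis.
Set Implicit Arguments.
Unset Strict Implicit.
Unset Printing Implicit Defensive.
Import Order.TTheory GRing.Theory Num.Theory.
Import numFieldNormedType.Exports.
Local Open Scope classical_set_scope.
Local Open Scope ring_scope.

(* R^d is 'rV[R]_d = 'M[R]_(1, d), and (R^d)^N is 'M[R]_(N, d), the k-th
   R^d-variable x_k of X being row k X. Both carry the library's topology, and
   the Borel sigma-algebra of that topology. *)

Fact mx_display : measure_display. Proof. exact: default_measure_display. Qed.

Section borel_mx.
Context (R : realType) (m n : nat).
Let borel : set (set 'M[R]_(m, n)) := <<s [set U : set 'M[R]_(m, n) | open U] >>.
Let borel0 : borel set0. Proof. exact: sigma_algebra0. Qed.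
Let borelC A : borel A -> borel (~` A). Proof. exact: sigma_algebraC. Qed.
Let borel_bigcup (F : (set 'M[R]_(m, n))^nat) :
  (forall i, borel (F i)) -> borel (\bigcup_i F i).
Proof. exact: sigma_algebra_bigcup. Qed.

HB.instance Definition _ := @isMeasurable.Build mx_display 'M[R]_(m, n)
  borel borel0 borelC borel_bigcup.

End borel_mx.

Lemma measurable_to_mx (R : realType) d (T : measurableType d) m n
    (f : T -> 'M[R]_(m, n)) :
  (forall U : set 'M[R]_(m, n), open U -> measurable (f @^-1` U)) ->
  measurable_fun setT f.
Proof.
move=> fo; apply: (@measurability _ _ _ _ _ f [set U | open U]) => //.
by move=> _ [U oU <-]; rewrite setTI; exact: fo.
Qed.

Lemma continuous_row (R : realType) m n (i : 'I_m) :
  continuous (@row R m n i).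
Proof.
move=> M A /nbhs_ballP[e /= e0 eA]; apply/nbhs_ballP; exists e => //= N MN.
by apply: eA; case: MN => ? MN; split=> // k l; rewrite !mxE; exact: MN.
Qed.

Lemma measurable_row (R : realType) m n (i : 'I_m) :
  measurable_fun setT (@row R m n i).
Proof.
apply: measurable_to_mx => U oU; apply: sub_sigma_algebra => /=.
by apply: open_comp => // M _; exact: continuous_row.
Qed.

HB.instance Definition _ (R : realType) m n (i : 'I_m) :=
  @isMeasurableFun.Build _ _ 'M[R]_(m, n) 'rV[R]_n (@row R m n i)
    (@measurable_row R m n i).

Section image_measure.
Context d1 d2 (T1 : measurableType d1) (T2 : measurableType d2) (R : realType).
Variables (mu : {measure set T1 -> \bar R}) (f : {mfun T1 >-> T2}).

Definition image_measure : set T2 -> \bar R := pushforward mu f.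

Let image_measure0 : image_measure set0 = 0%E.
Proof. by rewrite /image_measure /pushforward preimage_set0 measure0. Qed.

Let image_measure_ge0 A : (0 <= image_measure A)%E.
Proof. exact: measure_ge0. Qed.

Let image_measure_sigma_additive : semi_sigma_additive image_measure.
Proof. exact: (@measure_semi_sigma_additive _ _ _ (pushforward mu f)). Qed.

HB.instance Definition _ := isMeasure.Build _ _ _ image_measure
  image_measure0 image_measure_ge0 image_measure_sigma_additive.

End image_measure.

Section lebesgue_tuple.
Context (R : realType).
Let TR : measurableType _ := measurableTypeR R.

Definition tuple_consp n (x : TR * n.-tuple TR) : n.+1.-tuple TR :=
  [tuple of x.1 :: x.2].

Lemma measurable_tuple_consp n : measurable_fun setT (@tuple_consp n).
Proof. exact: measurable_cons. Qed.

HB.instance Definition _ n :=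
  isMeasurableFun.Build _ _ _ _ (@tuple_consp n) (@measurable_tuple_consp n).

Fixpoint lebesgue_tuple (n : nat) : {measure set (n.-tuple TR) -> \bar R} :=
  match n with
  | 0 => \d_ ([tuple] : 0.-tuple TR)
  | k.+1 => image_measure (lebesgue_measure \x^ lebesgue_tuple k)%E (@tuple_consp k)
  end.

Lemma lebesgue_tuple_box n (A : 'I_n -> set TR) :
  (forall i, measurable (A i)) ->
  lebesgue_tuple n [set t | forall i, A i (tnth t i)] =
  (\prod_(i < n) lebesgue_measure (A i))%E.
Proof.
elim: n A => [|n IH] A mA /=.
  rewrite big_ord0 diracE mem_set// => -[].
  by case.
rewrite /image_measure /pushforward big_ord_recl -IH//.
rewrite -product_measure2E//=; last first.
  rewrite [X in measurable X](_ : _ =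
    \bigcap_(i in [set: 'I_n]) ((fun t : n.-tuple TR => tnth t i) @^-1` A (lift ord0 i))).
    apply: fin_bigcap_measurable => [|i _]; first exact: finite_finset.
    by rewrite -[X in measurable X]setTI; exact: measurable_tnth.
  by apply/seteqP; split=> t /= tA i => [_|]; exact: tA.
congr product_measure2.
apply/seteqP; split => -[x t] /=.
  move=> H; split; first by have := H ord0; rewrite tnth0.
  by move=> i; have := H (lift ord0 i); rewrite tnthS.
move=> [H0 H] i; have [j ->|->] := unliftP ord0 i; last by rewrite tnth0.
by rewrite tnthS.
Qed.

End lebesgue_tuple.

Section lebesgue_mx.
Context (R : realType) (m n : nat).
Let TR : measurableType _ := measurableTypeR R.

Definition mx_of_tuple (t : (m * n).-tuple TR) : 'M[R]_(m, n) :=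
  \matrix_(i, j) tnth t (mxvec_index i j).

Lemma measurable_mx_of_tuple : measurable_fun setT mx_of_tuple.
Proof.
apply: measurable_to_mx => U oU.
pose c (q : 'M[rat]_(m, n)) : 'M[R]_(m, n) := map_mx ratr q.
pose I := [set qk : 'M[rat]_(m, n) * nat | ball (c qk.1) qk.2.+1%:R^-1 `<=` U].
have -> : U = \bigcup_(qk in I) ball (c qk.1) qk.2.+1%:R^-1.
  apply/seteqP; split; last by move=> M [qk qkI]; exact: qkI.
  move=> M UM.
  have /nbhs_ballP[e /= e0 eU] : nbhs M U by exact: open_nbhs_nbhs.
  have e20 : 0 < e / 2 by rewrite divr_gt0.
  pose k := Num.truncn (e / 2)^-1.
  have ke : k.+1%:R^-1 < e / 2.
    by rewrite invf_plt ?posrE//; exact: truncnS_gt.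
  have k0 : (0 : R) < k.+1%:R^-1 by rewrite invr_gt0.
  have H i j : {q : rat | ratr q \in `](M i j - k.+1%:R^-1), (M i j + k.+1%:R^-1)[}.
    by apply/cid/rat_in_itvoo; rewrite ltrBlDr -addrA ltrDl addr_gt0.
  have cM : ball (c (\matrix_(i, j) sval (H i j))) k.+1%:R^-1 M.
    split=> // i j; rewrite !mxE/=; case: (H i j) => q /=.
    by rewrite in_itv/= -ball_normE/= ltr_distlC => /andP[? ?]; apply/andP; split; rewrite ?ltrBlDr// -ltrBlDr.
  exists (\matrix_(i, j) sval (H i j), k) => //=.
  move=> N cN; apply: eU; rewrite [e]splitr.
  apply: ball_triangle.
    by apply/ball_sym; apply: le_ball cM; exact: ltW.
  by apply: le_ball cN; exact: ltW.
rewrite preimage_bigcup bigcup_mkcond.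
apply: countable_bigcupT_measurable => // -[q k] /=; case: ifPn => // _.
have e0 : 0 < k.+1%:R^-1 :> R by rewrite invr_gt0.
rewrite (_ : _ @^-1` _ = \bigcap_(ij in [set: 'I_m * 'I_n])
   ((fun t : (m * n).-tuple TR => tnth t (mxvec_index ij.1 ij.2)) @^-1`
     ball (c q ij.1 ij.2) k.+1%:R^-1)); last first.
  apply/seteqP; split => t /=.
    by move=> [_ H] [i j] _ /=; have := H i j; rewrite [mx_of_tuple t i j]mxE.
  by move=> H; split=> // i j; have := H (i, j) Logic.I; rewrite /= [mx_of_tuple t i j]mxE.
apply: fin_bigcap_measurable; first exact: finite_finset.
move=> [i j] _ /=; rewrite -[X in measurable X]setTI.
apply: measurable_tnth => //.
rewrite (_ : ball _ _ = `]c q i j - k.+1%:R^-1, c q i j + k.+1%:R^-1[%classic).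
  exact: measurable_itv.
by apply/seteqP; split=> y; rewrite -ball_normE /= in_itv/= ltr_distlC.
Qed.

HB.instance Definition _ :=
  isMeasurableFun.Build _ _ _ _ mx_of_tuple measurable_mx_of_tuple.

Definition lebesgue_mx : set 'M[R]_(m, n) -> \bar R :=
  image_measure (lebesgue_tuple R (m * n)) mx_of_tuple.

HB.instance Definition _ := Measure.on lebesgue_mx.

Lemma lebesgue_mx_box (A : 'I_m -> 'I_n -> set TR) :
  (forall i j, measurable (A i j)) ->
  lebesgue_mx [set X | forall i j, A i j (X i j)] =
  (\prod_(i < m) \prod_(j < n) lebesgue_measure (A i j))%E.
Proof.
move=> mA; rewrite /lebesgue_mx /image_measure /pushforward pair_bigA/=.
pose B k : set TR := let ij := enum_val (cast_ord (esym (mxvec_cast m n)) k) in A ij.1 ij.2.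
have BE i j : B (mxvec_index i j) = A i j.
  by rewrite /B /mxvec_index cast_ordK enum_rankK.
transitivity (\prod_k lebesgue_measure (B k))%E; last first.
  rewrite (reindex _ (curry_mxvec_bij m n))/=.
  by apply: eq_bigr => -[i j] _ /=; rewrite BE.
rewrite -lebesgue_tuple_box; last by move=> k; exact: mA.
congr (lebesgue_tuple R (m * n) _).
apply/seteqP; split => t /= H.
  move=> k; case/mxvec_indexP: k => i j; rewrite BE.
  by have := H i j; rewrite mxE.
by move=> i j; rewrite mxE -BE.
Qed.

End lebesgue_mx.

Section sobolev.
Context (R : realType) (m n : nat).
Local Notation leb := (@lebesgue_mx R m n).
Implicit Types (u g phi : 'M[R]_(m, n) -> R).

Fixpoint is_Ck (k : nat) phi : Prop :=
  continuous phi /\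
  match k with
  | 0 => True
  | l.+1 => forall i j, (forall X, derivable phi X (delta_mx i j)) /\
                        is_Ck l ('D_(delta_mx i j) phi)
  end.

Definition test_function phi : Prop :=
  (forall k, is_Ck k phi) /\ compact (closure [set X | phi X != 0]).

Definition loc_integrable u : Prop :=
  measurable_fun setT u /\
  forall K : set 'M[R]_(m, n), compact K -> leb.-integrable K (EFin \o u).

Definition is_weak_partial (i : 'I_m) (j : 'I_n) u g : Prop :=
  [/\ loc_integrable u, loc_integrable g &
      forall phi, test_function phi ->
        \int[leb]_X (u X * 'D_(delta_mx i j) phi X) =
        - \int[leb]_X (g X * phi X)].

Definition is_weak_grad u (G : 'M[R]_(m, n) -> 'M[R]_(m, n)) : Prop :=
  forall i j, is_weak_partial i j u (fun X => G X i j).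

(* The weak gradient in the variable row i X only. *)
Definition is_weak_grad_row (i : 'I_m) u (G : 'M[R]_(m, n) -> 'rV[R]_n) : Prop :=
  forall j, is_weak_partial i j u (fun X => G X 0 j).

Definition W1p (p : R) u : Prop :=
  u \in Lfun leb p%:E /\
  exists2 G, is_weak_grad u G &
    forall i j, (fun X => G X i j) \in Lfun leb p%:E.

Definition is_density (P : set 'M[R]_(m, n) -> \bar R) (f : 'M[R]_(m, n) -> R) :
    Prop :=
  [/\ measurable_fun setT f, forall X, 0 <= f X &
      forall A, measurable A -> P A = (\int[leb]_(X in A) (f X)%:E)%E].

(* W^{1,p}-membership of f `^ p^-1 does not depend on the version f of the
   density. *)
Definition P1p (p : R) (P : probability 'M[R]_(m, n) R) : Prop :=
  P `<< leb /\
  exists2 f, is_density P f & W1p p (fun X => f X `^ p^-1).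

End sobolev.

Section theta.
Context (R : realType) (d N : nat).

Definition marginal (mu : probability 'M[R]_(N, d) R) (k : 'I_N) :
  probability 'rV[R]_d R := distribution mu (row k).

Definition eta (eps : R) (z : 'rV[R]_d) : R :=
  (2 * pi * eps) `^ (- (d%:R / 2)) *
  expR (- (\sum_i z 0 i ^+ 2) / (2 * eps)).

Definition grad_eta (eps : R) (z : 'rV[R]_d) : 'rV[R]_d :=
  \row_i 'D_(delta_mx 0 i) (eta eps) z.

Variables (eps : R) (mu : probability 'M[R]_(N, d) R).

Definition Lambda (Y : 'M[R]_(N, d)) : R :=
  \int[mu]_X \prod_k eta eps (row k Y - row k X).

Definition conv_eta (k : 'I_N) (y : 'rV[R]_d) : R :=
  \int[marginal mu k]_x eta eps (y - x).

(* f k stands for a density of the k-th marginal. *)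
Variable f : 'I_N -> 'rV[R]_d -> R.

Definition Pdens (X Y : 'M[R]_(N, d)) : R :=
  (\prod_k (eta eps (row k Y - row k X) / conv_eta k (row k Y) * f k (row k X)))
  * Lambda Y.

(* Real-valued integral: it is 0 on the Lebesgue-null set of the X at which the
   extended integral of the density diverges. *)
Definition Theta (X : 'M[R]_(N, d)) : R :=
  \int[@lebesgue_mx R N d]_Y Pdens X Y.

(* g stands for the weak gradient of f j; the quotient by f j is taken to be 0
   where f j vanishes. *)
Definition grad_Theta (j : 'I_N) (g : 'rV[R]_d -> 'rV[R]_d) (X : 'M[R]_(N, d)) :
    'rV[R]_d :=
  (if f j (row j X) == 0 then 0
   else (Theta X / f j (row j X)) *: g (row j X))
  - \row_i \int[@lebesgue_mx R N d]_Y
      (grad_eta eps (row j Y - row j X) 0 i / eta eps (row j Y - row j X)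
       * Pdens X Y).

End theta.

(* Main.v *)
Require Import Defs.
From HB Require Import structures.
From mathcomp Require Import all_boot all_order all_algebra.
From mathcomp Require Import all_classical all_reals all_analysis.
From mathcomp Require Import measurable_realfun.
From mathcomp Require Import ring lra.
Set Implicit Arguments.
Unset Strict Implicit.
Unset Printing Implicit Defensive.
Import Order.TTheory GRing.Theory Num.Theory.
Import numFieldNormedType.Exports.
Local Open Scope classical_set_scope.
Local Open Scope ring_scope.

(** For fixed Y, the density P(X, Y) is a constant times the product F of the
    densities f k (row k X) times a product of Gaussian factors, which is smooth
    in X. In F only the factor f j depends on row j, so F inherits a weak
    partial derivative from f j ([weak_partial_prod_rows]); the smooth factor is
    harmless, because its product with a test function is a test function. Hence
    P(., Y) has the weak partial derivative score * P, where the score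
      g_i(x_j) / f_j(x_j) + (y_j - x_j)_i / eps
    is the sum of the logarithmic derivatives of the two factors containing x_j
    ([weak_partial_Pdens]). Integrating over Y with Fubini's theorem gives the
    weak gradient of Theta, and the integral of score * P is grad_Theta
    ([weak_partial_Theta]).

    Every integrability question reduces to one identity: for a kernel q >= 0,
      int int q(x_j, y_j) P(X, Y) dX dY = int f_j(x) int q(x, y) eta(y - x) dy dx
    ([Pdens_integral]). Indeed, integrating over the x_k with k <> j cancels the
    denominators mu_k * eta, and integrating Lambda over the y_k with k <> j
    leaves the denominator mu_j * eta, which cancels too. With q = 1 it says that
    Theta has integral 1. With q = |score|^p it bounds int int |score|^p P by the
    p-th moment of g / f_j under f_j, which is finite because the p-th root of
    f_j is in W^{1,p} ([density_weak_grad]), and by a Gaussian moment. Jensen's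
    inequality for the average over Y then gives
      int Theta |grad Theta / Theta|^p <= int int |score|^p P < oo
    ([Int_root_grad]), the L^p bound for the gradient of the p-th root of Theta.

    The passage between a function and its powers cannot use the usual chain
    rule: t |-> t^p is not globally Lipschitz and t |-> t^(1/p) is singular at 0.
    [weak_partial_power] allows any exponent a > 0, provided that the expected
    derivative, set to 0 on {u = 0}, is locally integrable. It is applied with
    a = p to the roots of the f j, and then shows in particular that a weak
    gradient of f j vanishes almost everywhere on {f j = 0}, and with a = 1/p to
    Theta. It is proved on lines: a weak partial derivative is the same thing as
    absolute continuity along almost every line ([ac_on_lines_weak],
    [weak_ac_on_lines]), and along a line |s|^a is the limit of
    (s^2 + r)^(a/2) ([ac_power]).

    Finally weak partial derivatives are unique almost everywhere
    ([weak_partial_unique], from the fundamental lemma of the calculus of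
    variations), so the formula holds for any weak gradient of the root and with
    any weak gradient of f j. *)

(** * Measures on spaces of matrices *)

Section matrix_measurability.
Context (R : realType) (m n : nat).
Let TR : measurableType _ := measurableTypeR R.
Local Notation M := 'M[R]_(m, n).

Lemma measurable_entry i j : measurable_fun [set: M] (fun X : M => X i j : TR).
Proof.
apply: (measurability _ (RGenOpens.measurableE R)) => //.
move=> _ [_ [a [b ->] <-]]; rewrite setTI; apply: sub_sigma_algebra => /=.
by apply: open_comp => [X _|]; [exact: coord_continuous|exact: interval_open].
Qed.

(** Such a map factors through mx_of_tuple, which is measurable. *)
Lemma measurable_mxP d (T : measurableType d) (f : T -> M) :
  (forall i j, measurable_fun setT (fun x => f x i j : TR)) ->
  measurable_fun setT f.
Proof.
move=> mf.
pose ix (k : 'I_(m * n)) := enum_val (cast_ord (esym (mxvec_cast m n)) k).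
pose t x : (m * n).-tuple TR := [tuple f x (ix k).1 (ix k).2 | k < m * n].
have -> : f = @mx_of_tuple R m n \o t.
  apply/funext => x; apply/matrixP => i j; rewrite !mxE tnth_mktuple.
  by rewrite /ix /mxvec_index cast_ordK enum_rankK.
apply: measurableT_comp; first exact: measurable_mx_of_tuple.
apply/measurable_fun_tnthP => k.
rewrite (_ : _ \o _ = (fun x => f x (ix k).1 (ix k).2)); first exact: mf.
by apply/funext => x /=; rewrite tnth_mktuple.
Qed.

Definition box (A : 'I_m -> 'I_n -> set TR) : set M :=
  [set X | forall i j, A i j (X i j)].

Lemma measurable_box A : (forall i j, measurable (A i j)) -> measurable (box A).
Proof.
move=> mA; rewrite (_ : box A = \bigcap_(ij in [set: 'I_m * 'I_n])
    ((fun X : M => X ij.1 ij.2) @^-1` A ij.1 ij.2)); last first.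
  apply/seteqP; split=> X /= XA; first by move=> ij _; exact: XA.
  by move=> i j; exact: (XA (i, j)).
apply: fin_bigcap_measurable; first exact: finite_finset.
by move=> [i j] _; rewrite -[X in measurable X]setTI; exact: measurable_entry.
Qed.

Lemma lebesgue_box A : (forall i j, measurable (A i j)) ->
  lebesgue_mx (box A) = (\prod_i \prod_j lebesgue_measure (A i j))%E.
Proof. exact: lebesgue_mx_box. Qed.

Definition cube (K : R) : set M := box (fun _ _ => `[- K, K]%classic).

Lemma measurable_cube K : measurable (cube K).
Proof. by apply: measurable_box => i j; exact: measurable_itv. Qed.

Lemma cubeP X : exists K : nat, cube K%:R X /\ forall i j, - K%:R < X i j < K%:R.
Proof.
pose b := \sum_i \sum_j `|X i j|.
suff H i j : `|X i j| < (Num.truncn b).+1%:R.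
  exists (Num.truncn b).+1; split => i j; rewrite /= ?in_itv/=.
    by rewrite -ler_norml ltW.
  by rewrite -ltr_norml.
apply: le_lt_trans (truncnS_gt b); rewrite /b (bigD1 i)//= (bigD1 j)//= -addrA lerDl addr_ge0//.
  by apply: sumr_ge0.
by apply: sumr_ge0 => k _; apply: sumr_ge0.
Qed.

Lemma bigcup_cube : \bigcup_k cube k%:R = [set: M].
Proof.
by apply/seteqP; split => // X _; have [K [QX _]] := cubeP X; exists K.
Qed.

Lemma box_setI A B : box A `&` box B = box (fun i j => A i j `&` B i j).
Proof.
apply/seteqP; split=> X /=; first by move=> [XA XB] i j; split; [exact: XA|exact: XB].
by move=> XAB; split=> i j; have [] := XAB i j.
Qed.

(** Open boxes form a pi-system that generates the Borel sets: the identity is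
    measurable from the sigma-algebra they generate, because its entries are. *)
Lemma measure_unique_itv (m1 m2 : {measure set M -> \bar R}) :
  (forall a b : 'I_m -> 'I_n -> R, m1 (box (fun i j => `]a i j, b i j[%classic)) =
     m2 (box (fun i j => `]a i j, b i j[%classic))) ->
  (forall K : nat, m1 (cube K%:R) < +oo)%E ->
  forall A, measurable A -> m1 A = m2 A.
Proof.
move=> m12 fin A mA.
pose obox (a b : 'I_m -> 'I_n -> R) := box (fun i j => `]a i j, b i j[%classic).
have mobox a b : measurable (obox a b) by apply: measurable_box => i j; exact: measurable_itv.
pose G : set (set M) := [set B | exists a b, B = obox a b].
apply: (measure_unique G (fun k => obox (fun _ _ => - k%:R) (fun _ _ => k%:R))) => //.
- apply/seteqP; split.
    pose S := g_sigma_algebraType G.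
    have mid : measurable_fun [set: S] (id : S -> M).
      apply: measurable_mxP => i j.
      apply: (measurability _ (RGenOpens.measurableE R)) => //.
      move=> _ [_ [a [b ->] <-]]; rewrite setTI.
      rewrite (_ : _ @^-1` _ = \bigcup_k obox
          (fun k' l => if (k' == i) && (l == j) then a else - k%:R)
          (fun k' l => if (k' == i) && (l == j) then b else k%:R)).
        apply: bigcupT_measurable => k; apply: sub_sigma_algebra.
        by eexists; eexists; reflexivity.
      apply/seteqP; split => [X Xab|X [k _ Xk]]; last by have := Xk i j; rewrite !eqxx.
      have [k [_ kX]] := cubeP X; exists k => // k' l /=.
      by case: ifPn => [/andP[/eqP-> /eqP->]//|_]; rewrite in_itv/= kX.
    by move=> B mB; have := mid measurableT B mB; rewrite setTI.
  apply: smallest_sub; first exact: sigma_algebra_measurable.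
  by move=> _ [a [b ->]]; exact: mobox.
- move=> _ _ [a [b ->]] [a' [b' ->]].
  exists (fun i j => Num.max (a i j) (a' i j)), (fun i j => Num.min (b i j) (b' i j)).
  rewrite /obox box_setI; congr box; apply/funext => i; apply/funext => j.
  apply/seteqP; split => x /=; rewrite !in_itv/= gt_max lt_min.
    by move=> [/andP[-> ->] /andP[-> ->]].
  by move=> /andP[/andP[-> ->] /andP[-> ->]].
- by move=> k; eexists; eexists; reflexivity.
- apply/seteqP; split => // X _; by have [k [_ kX]] := cubeP X; exists k.
- by move=> _ [a [b ->]]; exact: m12.
- move=> k; apply: le_lt_trans (fin k); apply: le_measure; rewrite ?inE//.
    exact: measurable_cube.
  by move=> X Xk i j /=; have := Xk i j; rewrite /= !in_itv/= => /andP[/ltW -> /ltW ->].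
Qed.

Lemma measure_unique_box (m1 m2 : {measure set M -> \bar R}) :
  (forall A, (forall i j, measurable (A i j)) -> m1 (box A) = m2 (box A)) ->
  (forall K : nat, m1 (cube K%:R) < +oo)%E ->
  forall A, measurable A -> m1 A = m2 A.
Proof.
by move=> m12; apply: measure_unique_itv => a b; apply: m12 => i j; exact: measurable_itv.
Qed.

Lemma lebesgue_seg (K : R) : 0 <= K ->
  lebesgue_measure (`[- K, K]%classic : set TR) = (K *+ 2)%:E.
Proof.
move=> K0; rewrite lebesgue_measure_itv/= lte_fin.
case: ltP => KK; first by rewrite -EFinD opprK.
have -> : K = 0 by lra.
by rewrite mul0rn.
Qed.

Lemma lebesgue_seg_lty (K : R) :
  (lebesgue_measure (`[(- K)%R, K]%classic : set TR) < +oo)%E.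
Proof.
rewrite lebesgue_measure_itv/=; case: ifP => _; last exact: ltry.
by rewrite -EFinD ltry.
Qed.

Lemma lebesgue_mx_cube_lty K : (lebesgue_mx (cube K) < +oo)%E.
Proof.
rewrite lebesgue_box//; apply: (le_lt_trans (lee_abs _)).
rewrite -fin_num_abs; apply: prode_fin_num => i _.
apply: prode_fin_num => j _; rewrite ge0_fin_numE//.
exact: lebesgue_seg_lty.
Qed.

Lemma lebesgue_mx_sigma_finite : sigma_finite [set: M] (@lebesgue_mx R m n).
Proof.
exists (fun k => cube k%:R); first by rewrite bigcup_cube.
by move=> k; split; [exact: measurable_cube|exact: lebesgue_mx_cube_lty].
Qed.

HB.instance Definition _ := @Measure_isSigmaFinite.Build _ _ _
  (@lebesgue_mx R m n) lebesgue_mx_sigma_finite.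

(** Lebesgue measure restricted to a cube and to a segment: the whole theory of
    weak derivatives below is local, and working with finite measures on full
    types avoids integration domains in the uses of Fubini's theorem. *)
Definition lcube K : {finite_measure set M -> \bar R} :=
  mfrestr (measurable_cube K) (lebesgue_mx_cube_lty K).

Definition lseg (K : R) : {finite_measure set TR -> \bar R} :=
  @mfrestr _ TR R `[- K, K]%classic (@lebesgue_measure R)
    (measurable_itv `[- K, K]) (lebesgue_seg_lty K).

Lemma lcubeE K A : lcube K A = lebesgue_mx (A `&` cube K).
Proof. by []. Qed.

Lemma lsegE K A : lseg K A = lebesgue_measure (A `&` `[- K, K]%classic).
Proof. by []. Qed.

End matrix_measurability.

Section restricted_measure.
Context d (T : measurableType d) (R : realType).
Variables (mu : {measure set T -> \bar R}) (D : set T) (mD : measurable D).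
Variables (muD : (mu D < +oo)%E).
Local Notation muR := (mfrestr mD muD).

Lemma mfrestrCD : muR (~` D) = 0%E.
Proof. by rewrite /mfrestr /mrestr setICl measure0. Qed.

Lemma ae_mfrestrD : {ae muR, forall x, D x}.
Proof. by exists (~` D); split=> //; [exact: measurableC|exact: mfrestrCD]. Qed.

Lemma integral_mfrestr (f : T -> \bar R) : measurable_fun setT f ->
  (\int[muR]_x f x = \int[mu]_(x in D) f x)%E.
Proof.
move=> mf; rewrite [RHS](eq_measure_integral muR); last first.
  by move=> A mA AD; rewrite /= /mfrestr /mrestr setIidl.
rewrite [RHS]integral_mkcond; apply: ae_eq_integral => //.
  by apply/(measurable_restrictT _ _).1 => //; exact: measurable_funTS.
by apply: filterS ae_mfrestrD => x /= Dx _; rewrite patchE mem_set.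
Qed.

Lemma integrable_mfrestr (f : T -> \bar R) : measurable_fun setT f ->
  muR.-integrable setT f <-> mu.-integrable D f.
Proof.
move=> mf; have maf : measurable_fun setT (abse \o f) by exact: measurableT_comp.
split=> /integrableP[mfD fi]; apply/integrableP; split=> //.
- exact: measurable_funTS.
- by rewrite -integral_mfrestr.
- by rewrite integral_mfrestr.
Qed.

Lemma ae_mfrestr (P : T -> Prop) :
  {ae muR, forall x, P x} <-> {ae mu, forall x, D x -> P x}.
Proof.
split=> [[N [mN N0 NP]]|[N [mN N0 NP]]].
  exists (N `&` D); split=> //; first exact: measurableI.
  move=> x /= /not_implyP[Dx nPx]; split=> //; exact: NP.
exists (N `|` ~` D); split.
- by apply: measurableU => //; exact: measurableC.
- rewrite /mfrestr /mrestr setIUl setICl setU0.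
  by apply: subset_measure0 N0 => //; exact: measurableI.
- move=> x /= nPx; have [Dx|] := pselect (D x); last by right.
  by left; apply: NP => /=; apply/not_implyP.
Qed.
End restricted_measure.

Section density_measure.
Context d (T : measurableType d) (R : realType).
Variables (mu : {measure set T -> \bar R}) (f : T -> R).
Hypotheses (mf : measurable_fun setT f) (f0 : forall x, 0 <= f x).

(** The two proofs are arguments of the definition, so that the measure
    structure declared below can be inferred from them. *)
Definition mdensity of measurable_fun setT f & (forall x, 0 <= f x) :
  set T -> \bar R := fun A => (\int[mu]_(x in A) (f x)%:E)%E.

Local Notation mdens := (mdensity mf f0).

Let mdens0 : mdens set0 = 0%E.
Proof. exact: integral_set0. Qed.

Let mdens_ge0 A : (0 <= mdens A)%E.
Proof. by apply: integral_ge0 => x _; rewrite lee_fin. Qed.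

Let mdens_sigma_additive : semi_sigma_additive mdens.
Proof.
move=> A mA tA mUA; rewrite /mdensity ge0_integral_bigcup//; last 2 first.
- by apply: measurable_funTS; exact/measurable_EFinP.
- by move=> x _; rewrite lee_fin.
apply: is_cvg_ereal_nneg_natsum_cond => n _ _.
by apply: integral_ge0 => x _; rewrite lee_fin.
Qed.

HB.instance Definition _ := isMeasure.Build _ _ _ mdens
  mdens0 mdens_ge0 mdens_sigma_additive.

End density_measure.

Section slice.
Context (R : realType) (m n : nat) (i : 'I_m) (j : 'I_n).
Let TR : measurableType _ := measurableTypeR R.
Local Notation M := 'M[R]_(m, n).

Definition upd (X : M) (t : R) : M :=
  \matrix_(k, l) if (k == i) && (l == j) then t else X k l.

Lemma upd_same X t : upd X t i j = t.
Proof. by rewrite mxE !eqxx. Qed.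

Lemma upd_upd X s t : upd (upd X s) t = upd X t.
Proof. by apply/matrixP => k l; rewrite !mxE; case: ifP => // ->. Qed.

Lemma upd_id X : upd X (X i j) = X.
Proof. by apply/matrixP => k l; rewrite !mxE; case: ifP => // /andP[/eqP-> /eqP->]. Qed.

Definition updp (p : M * TR) : M := upd p.1 p.2.

Lemma measurable_updp : measurable_fun setT updp.
Proof.
apply: measurable_mxP => k l.
have [kl|kl] := boolP ((k == i) && (l == j)).
  rewrite (_ : (fun _ => _) = snd); first exact: measurable_snd.
  by apply/funext => x; rewrite mxE kl.
rewrite (_ : (fun _ => _) = (fun X : M => X k l : TR) \o fst); last first.
  by apply/funext => x; rewrite mxE (negbTE kl).
by apply: measurableT_comp; [exact: measurable_entry|exact: measurable_fst].
Qed.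

HB.instance Definition _ := isMeasurableFun.Build _ _ _ _ updp measurable_updp.

(** Replacing one entry of a uniform point of the cube by an independent uniform
    entry yields a uniform point of the cube. This is how Fubini's theorem
    along the lines parallel to the (i, j)-axis is expressed here, without
    splitting the type of matrices into a product. *)
Lemma slice_measure (K : R) (K0 : 0 <= K) A : measurable A ->
  (lcube m n K \x lseg K)%E (updp @^-1` A) =
  ((K *+ 2)%:E * lcube m n K A)%E.
Proof.
have K20 : 0 <= K *+ 2 by rewrite mulrn_wge0.
pose m1 : {measure set M -> \bar R} := image_measure (lcube m n K \x lseg K)%E updp.
pose m2 : {measure set M -> \bar R} := mscale (NngNum K20) (lcube m n K).
move=> mA; rewrite -[LHS]/(m1 A) -[RHS]/(m2 A).
apply: measure_unique_box mA => [B mB|k].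
  pose B' k l := if (k == i) && (l == j) then setT else B k l.
  have mB' k l : measurable (B' k l) by rewrite /B'; case: ifP.
  have updB : updp @^-1` box B = box B' `*` B i j.
    apply/seteqP; split => -[X t] /=.
      move=> H; split=> /= [k l|]; last by have := H i j; rewrite upd_same.
      by have := H k l; rewrite mxE /B'; case: ifP.
    move=> [/= XB' tB] k l; rewrite mxE; have := XB' k l; rewrite /B'.
    by case: ifP => // /andP[/eqP -> /eqP ->].
  transitivity (lebesgue_mx (box B' `&` cube K) *
      lebesgue_measure (B i j `&` `[(- K)%R, K]%classic))%E.
    rewrite -[LHS]/((lcube m n K \x lseg K)%E (updp @^-1` box B)) updB.
    by have := product_measure1E (lcube m n K) (lseg K) (measurable_box mB') (mB i j).
  transitivity ((K *+ 2)%:E * lebesgue_mx (box B `&` cube K))%E; last by [].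
  rewrite /cube !box_setI !lebesgue_box//; last 2 first.
    by move=> k l; exact: measurableI.
    by move=> k l; exact: measurableI.
  rewrite !(pair_bigA _ (fun k l => lebesgue_measure _))/=.
  rewrite (bigD1 (i, j))//= [in RHS](bigD1 (i, j))//=.
  rewrite {1}/B' !eqxx/= setTI lebesgue_seg// -!muleA; congr (_ * _)%E.
  rewrite muleC; congr (_ * _)%E; apply: eq_bigr => -[k l] /=.
  by rewrite xpair_eqE /B' => /negbTE ->.
apply: (@le_lt_trans _ _ (m1 setT)).
  by apply: le_measure; rewrite ?inE//; exact: measurable_cube.
have -> : m1 setT = (lcube m n K setT * lseg K setT)%E.
  have := product_measure1E (lcube m n K) (lseg K) measurableT measurableT.
  by rewrite setXTT.
rewrite lcubeE lsegE !setTI lte_mul_pinfty//; last exact: lebesgue_seg_lty.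
by rewrite ge0_fin_numE// lebesgue_mx_cube_lty.
Qed.

Lemma ge0_slice (K : R) (F : M -> \bar R) : 0 <= K ->
  measurable_fun setT F -> (forall X, 0 <= F X)%E ->
  (\int[lcube m n K]_X \int[lseg K]_t F (upd X t) =
   (K *+ 2)%:E * \int[lcube m n K]_X F X)%E.
Proof.
move=> K0 mF F0; have K20 : 0 <= K *+ 2 by rewrite mulrn_wge0.
have <- := ge0_integral_mscale (lcube m n K) measurableT (NngNum K20) mF (fun X _ => F0 X).
have -> : (\int[mscale (NngNum K20) (lcube m n K)]_X F X =
    \int[pushforward (lcube m n K \x lseg K)%E updp]_X F X)%E.
  by apply: eq_measure_integral => A mA _; exact/esym/slice_measure.
rewrite ge0_integral_pushforward//.
apply/esym/(fubini_tonelli1 (F \o updp)) => [|p]; last exact: F0.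
exact: measurableT_comp.
Qed.

Lemma integrable_slice (K : R) (F : M -> \bar R) : 0 <= K ->
  (lcube m n K).-integrable setT F ->
  (lcube m n K \x lseg K)%E.-integrable setT (F \o updp).
Proof.
move=> K0 /integrableP[mF iF].
have mFu : measurable_fun setT (F \o updp) by exact: measurableT_comp.
apply/(integrable12ltyP (lcube m n K) (lseg K) mFu).
have mA : measurable_fun setT (abse \o F) by exact: measurableT_comp.
have := ge0_slice K0 mA (fun X => abse_ge0 _).
by move=> /= ->; rewrite lte_mul_pinfty// lee_fin mulrn_wge0.
Qed.

Lemma integral_slice (K : R) (F : M -> \bar R) : 0 <= K ->
  (lcube m n K).-integrable setT F ->
  (\int[lcube m n K]_X \int[lseg K]_t F (upd X t) =
   (K *+ 2)%:E * \int[lcube m n K]_X F X)%E.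
Proof.
move=> K0 iF; have mF := measurable_int _ iF; have K20 : 0 <= K *+ 2 by rewrite mulrn_wge0.
rewrite (integral12_prod_meas1 (integrable_slice K0 iF))//.
have -> : (\int[lcube m n K \x lseg K]_z (F \o updp) z =
    \int[mscale (NngNum K20) (lcube m n K)]_X F X)%E.
  transitivity (\int[pushforward (lcube m n K \x lseg K)%E updp]_X F X)%E.
    rewrite integral_pushforward// preimage_setT.
    exact: integrable_slice.
  by apply: eq_measure_integral => A mA _; exact: slice_measure.
rewrite integralE [in RHS]integralE !ge0_integral_mscale//=.
- rewrite [RHS]muleBr//.
  apply: fin_num_adde_defl; rewrite fin_numN; apply: integrable_fin_num => //.
  exact: integrable_funeneg.
- exact: measurable_funeneg.
- exact: measurable_funepos.
Qed.

Lemma ae_slice (K : R) (P : M -> Prop) : 0 <= K ->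
  {ae lcube m n K, forall X, P X} ->
  {ae lcube m n K, forall X, {ae lseg K, forall t, P (upd X t)}}.
Proof.
move=> K0 [A [mA A0 PA]].
have m1A : measurable_fun setT (EFin \o \1_A : M -> \bar R).
  by apply/measurable_EFinP; exact: measurable_indic.
have F0 X : (0 <= (EFin \o \1_A : M -> \bar R) X)%E by rewrite lee_fin.
have := ge0_slice K0 m1A F0; rewrite [X in (_ * X)%E]integral_indic// setIT [X in (_ * X)%E]A0 mule0.
pose G X := (\int[lseg K]_t (\1_A (upd X t))%:E)%E.
have mG : measurable_fun setT G.
  apply: (measurable_fun_fubini_tonelli_F (EFin \o \1_A \o updp)) => [|p].
    by apply: (@measurableT_comp _ _ _ _ _ _ (EFin \o \1_A)).
  exact: F0.
have G0 X : (0 <= G X)%E by apply: integral_ge0 => t _; rewrite lee_fin.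
move=> intG; have : (\int[lcube m n K]_X `|G X|)%E = 0%E.
  by rewrite -[RHS]intG; apply: eq_integral => X _; rewrite gee0_abs.
move/(ae_eq_integral_abs (lcube m n K) measurableT mG); apply: filterS => X /(_ I) GX0.
have mAX : measurable_fun setT (fun t => (\1_A (upd X t))%:E : \bar R).
  apply: (@measurableT_comp _ _ _ _ _ _ (EFin \o \1_A)) => //.
  exact: (measurableT_comp measurable_updp (pair1_measurable X)).
have : (\int[lseg K]_t `|(\1_A (upd X t))%:E|)%E = 0%E.
  by rewrite -[RHS]GX0; apply: eq_integral => t _; rewrite gee0_abs// lee_fin.
move/(ae_eq_integral_abs (lseg K) measurableT mAX); apply: filterS => t /(_ I) /=.
move=> [] A1; apply: contrapT => nP; move: A1.
by rewrite indicE mem_set ?oner_eq0//; [move/eqP; rewrite oner_eq0|exact: PA].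
Qed.

End slice.

(** * Integrals of products over entries and rows *)

Section tuple_product.
Context (R : realType).
Let TR : measurableType _ := measurableTypeR R.

Lemma lebesgue_tuple_sigma_finite n :
  sigma_finite [set: n.-tuple TR] (lebesgue_tuple R n).
Proof.
exists (fun k => [set t : n.-tuple TR | forall i, `[- k%:R, k%:R]%classic (tnth t i)]).
  apply/seteqP; split => // t _.
  exists (Num.truncn (\sum_i `|tnth t i : R|)).+1 => // i /=.
  rewrite in_itv/= -ler_norml; apply: le_trans (ltW (truncnS_gt _)).
  by rewrite (bigD1 i)//= lerDl sumr_ge0.
move=> k; split.
  rewrite (_ : [set t : n.-tuple TR | _] = \bigcap_(i in [set: 'I_n])
      ((fun t : n.-tuple TR => tnth t i) @^-1` `[- k%:R, k%:R]%classic)); last first.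
    by apply/seteqP; split=> t /= tk i; [move=> _|]; exact: tk.
  apply: fin_bigcap_measurable => [|i _]; first exact: finite_finset.
  rewrite -[X in measurable X]setTI; apply: measurable_tnth => //.
rewrite (@lebesgue_tuple_box R n (fun=> `[- k%:R, k%:R]%classic))//; apply: (le_lt_trans (lee_abs _)).
rewrite -fin_num_abs; apply: prode_fin_num => i _.
by rewrite ge0_fin_numE//; exact: lebesgue_seg_lty.
Qed.

(** The fixpoint lebesgue_tuple returns a bundled measure; the
    sigma-finiteness needed by Tonelli's theorem is attached to this alias of
    the underlying set function. *)
Definition ltuple n : set (n.-tuple TR) -> \bar R := lebesgue_tuple R n.

HB.instance Definition _ n := Measure.on (@ltuple n).

HB.instance Definition _ n := @Measure_isSigmaFinite.Build _ _ _
  (@ltuple n) (@lebesgue_tuple_sigma_finite n).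

Lemma measurable_eprod d (T : measurableType d) I (s : seq I) (F : I -> T -> \bar R) :
  (forall i, measurable_fun setT (F i)) ->
  measurable_fun setT (fun x => \prod_(i <- s) F i x)%E.
Proof.
move=> mF; elim: s => [|a s IH].
  by under eq_fun do rewrite big_nil; exact: measurable_cst.
by under eq_fun do rewrite big_cons; exact: emeasurable_funM.
Qed.

Lemma integral_tuple_prod n (g : 'I_n -> TR -> \bar R) :
  (forall i, measurable_fun setT (g i)) -> (forall i x, 0 <= g i x)%E ->
  (\int[lebesgue_tuple R n]_t \prod_(i < n) g i (tnth t i) =
   \prod_(i < n) \int[lebesgue_measure]_x g i x)%E.
Proof.
elim: n g => [|n IH] g mg g0.
  rewrite big_ord0; under eq_integral do rewrite big_ord0.
  by rewrite integral_cst//= mul1e diracT.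
have mpr k (h : 'I_k -> TR -> \bar R) : (forall i, measurable_fun setT (h i)) ->
    measurable_fun setT (fun t : k.-tuple TR => \prod_(i < k) h i (tnth t i))%E.
  move=> mh; apply: measurable_eprod => i.
  by apply: measurableT_comp => //; exact: measurable_tnth.
have pr0 k (h : 'I_k -> TR -> \bar R) (t : k.-tuple TR) :
  (forall i x, 0 <= h i x)%E -> (0 <= \prod_(i < k) h i (tnth t i))%E.
  by move=> h0; apply: prode_ge0.
transitivity (\int[lebesgue_measure \x^ lebesgue_tuple R n]_p
    \prod_(i < n.+1) g i (tnth (tuple_consp p) i))%E.
  apply: (ge0_integral_pushforward (@measurable_tuple_consp R n)) => //.
    exact: mpr.
  by move=> t _; exact: pr0.
under eq_integral do rewrite big_ord_recl.
transitivity (\int[lebesgue_measure \x @ltuple n]_p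
  (g ord0 p.1 * \prod_(i < n) g (lift ord0 i) (tnth p.2 i)))%E.
  rewrite [LHS](eq_measure_integral (lebesgue_measure \x @ltuple n)%E); last first.
    move=> A mA _; apply/esym; apply: product_measure_unique => // B C mB mC.
    exact: (product_measure2E lebesgue_measure (lebesgue_tuple R n) mB mC).
  apply: eq_integral => -[x t] _ /=; rewrite (tnth_nth x)/=; congr (_ * _)%E.
  by apply: eq_bigr => i _; rewrite tnthS.
rewrite fubini_tonelli1//=; last 2 first.
- apply: emeasurable_funM; first exact: measurableT_comp.
  apply: (measurableT_comp (mpr _ (fun i => g (lift ord0 i)) _)) => // i.
- by move=> p; rewrite mule_ge0//; exact: (pr0 _ (fun i => g (lift ord0 i))).
rewrite big_ord_recl -IH// /fubini_F/=.
have mP := mpr _ (fun i => g (lift ord0 i)) (fun i => mg _).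
rewrite -ge0_integralZr//; last first.
  by apply: integral_ge0 => t _; exact: (pr0 _ (fun i => g (lift ord0 i))).
apply: eq_integral => x _; rewrite -ge0_integralZl// => t _.
exact: (pr0 _ (fun i => g (lift ord0 i))).
Qed.

Lemma integral_mx_entries m n (g : 'I_m -> 'I_n -> TR -> \bar R) :
  (forall i j, measurable_fun setT (g i j)) -> (forall i j x, 0 <= g i j x)%E ->
  (\int[@lebesgue_mx R m n]_X \prod_i \prod_j g i j (X i j) =
   \prod_i \prod_j \int[lebesgue_measure]_x g i j x)%E.
Proof.
move=> mg g0.
have mG : measurable_fun setT (fun X : 'M[R]_(m, n) => \prod_i \prod_j g i j (X i j))%E.
  apply: measurable_eprod => i; apply: measurable_eprod => j.
  exact: (measurableT_comp (mg i j) (measurable_entry i j)).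
transitivity (\int[lebesgue_tuple R (m * n)]_t
    \prod_i \prod_j g i j (mx_of_tuple t i j))%E.
  apply: (ge0_integral_pushforward (@measurable_mx_of_tuple R m n)) => //.
  by move=> X _; apply: prode_ge0 => i _; exact: prode_ge0.
pose h k := let ij := enum_val (cast_ord (esym (mxvec_cast m n)) k) in g ij.1 ij.2.
have hE i j : h (mxvec_index i j) = g i j.
  by rewrite /h /mxvec_index cast_ordK enum_rankK.
have reidx (F : 'I_(m * n) -> \bar R) :
    (\prod_k F k = \prod_i \prod_j F (mxvec_index i j))%E.
  rewrite [RHS]pair_bigA/= (reindex _ (curry_mxvec_bij m n))/=.
  by apply: eq_bigr => -[].
transitivity (\int[lebesgue_tuple R (m * n)]_t \prod_k h k (tnth t k))%E.
  apply: eq_integral => t _ /=; rewrite reidx.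
  by apply: eq_bigr => i _; apply: eq_bigr => j _; rewrite hE mxE.
rewrite integral_tuple_prod//; last 2 first.
- by move=> k; exact: mg.
- by move=> k x; exact: g0.
by rewrite reidx; apply: eq_bigr => i _; apply: eq_bigr => j _; rewrite hE.
Qed.

End tuple_product.

Section row_product.
Context (R : realType).
Let TR : measurableType _ := measurableTypeR R.

Definition stack m n (p : 'rV[R]_n * 'M[R]_(m, n)) : 'M[R]_(m.+1, n) :=
  \matrix_(k, l) if unlift ord0 k is Some k' then p.2 k' l else p.1 ord0 l.

Lemma measurable_stack m n : measurable_fun setT (@stack m n).
Proof.
apply: measurable_mxP => k l; case: (unliftP ord0 k) => [k' ->|->].
  rewrite (_ : (fun _ => _) = (fun X : 'M[R]_(m, n) => X k' l : TR) \o snd).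
    by apply: measurableT_comp; [exact: measurable_entry|exact: measurable_snd].
  by apply/funext => p; rewrite mxE liftK.
rewrite (_ : (fun _ => _) = (fun X : 'rV[R]_n => X ord0 l : TR) \o fst).
  by apply: measurableT_comp; [exact: measurable_entry|exact: measurable_fst].
by apply/funext => p; rewrite mxE unlift_none.
Qed.

HB.instance Definition _ m n :=
  isMeasurableFun.Build _ _ _ _ (@stack m n) (@measurable_stack m n).

Lemma row_stack0 m n p : row ord0 (@stack m n p) = p.1.
Proof. by apply/rowP => l; rewrite !mxE unlift_none. Qed.

Lemma row_stackS m n p k : row (lift ord0 k) (@stack m n p) = row k p.2.
Proof. by apply/rowP => l; rewrite !mxE liftK. Qed.

(** Both measures agree on boxes. This isolates the first row, for inductions
    on the number of rows. *)
Lemma stack_measure m n (A : set 'M[R]_(m.+1, n)) : measurable A ->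
  (@lebesgue_mx R 1 n \x @lebesgue_mx R m n)%E (@stack m n @^-1` A) =
  lebesgue_mx A.
Proof.
pose m1 : {measure set 'M[R]_(m.+1, n) -> \bar R} :=
  image_measure (@lebesgue_mx R 1 n \x @lebesgue_mx R m n)%E (@stack m n).
move=> mA; rewrite -[LHS]/(m1 A).
have boxE B : (forall i j, measurable (B i j)) -> m1 (box B) = lebesgue_mx (box B).
  move=> mB; rewrite -[LHS]/((_ \x _)%E (@stack m n @^-1` box B)).
  have -> : @stack m n @^-1` box B =
      box (fun _ : 'I_1 => B ord0) `*` box (fun k => B (lift ord0 k)).
    apply/seteqP; split => -[x X] /=.
      move=> H; split => [k l|k l]; first by have := H ord0 l; rewrite !ord1 mxE unlift_none.
      by have := H (lift ord0 k) l; rewrite mxE liftK.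
    move=> [/= Hx HX] k l; rewrite mxE; case: (unliftP ord0 k) => [k' ->|->]; last exact: Hx.
    exact: HX.
  rewrite (product_measure1E _ _ (measurable_box _) (measurable_box _))//.
  transitivity (@lebesgue_mx R 1 n (box (fun=> B ord0)) *
      lebesgue_mx (box (fun k => B (lift ord0 k))))%E; first by [].
  rewrite !lebesgue_box//.
  by rewrite [RHS]big_ord_recl big_ord_recl big_ord0 mule1.
apply: measure_unique_box mA => // K.
by rewrite boxE; [exact: lebesgue_mx_cube_lty|move=> i j; exact: measurable_itv].
Qed.

Lemma integral_mx_rows m n (h : 'I_m -> 'rV[R]_n -> \bar R) :
  (forall k, measurable_fun setT (h k)) -> (forall k x, 0 <= h k x)%E ->
  (\int[@lebesgue_mx R m n]_X \prod_k h k (row k X) =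
   \prod_k \int[@lebesgue_mx R 1 n]_x h k x)%E.
Proof.
have mpr k (g : 'I_k -> 'rV[R]_n -> \bar R) : (forall i, measurable_fun setT (g i)) ->
    measurable_fun setT (fun X : 'M[R]_(k, n) => \prod_(i < k) g i (row i X))%E.
  by move=> mg; apply: measurable_eprod => i; exact: measurableT_comp.
elim: m h => [|m IH] h mh h0.
  rewrite big_ord0; under eq_integral do rewrite big_ord0.
  rewrite integral_cst// mul1e.
  have := @lebesgue_mx_box R 0 n (fun _ _ => setT) (fun _ _ => measurableT).
  rewrite big_ord0 => <-; congr lebesgue_mx; apply/seteqP; split => // X _.
transitivity (\int[pushforward (@lebesgue_mx R 1 n \x @lebesgue_mx R m n)%E (@stack m n)]_X
    \prod_k h k (row k X))%E.
  by apply: eq_measure_integral => A mA _; exact/esym/stack_measure.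
transitivity (\int[@lebesgue_mx R 1 n \x @lebesgue_mx R m n]_p
    (h ord0 p.1 * \prod_k h (lift ord0 k) (row k p.2)))%E.
  rewrite (ge0_integral_pushforward (@measurable_stack m n))//.
  - apply: eq_integral => p _ /=; rewrite big_ord_recl row_stack0; congr (_ * _)%E.
    by apply: eq_bigr => k _; rewrite row_stackS.
  - exact: mpr.
  - by move=> X _; exact: prode_ge0.
rewrite [LHS](fubini_tonelli1 _)/=; last 2 first.
- apply: emeasurable_funM; first exact: measurableT_comp.
  exact: (measurableT_comp (mpr _ (fun i => h (lift ord0 i)) _)).
- by move=> p; rewrite mule_ge0// prode_ge0.
rewrite big_ord_recl -IH// /fubini_F/=.
have mP := mpr _ (fun i => h (lift ord0 i)) (fun i => mh _).
rewrite -ge0_integralZr//; last by apply: integral_ge0 => X _; exact: prode_ge0.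
by apply: eq_integral => x _; rewrite -ge0_integralZl// => X _; exact: prode_ge0.
Qed.
End row_product.

(** * Integrals of real-valued functions *)

Local Notation Int mu f := (integrable mu setT (EFin \o f)).

Section real_integrals.
Context d (T : measurableType d) (R : realType).
Variable mu : {measure set T -> \bar R}.
Implicit Types f g h : T -> R.

(** Instances of general filter lemmas in which the filter is fixed by the
    measure, so that it is not left to unification. *)
Lemma aeT (P : T -> Prop) : (forall x, P x) -> {ae mu, forall x, P x}.
Proof. exact: aeW. Qed.

Lemma aeS (P Q : T -> Prop) : (forall x, P x -> Q x) ->
  {ae mu, forall x, P x} -> {ae mu, forall x, Q x}.
Proof. exact: filterS. Qed.

Lemma aeS2 (P Q W : T -> Prop) : (forall x, P x -> Q x -> W x) ->
  {ae mu, forall x, P x} -> {ae mu, forall x, Q x} -> {ae mu, forall x, W x}.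
Proof. exact: filterS2. Qed.

Lemma Int_meas f : Int mu f -> measurable_fun setT f.
Proof. by move=> /measurable_int/measurable_EFinP. Qed.

Lemma Int_le f g : Int mu f -> measurable_fun setT g ->
  {ae mu, forall x, `|g x| <= f x} -> Int mu g.
Proof.
move=> intf mg gf; apply/integrableP; split; first exact/measurable_EFinP.
have mf := Int_meas intf.
case/integrableP : intf => _; apply: le_lt_trans.
apply: ae_ge0_le_integral => //=.
- by apply/measurable_EFinP; exact: measurableT_comp.
- by apply/measurable_EFinP; exact: measurableT_comp.
apply: filterS gf => x gfx _ /=.
by rewrite lee_fin (le_trans gfx)// ler_norm.
Qed.

Lemma IntZ r f : Int mu f -> Int mu (fun x => r * f x).
Proof.
move=> intf; apply: (eq_integrable measurableT (fun x => r%:E * (EFin \o f) x)%E) => //.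
exact: integrableZl.
Qed.

Lemma IntD f g : Int mu f -> Int mu g -> Int mu (fun x => f x + g x).
Proof.
move=> intf intg.
apply: (eq_integrable measurableT ((EFin \o f) \+ (EFin \o g))%E) => //.
exact: integrableD.
Qed.

Lemma IntN f : Int mu f -> Int mu (fun x => - f x).
Proof.
move=> /(IntZ (-1)); apply: (eq_integrable measurableT) => // x _ /=.
by rewrite mulN1r.
Qed.

Lemma IntB f g : Int mu f -> Int mu g -> Int mu (fun x => f x - g x).
Proof. by move=> intf /IntN; exact: IntD. Qed.

Lemma Int_norm f : Int mu f -> Int mu (fun x => `|f x|).
Proof. by move=> /integrable_abse; apply: eq_integrable. Qed.

Lemma IntM_bnd B f h : Int mu f -> measurable_fun setT h ->
  {ae mu, forall x, `|h x| <= B} -> Int mu (fun x => f x * h x).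
Proof.
move=> intf mh hB; apply: (@Int_le (fun x => B * `|f x|)).
- exact/IntZ/Int_norm.
- by apply: measurable_funM => //; exact: Int_meas.
by apply: filterS hB => x hB; rewrite normrM mulrC ler_wpM2r.
Qed.

Lemma Int_ae f g : Int mu f -> measurable_fun setT g ->
  {ae mu, forall x, f x = g x} -> Int mu g.
Proof.
move=> intf mg fg; apply: (Int_le (Int_norm intf) mg).
by apply: filterS fg => x ->.
Qed.

Lemma Rint_ae f g : measurable_fun setT f -> measurable_fun setT g ->
  {ae mu, forall x, f x = g x} -> \int[mu]_x f x = \int[mu]_x g x.
Proof.
move=> mf mg fg; rewrite /Rintegral; congr fine; apply: ae_eq_integral => //.
- exact/measurable_EFinP.
- exact/measurable_EFinP.
by apply: filterS fg => x + _ => ->.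
Qed.

Lemma RintE f : Int mu f -> (\int[mu]_x (f x)%:E = (\int[mu]_x f x)%:E)%E.
Proof. by move=> intf; rewrite /Rintegral fineK//; exact: integrable_fin_num. Qed.

(** An integrable function is finite almost everywhere. *)
Lemma Int_fine (F : T -> \bar R) : mu.-integrable setT F ->
  Int mu (fine \o F) /\ \int[mu]_x fine (F x) = fine (\int[mu]_x F x)%E.
Proof.
move=> iF; have mF := measurable_int _ iF.
have mf : measurable_fun setT (EFin \o (fine \o F)).
  by apply/measurable_EFinP; exact: (measurableT_comp (fine_measurable measurableT) mF).
have eF : ae_eq mu setT (EFin \o (fine \o F)) F.
  apply: filterS (integrable_ae measurableT iF) => x + _ => /(_ I) Fx /=.
  by rewrite fineK.
split; last by rewrite /Rintegral; congr fine; exact: ae_eq_integral.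
case/integrableP : iF => _ iF; apply/integrableP; split => //.
rewrite (ae_eq_integral (abse \o F)) //; [exact: measurableT_comp|exact: measurableT_comp|].
by apply: filterS eF => x + _ => /(_ I) /= {2}<-.
Qed.

Lemma ge0_Int f : measurable_fun setT f -> (forall x, 0 <= f x) ->
  (\int[mu]_x (f x)%:E < +oo)%E -> Int mu f.
Proof.
move=> mf f0 foo; apply/integrableP; split; first exact/measurable_EFinP.
by under eq_integral do rewrite /= ger0_norm//.
Qed.

End real_integrals.

Section real_fubini.
Context d1 d2 (T1 : measurableType d1) (T2 : measurableType d2) (R : realType).
Variables (m1 : {sigma_finite_measure set T1 -> \bar R}).
Variables (m2 : {sigma_finite_measure set T2 -> \bar R}).
Variable f : T1 * T2 -> R.
Hypothesis intf : Int (m1 \x m2)%E f.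

Lemma ae_Int1 : {ae m1, forall x, Int m2 (fun y => f (x, y))}.
Proof. exact: (ae_integrable1 intf). Qed.

Lemma Rfubini1 : Int m1 (fun x => \int[m2]_y f (x, y)) /\
  \int[m1]_x \int[m2]_y f (x, y) = \int[(m1 \x m2)%E]_z f z.
Proof.
have [? ->] := Int_fine (integrable_fubini_F intf).
by split => //; rewrite (integral12_prod_meas1 intf).
Qed.

Lemma Rfubini2 : Int m2 (fun y => \int[m1]_x f (x, y)) /\
  \int[m2]_y \int[m1]_x f (x, y) = \int[(m1 \x m2)%E]_z f z.
Proof.
have mf := measurable_int _ intf.
have iG : m2.-integrable setT (fubini_G m1 (EFin \o f)).
  have mG := measurable_fubini_G intf.
  apply/integrableP; split => //.
  have /(integrable21ltyP m1 m2 mf) := intf; apply: le_lt_trans.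
  apply: ge0_le_integral => //.
  - exact: measurableT_comp.
  - apply: (measurable_fun_fubini_tonelli_G (abse \o (EFin \o f))) => //.
    exact: measurableT_comp.
  - by move=> p; exact: abse_ge0.
  - move=> y _; apply: le_abse_integral => //.
    exact: (measurable_fun_pair1 y mf).
have [? ->] := Int_fine iG.
by split => //; rewrite (integral21_prod_meas1 intf).
Qed.

End real_fubini.

Section finite_product.
Context d1 d2 (T1 : measurableType d1) (T2 : measurableType d2) (R : realType).
Variables (m1 : {finite_measure set T1 -> \bar R}).
Variables (m2 : {finite_measure set T2 -> \bar R}).

Lemma Int_snd (g : T2 -> R) : Int m2 g -> Int (m1 \x m2)%E (fun p => g p.2).
Proof.
move=> intg; have mg := Int_meas intg.
have mg2 : measurable_fun setT (fun p : T1 * T2 => (g p.2)%:E).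
  by apply/measurable_EFinP; exact: (measurableT_comp mg measurable_snd).
apply/(integrable12ltyP m1 m2 mg2) => /=.
rewrite integral_cst//= lte_mul_pinfty//.
- exact: integral_ge0.
- by apply: integrable_fin_num => //; exact: (Int_norm intg).
- by rewrite -ge0_fin_numE// fin_num_measure.
Qed.

Lemma ae_fst (P : T1 -> Prop) : {ae m1, forall x, P x} ->
  {ae (m1 \x m2)%E, forall p, P p.1}.
Proof.
move=> [N [mN N0 NP]]; exists (N `*` setT); split.
- exact: measurableX.
- have := product_measure1E m1 m2 mN measurableT.
  by rewrite /= N0 mul0e.
- by move=> -[x y] /= nP; split => //; exact: NP.
Qed.

Lemma ae_snd (P : T2 -> Prop) : {ae m2, forall x, P x} ->
  {ae (m1 \x m2)%E, forall p, P p.2}.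
Proof.
move=> [N [mN N0 NP]]; exists (setT `*` N); split.
- exact: measurableX.
- have := product_measure1E m1 m2 measurableT mN.
  by rewrite /= N0 mule0.
- by move=> -[x y] /= nP; split => //; exact: NP.
Qed.

End finite_product.

(** * Calculus on a segment *)

Section segment.
Context (R : realType).
Let TR : measurableType _ := measurableTypeR R.

Lemma ae_seg (K : R) (P : R -> Prop) : (forall t : R, - K <= t <= K -> P t) ->
  {ae lseg K, forall t, P t}.
Proof.
move=> HP; exists (~` `[- K, K]%classic); split.
- by apply: measurableC; exact: measurable_itv.
- by rewrite lsegE setICl measure0.
- by move=> t /= nP; apply: contra_not nP; rewrite in_itv/=; exact: HP.
Qed.

(** Asking for differentiability at the end points too spares one-sided limits. *)
Lemma RintFTC (f F : R -> R) (a b : R) : a <= b ->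
  (forall x : R, a <= x <= b -> {for x, continuous f}) ->
  (forall x : R, a <= x <= b -> is_derive x 1 F (f x)) ->
  \int[lebesgue_measure]_(x in `[a, b]) f x = F b - F a.
Proof.
rewrite le_eqVlt => /predU1P[<- _ _|ab cf dF].
  by rewrite set_itv1 Rintegral_set1 subrr.
have cF x : a <= x <= b -> {for x, continuous F}.
  move=> xab; apply/differentiable_continuous/derivable1_diffP.
  by have [] := dF x xab.
rewrite /Rintegral (@continuous_FTC2 _ f F)//.
- by apply: continuous_in_subspaceT => x; rewrite mem_setE in_itv; exact: cf.
- split.
  + by move=> x; rewrite in_itv/= => /andP[/ltW ax /ltW xb]; have [] := dF x; rewrite ?ax.
  + by apply: cvg_at_right_filter; apply: cF; rewrite lexx ltW.
  + by apply: cvg_at_left_filter; apply: cF; rewrite lexx ltW.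
- move=> x; rewrite in_itv/= => /andP[/ltW ax /ltW xb].
  by rewrite derive1E; have [] := dF x; rewrite ?ax.
Qed.

Lemma ex_primitive (f : R -> R) (K : R) : continuous f ->
  exists F : R -> R, forall x : R, - K <= x <= K -> is_derive x 1 F (f x).
Proof.
move=> cf; exists (fun y => \int[lebesgue_measure]_(t in `[- K - 1, y]) f t) => x /andP[Kx xK].
have [||||H1 H2] := @continuous_FTC1 R f (BLeft (- K - 1)) x (K + 1).
- by lra.
- apply: continuous_compact_integrable; first exact: segment_compact.
  exact: continuous_subspaceT.
- by rewrite /Order.lt/=; lra.
- exact: cf.
- by apply: DeriveDef; [exact: H1|rewrite -derive1E; exact: H2].
Qed.

(** The primitive of g that vanishes at - K. The bound s <= t sits in the
    integrand, so that Fubini's theorem applies to functions of (s, t). *)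
Definition prim (K : R) (g : R -> R) (t : R) : R :=
  \int[lseg K]_s (g s * (s <= t)%R%:R).

Lemma measurable_step d (T : measurableType d) (f g : T -> R) :
  measurable_fun setT f -> measurable_fun setT g ->
  measurable_fun setT (fun x => (f x <= g x)%R%:R : R).
Proof.
move=> mf mg; rewrite (_ : (fun _ => _) = \1_[set x | f x <= g x]).
  apply: measurable_indic.
  rewrite -[X in measurable X]setTI; exact: measurable_fun_le.
apply/funext => x; rewrite indicE.
by case: (boolP (f x <= g x)) => fg; [rewrite mem_set|rewrite memNset//; exact/negP].
Qed.

Lemma Rint_lseg K (f : R -> R) : measurable_fun setT f ->
  \int[lseg K]_t f t = \int[lebesgue_measure]_(t in `[- K, K]) f t.
Proof. by move=> mf; rewrite /Rintegral integral_mfrestr//; exact/measurable_EFinP. Qed.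

Lemma Rint_lseg_le K (f : R -> R) t : measurable_fun setT f -> t <= K ->
  \int[lseg K]_s (f s * (s <= t)%R%:R) =
  \int[lebesgue_measure]_(s in `[- K, t]) f s.
Proof.
move=> mf tK; rewrite Rint_lseg; last first.
  by apply: measurable_funM => //; exact: measurable_step.
rewrite Rintegral_mkcond [RHS]Rintegral_mkcond; apply: eq_Rintegral => s _.
rewrite !patchE !mem_setE !in_itv/=.
case: (boolP (s <= t)) => st; rewrite ?mulr1 ?mulr0 ?andbT ?andbF ?if_same//.
by rewrite (le_trans st tK) andbT.
Qed.

Lemma Rint_lseg_ge K (f : R -> R) s : measurable_fun setT f -> - K <= s ->
  \int[lseg K]_t (f t * (s <= t)%R%:R) =
  \int[lebesgue_measure]_(t in `[s, K]) f t.
Proof.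
move=> mf tK; rewrite Rint_lseg; last first.
  by apply: measurable_funM => //; exact: measurable_step.
rewrite Rintegral_mkcond [RHS]Rintegral_mkcond; apply: eq_Rintegral => t _.
rewrite !patchE !mem_setE !in_itv/=.
case: (boolP (s <= t)) => st; rewrite ?mulr1 ?mulr0 ?andbT ?andbF ?if_same//.
by rewrite (le_trans tK st).
Qed.

Lemma continuous_bounded_seg (K : R) (f : R -> R) : continuous f ->
  exists B : R, forall t : R, - K <= t <= K -> `|f t| <= B.
Proof.
move=> cf; have : compact (f @` `[- K, K]).
  by apply: continuous_compact; [exact: continuous_subspaceT|exact: segment_compact].
move=> /compact_bounded[M [_ HM]]; exists (M + 1) => t tK.
by apply: (HM (M + 1)); [lra|exists t => //=; rewrite in_itv].
Qed.

Lemma Int_continuous (K : R) (f : R -> R) : continuous f -> Int (lseg K) f.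
Proof.
move=> cf; have [B fB] := continuous_bounded_seg K cf.
apply: (@Int_le _ _ _ _ (fun=> B)).
- exact: finite_measure_integrable_cst.
- exact: continuous_measurable_fun.
- exact: ae_seg.
Qed.

Lemma IntM_continuous (K : R) (f h : R -> R) : Int (lseg K) f -> continuous h ->
  Int (lseg K) (fun t => f t * h t).
Proof.
move=> intf ch; have [B hB] := continuous_bounded_seg K ch.
apply: (@IntM_bnd _ _ _ _ B) => //; first exact: continuous_measurable_fun.
exact: ae_seg.
Qed.

Lemma step_le1 (a b : R) : `|(a <= b)%R%:R : R| <= 1.
Proof. by case: (a <= b); rewrite ?normr1// normr0. Qed.

Lemma Int_prim (K : R) (g : R -> R) : Int (lseg K) g -> Int (lseg K) (prim K g).
Proof.
move=> intg.
have intf : Int (lseg K \x lseg K)%E (fun p : TR * TR => g p.2 * (p.2 <= p.1)%R%:R).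
  apply: (@IntM_bnd _ _ _ _ 1 _ _ (Int_snd _ intg)); first exact: measurable_step.
  by apply: aeW => p; exact: step_le1.
by have [] := Rfubini1 intf.
Qed.

(** Fubini's theorem on the triangle s <= t. *)
Lemma prim_by_parts (K : R) (g psi dpsi : R -> R) : 0 <= K ->
  Int (lseg K) g -> continuous dpsi ->
  (forall t : R, - K <= t <= K -> is_derive t 1 psi (dpsi t)) -> continuous psi ->
  psi K = 0 ->
  \int[lseg K]_t (prim K g t * dpsi t) = - \int[lseg K]_t (g t * psi t).
Proof.
move=> K0 intg cdpsi dpsiE cpsi psiK.
have [B dB] := continuous_bounded_seg K cdpsi.
have mg := Int_meas intg; have mdpsi := continuous_measurable_fun cdpsi.
pose f (p : TR * TR) : R := g p.2 * ((p.2 <= p.1)%R%:R * dpsi p.1).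
have mh : measurable_fun setT (fun p : TR * TR => (p.2 <= p.1)%R%:R * dpsi p.1 : R).
  apply: measurable_funM; first exact: measurable_step.
  exact: (measurableT_comp mdpsi measurable_fst).
have intf : Int (lseg K \x lseg K)%E f.
  apply: (@IntM_bnd _ _ _ _ B _ _ (Int_snd _ intg) mh).
  apply: filterS (ae_fst (lseg K) (ae_seg dB)) => p dpB.
  by rewrite normrM (le_trans _ dpB)// ler_piMl// step_le1.
have [_ f1] := Rfubini1 intf; have [_ f2] := Rfubini2 intf.
transitivity (\int[lseg K]_t \int[lseg K]_s f (t, s)).
  apply: eq_Rintegral => t _; rewrite /prim -RintegralZr//.
    by apply: eq_Rintegral => s _; rewrite /f/= mulrA.
  apply: (@IntM_bnd _ _ _ _ 1) => //; first exact: measurable_step.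
  by apply: aeW => s; exact: step_le1.
rewrite f1 -f2 -mulN1r -RintegralZl//; last first.
  by apply: IntM_continuous.
apply: Rint_ae => //.
- by have [/Int_meas] := Rfubini2 intf.
- by apply: measurable_funM => //; apply: measurable_funM => //; exact: continuous_measurable_fun.
apply: ae_seg => s /andP[Ks sK]; rewrite /f/=.
rewrite RintegralZl//; last first.
  apply: (@Int_le _ _ _ _ (fun=> B)).
  - exact: finite_measure_integrable_cst.
  - by apply: measurable_funM => //; exact: measurable_step.
  - apply: ae_seg => t tK.
    by rewrite normrM (le_trans _ (dB t tK))// ler_piMl// step_le1.
under eq_Rintegral do rewrite mulrC.
rewrite Rint_lseg_ge//.
have dsK (t : R) : s <= t <= K -> is_derive t 1 psi (dpsi t).
  by move=> /andP[st tK]; apply: dpsiE; rewrite tK (le_trans Ks).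
by rewrite (RintFTC sK (fun x _ => cdpsi x) dsK) psiK sub0r mulrN mulN1r.
Qed.

(** An absolutely continuous function, given as the primitive of an integrable
    function, can be integrated by parts against a function vanishing at both
    ends. *)
Lemma ac_by_parts (K : R) (c : R) (u g psi dpsi : R -> R) : 0 <= K ->
  Int (lseg K) g -> measurable_fun setT u ->
  {ae lseg K, forall t, u t = c + prim K g t} ->
  continuous dpsi -> continuous psi ->
  (forall t : R, - K <= t <= K -> is_derive t 1 psi (dpsi t)) ->
  psi (- K) = 0 -> psi K = 0 ->
  \int[lseg K]_t (u t * dpsi t) = - \int[lseg K]_t (g t * psi t).
Proof.
move=> K0 intg mu uE cdpsi cpsi dpsiE psiNK psiK.
have mdpsi := continuous_measurable_fun cdpsi.
have ip := IntM_continuous (Int_prim intg) cdpsi.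
transitivity (\int[lseg K]_t (c * dpsi t + prim K g t * dpsi t)).
  apply: Rint_ae.
  - exact: measurable_funM.
  - apply: measurable_funD; first exact: measurable_funM.
    exact: (Int_meas ip).
  - by apply: aeS uE => t ->; rewrite mulrDl.
have id := Int_continuous K cdpsi.
rewrite RintegralD//; last exact: IntZ.
rewrite (@prim_by_parts K g psi)// RintegralZl// Rint_lseg//.
have NKK : - K <= K by lra.
by rewrite (RintFTC NKK (fun x _ => cdpsi x) dpsiE) psiK psiNK subrr mulr0 add0r.
Qed.

End segment.

Section chain_rule.
Context (R : realType).
Let TR : measurableType _ := measurableTypeR R.

Lemma is_derive_continuous (f : R -> R) (x df : R) : is_derive x 1 f df -> {for x, continuous f}.
Proof. by move=> [fx _]; exact/differentiable_continuous/derivable1_diffP. Qed.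

Lemma Int_lseg (K : R) (f : R -> R) : measurable_fun setT f ->
  Int (lseg K) f <-> lebesgue_measure.-integrable `[- K, K] (EFin \o f).
Proof. by move=> mf; apply: integrable_mfrestr; exact/measurable_EFinP. Qed.

Lemma cvg_dist_le (u e : R^nat) (l : R) : (forall n, `|u n - l| <= e n) ->
  e n @[n --> \oo] --> (0 : R) -> u n @[n --> \oo] --> l.
Proof.
move=> ue e0; apply/cvgrPdist_lt => eps eps0.
have /cvgrPdist_lt/(_ _ eps0) := e0; apply: filterS => n.
rewrite sub0r normrN distrC => en.
by rewrite (le_lt_trans (ue n))// (le_lt_trans (ler_norm _)).
Qed.

Lemma prim_diff (K : R) (g h : R -> R) t : Int (lseg K) g -> Int (lseg K) h ->
  `|prim K g t - prim K h t| <= \int[lseg K]_s `|g s - h s|.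
Proof.
move=> ig ih.
have istep f : Int (lseg K) f -> Int (lseg K) (fun s => f s * (s <= t)%R%:R).
  move=> intf; apply: (@IntM_bnd _ _ _ _ 1) => //; first exact: measurable_step.
  by apply: aeT => s; exact: step_le1.
rewrite /prim -RintegralB//; [|exact: istep|exact: istep].
have iB := IntB (istep _ ig) (istep _ ih).
apply: le_trans (le_normr_Rintegral _ iB) _ => //.
apply: le_Rintegral => //.
- exact: Int_norm.
- exact/Int_norm/IntB.
- by move=> s _; rewrite -mulrBl normrM ler_piMr// step_le1.
Qed.

Lemma prim_norm_le (K : R) (g : R -> R) t : Int (lseg K) g ->
  `|prim K g t| <= \int[lseg K]_s `|g s|.
Proof.
move=> ig; have i0 : Int (lseg K) (fun=> 0 : R) by exact: finite_measure_integrable_cst.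
have := prim_diff t ig i0; rewrite {2}/prim.
under [X in _ - X]eq_Rintegral do rewrite mul0r.
rewrite Rintegral_cst// mul0r subr0 => /le_trans; apply.
by under eq_Rintegral do rewrite subr0.
Qed.

(** For continuous g the primitive is differentiable and the usual chain rule
    applies. *)
Lemma continuous_ac_chain (K c : R) (g H dH : R -> R) (t : R) :
  continuous g -> continuous dH -> (forall x : R, is_derive x 1 H (dH x)) ->
  - K <= t <= K ->
  H (c + prim K g t) = H c + prim K (fun s => dH (c + prim K g s) * g s) t.
Proof.
move=> cg cdH HdH /andP[Kt tK].
have mg := continuous_measurable_fun cg.
have [F dF] := ex_primitive K cg.
have primE (s : R) : - K <= s <= K -> prim K g s = F s - F (- K).
  move=> /andP[Ks sK]; rewrite /prim Rint_lseg_le//.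
  apply: RintFTC => // x; first by move=> _; exact: cg.
  by move=> /andP[Kx xs]; apply: dF; rewrite Kx (le_trans xs).
have mp : measurable_fun setT (prim K g) by exact: (Int_meas (Int_prim (Int_continuous K cg))).
have mdH := continuous_measurable_fun cdH.
rewrite {2}/prim Rint_lseg_le//; last first.
  by apply: measurable_funM => //; apply: measurableT_comp => //; exact: measurable_funD.
have -> : \int[lebesgue_measure]_(s in `[- K, t]) (dH (c + prim K g s) * g s) =
    \int[lebesgue_measure]_(s in `[- K, t]) (dH (c + (F s - F (- K))) * g s).
  apply: eq_Rintegral => s; rewrite inE/= in_itv/= => /andP[Ks st].
  by rewrite primE// Ks (le_trans st).
have dG (s : R) : - K <= s <= t ->
    is_derive s 1 (fun s => H (c + (F s - F (- K)))) (dH (c + (F s - F (- K))) * g s).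
  move=> /andP[Ks st]; have dFs : is_derive s 1 F (g s) by apply: dF; rewrite Ks (le_trans st).
  apply: (@is_derive1_comp _ H (fun s => c + (F s - F (- K)))).
  have := is_deriveD (is_derive_cst c s 1) (is_deriveB dFs (is_derive_cst (F (- K)) s 1)).
  by rewrite add0r subr0.
rewrite (RintFTC Kt _ dG).
  by rewrite primE ?Kt// subrr addr0 subrKC.
move=> s /andP[Ks st]; have dFs : is_derive s 1 F (g s) by apply: dF; rewrite Ks (le_trans st).
apply: cvgM; last exact: cg.
apply: continuous_comp; last exact: cdH.
apply: cvgD; first exact: cvg_cst.
apply: cvgB; last exact: cvg_cst.
exact: is_derive_continuous dFs.
Qed.

(** Continuous functions are dense in L^1 and both sides depend continuously
    on g: when g varies in L^1 the primitives converge uniformly and stay in a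
    compact interval, on which dH is bounded, so dominated convergence
    applies. *)
Lemma ac_chain (K c : R) (g H dH : R -> R) (t : R) : Int (lseg K) g ->
  continuous dH -> (forall x : R, is_derive x 1 H (dH x)) -> - K <= t <= K ->
  H (c + prim K g t) = H c + prim K (fun s => dH (c + prim K g s) * g s) t.
Proof.
move=> ig cdH HdH tK.
have mdH := continuous_measurable_fun cdH.
have mg := Int_meas ig.
have igE : lebesgue_measure.-integrable `[- K, K] (EFin \o g).
  exact/(Int_lseg K mg).
have [g_ [cg ig_ g_g]] := approximation_continuous_integrable
  (measurable_itv `[- K, K]) (lebesgue_seg_lty K) igE.
pose e n := \int[lseg K]_s `|g_ n s - g s|.
pose w n s := c + prim K (g_ n) s.
pose v s := c + prim K g s.
have Ig n : Int (lseg K) (g_ n) by exact: Int_continuous.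
have e0 : e n @[n --> \oo] --> (0 : R).
  rewrite (_ : e = fun n => fine (\int[lebesgue_measure]_(z in `[(- K)%R, K])
      `|(g z - g_ n z)%:E|)%E); first exact: fine_cvg g_g.
  apply/funext => n; rewrite /e Rint_lseg; last first.
    apply: measurableT_comp => //; apply: measurable_funB => //.
    exact: continuous_measurable_fun.
  by rewrite /Rintegral; congr fine; apply: eq_integral => s _; rewrite /= distrC.
have we n s : `|w n s - v s| <= e n.
  by rewrite /w /v opprD addrACA subrr add0r; exact: prim_diff.
have wv s : w n s @[n --> \oo] --> v s by apply: (cvg_dist_le _ e0) => n; exact: we.
have [M eM] : exists M : R, forall n, e n <= M.
  have /cvg_seq_bounded[M [_ HM]] : cvgn e by apply/cvg_ex; exists 0.
  exists (M + 1) => n; apply: le_trans (ler_norm _) _.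
  by apply: (HM (M + 1)) => //; rewrite ltrDl.
pose C : R := `|c| + \int[lseg K]_s `|g s| + M.
have M0 : 0 <= M by apply: le_trans (eM 0%N); apply: Rintegral_ge0.
have vC s : `|v s| <= `|c| + \int[lseg K]_s `|g s|.
  by rewrite (le_trans (ler_normD _ _))// lerD2l prim_norm_le.
have wC n s : - C <= w n s <= C.
  rewrite -ler_norml -[w n s](subrK (v s)) addrC (le_trans (ler_normD _ _))//.
  by rewrite lerD// (le_trans (we n s)).
have vC' s : - C <= v s <= C by rewrite -ler_norml (le_trans (vC s))// lerDl.
have [B dHB] := continuous_bounded_seg C cdH.
have B0 : 0 <= B by apply: le_trans (dHB _ (vC' 0)).
have mw n : measurable_fun setT (w n).
  by apply: measurable_funD => //; exact: (Int_meas (Int_prim (Ig n))).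
have mv : measurable_fun setT v by apply: measurable_funD => //; exact: (Int_meas (Int_prim ig)).
have mdHw n : measurable_fun setT (dH \o w n) by exact: measurableT_comp.
have mdHv : measurable_fun setT (dH \o v) by exact: measurableT_comp.
have idHw n (h : R -> R) : Int (lseg K) h -> Int (lseg K) (fun s => h s * dH (w n s)).
  move=> ih; apply: (@IntM_bnd _ TR R (lseg K) B _ (dH \o w n)) => //; first exact: mdHw.
  by apply: aeT => s; exact: dHB.
have idHv (h : R -> R) : Int (lseg K) h -> Int (lseg K) (fun s => h s * dH (v s)).
  move=> ih; apply: (@IntM_bnd _ TR R (lseg K) B _ (dH \o v)) => //.
  by apply: aeT => s; exact: dHB.
pose D n := \int[lseg K]_s `|g s * dH (w n s) - g s * dH (v s)|.
have D0 : D n @[n --> \oo] --> (0 : R).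
  have [] := @dominated_convergence _ TR R (lseg K) setT measurableT
      (fun n => EFin \o (fun s => g s * dH (w n s)))
      (EFin \o (fun s => g s * dH (v s))) (EFin \o (fun s => B * `|g s|)).
  - by move=> n; exact/measurable_EFinP/Int_meas/idHw.
  - exact/measurable_EFinP/Int_meas/idHv.
  - apply: aeT => s _; apply: cvg_EFin; first exact: nearW.
    apply: cvgM; first exact: cvg_cst.
    by apply: continuous_cvg; [exact: cdH|exact: wv].
  - exact/IntZ/Int_norm.
  - by apply: aeT => s n _ /=; rewrite lee_fin normrM mulrC ler_wpM2r// dHB.
  - by move=> _ + _; move/fine_cvg.
have cvgA : (H (w n t) - H c) @[n --> \oo] --> H (v t) - H c.
  apply: cvgB; last exact: cvg_cst.
  by apply: continuous_cvg; [exact: is_derive_continuous (HdH _)|exact: wv].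
have cvgB : (H (w n t) - H c) @[n --> \oo] -->
    prim K (fun s => dH (c + prim K g s) * g s) t.
  apply: (@cvg_dist_le _ (fun n => B * e n + D n)); last first.
    rewrite -[X in _ --> X]addr0 -[X in _ --> X + _](mulr0 B).
    by apply: cvgD => //; apply: cvgM => //; exact: cvg_cst.
  move=> n; rewrite /w (continuous_ac_chain c (cg n) cdH HdH tK).
  rewrite [H c + _]addrC addrK.
  have i1 := idHw n _ (Ig n); have i2 := idHv _ ig.
  under [X in `|prim _ X _ - _|]eq_fun do rewrite mulrC.
  under [X in `|_ - prim _ X _|]eq_fun do rewrite mulrC.
  apply: le_trans (prim_diff _ i1 i2) _.
  rewrite /e /D -RintegralZl//; last exact/Int_norm/IntB.
  rewrite -RintegralD//; last 2 first.
  - exact/IntZ/Int_norm/IntB.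
  - by apply/Int_norm/IntB => //; exact: idHw.
  apply: le_Rintegral => //.
  - exact/Int_norm/IntB.
  - apply: IntD; first exact/IntZ/Int_norm/IntB.
    by apply/Int_norm/IntB => //; exact: idHw.
  - move=> s _.
    have -> : g_ n s * dH (w n s) - g s * dH (v s) =
      (g_ n s - g s) * dH (w n s) + (g s * dH (w n s) - g s * dH (v s)) by ring.
    rewrite (le_trans (ler_normD _ _))// lerD2r normrM mulrC.
    by rewrite ler_wpM2r// dHB.
have := cvg_unique _ cvgA cvgB.
by move=> /(_ (@Rhausdorff R)) <-; rewrite subrKC.
Unshelve. all: by end_near. Qed.

Lemma cvg_powR_harmonic (x b : R) : 0 <= x -> (x == 0) ==> (0 < b) ->
  (x + harmonic n) `^ b @[n --> \oo] --> x `^ b.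
Proof.
have h0 : (harmonic n : R) @[n --> \oo] --> 0 by exact: cvg_harmonic.
rewrite le_eqVlt => /predU1P[<-|x0 _].
  rewrite eqxx/= => b0; rewrite powR0 ?gt_eqF//.
  under eq_fun do rewrite add0r.
  have H := (cvg_at_rightP (fun y : R => y `^ b) 0 0).1 (@powR_cvg0 R b b0) harmonic.
  by apply: H; split => // n; rewrite /harmonic/= invr_gt0.
have cx : {for x, continuous (fun y : R => y `^ b)}.
  exact: is_derive_continuous (is_derive1_powR b x0).
have xr : (x + harmonic n) @[n --> \oo] --> x.
  by rewrite -[X in _ --> X]addr0; apply: cvgD => //; exact: cvg_cst.
exact: (cvg_comp _ _ xr cx).
Qed.

Lemma is_derive_regpow (a r s : R) : 0 < r ->
  is_derive s 1 (fun s : R => (s ^+ 2 + r) `^ (a / 2)) (a * (s ^+ 2 + r) `^ (a / 2 - 1) * s).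
Proof.
move=> r0; have sr0 : 0 < s ^+ 2 + r by rewrite ltr_wpDl// sqr_ge0.
have dsq : is_derive s 1 (fun s : R => s ^+ 2 + r) (2 * s).
  have := is_deriveD (is_deriveX 2 (is_derive_id s 1)) (is_derive_cst r s 1).
  by rewrite addr0 /= expr1 /GRing.scale/= mulr1.
have -> : a * (s ^+ 2 + r) `^ (a / 2 - 1) * s =
    (a / 2 * (s ^+ 2 + r) `^ (a / 2 - 1)) * (2 * s) by field.
exact: (is_derive1_comp (f := fun y : R => y `^ (a / 2)) (g := fun s : R => s ^+ 2 + r)
  (is_derive1_powR (a / 2) sr0) dsq).
Qed.

Lemma continuous_regpow (a r : R) : 0 < r ->
  continuous (fun s : R => a * (s ^+ 2 + r) `^ (a / 2 - 1) * s).
Proof.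
move=> r0 s; have sr0 : 0 < s ^+ 2 + r by rewrite ltr_wpDl// sqr_ge0.
apply: cvgM; last exact: cvg_id.
apply: cvgM; first exact: cvg_cst.
apply: (@continuous_comp _ _ _ (fun s : R => s ^+ 2 + r) (fun y : R => y `^ (a / 2 - 1))).
  by apply: cvgD; [exact: exprn_continuous|exact: cvg_cst].
exact: is_derive_continuous (is_derive1_powR _ sr0).
Qed.

Lemma powR_sqr_half (s a : R) : (s ^+ 2) `^ (a / 2) = `|s| `^ a.
Proof.
rewrite -real_normK ?num_real// -powR_mulrn// -powRrM mulrC divfK//.
Qed.

(** The power function is approximated by the smooth functions
    s |-> (s ^ 2 + r) ^ (a / 2); where the primitive vanishes, so does the
    factor (c + prim K g s) in the density below. *)
Lemma ac_power (K c a : R) (g : R -> R) (t : R) : 0 < a -> Int (lseg K) g ->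
  let v s := c + prim K g s in
  let h s := a * (`|v s| `^ (a - 2) * v s) * g s in
  Int (lseg K) h -> - K <= t <= K -> `|v t| `^ a = `|c| `^ a + prim K h t.
Proof.
move=> a0 ig v h ih tK.
have a20 : 0 < a / 2 by rewrite divr_gt0.
pose r n : R := harmonic n.
have r0 n : 0 < r n by rewrite /r /harmonic/= invr_gt0.
have r1 n : r n <= 1 by rewrite /r /harmonic/= invf_le1// ler1n.
pose dH n (s : R) := a * (s ^+ 2 + r n) `^ (a / 2 - 1) * s.
have chain n : (v t ^+ 2 + r n) `^ (a / 2) - (c ^+ 2 + r n) `^ (a / 2) =
    prim K (fun s => dH n (v s) * g s) t.
  have := @ac_chain K c g _ (dH n) t ig (@continuous_regpow a _ (r0 n))
    (fun x => is_derive_regpow a x (r0 n)) tK.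
  by rewrite -/(v t) => ->; rewrite [X in X - _]addrC addrK.
have mv : measurable_fun setT v by apply: measurable_funD => //; exact: (Int_meas (Int_prim ig)).
have mdH n : measurable_fun [set: TR] (fun s => dH n (v s) * g s).
  apply: measurable_funM; last exact: (Int_meas ig).
  apply: (measurableT_comp (continuous_measurable_fun (@continuous_regpow a _ (r0 n)))).
  exact: mv.
(* for a <= 2 the bound is |h|, as (v^2 + r)^(a/2 - 1) <= |v|^(a - 2); for
   a >= 2 it is the value at r = 1 and at the largest |v| *)
have [G iG dHG] : exists2 G, Int (lseg K) G & forall n s, `|dH n (v s) * g s| <= G s.
  have [a2|/ltW a2] := leP a 2.
    exists (fun s => `|h s|) => [|n s]; first exact: Int_norm.
    rewrite /h /dH !normrM ler_wpM2r//.
    have [->|v0] := eqVneq (v s) 0; first by rewrite normr0 !mulr0.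
    rewrite !(ger0_norm (powR_ge0 _ _)) -mulrA ler_wpM2l// ler_wpM2r//.
    have -> : `|v s| `^ (a - 2) = (v s ^+ 2) `^ (a / 2 - 1).
      by rewrite (_ : a / 2 - 1 = (a - 2) / 2) ?powR_sqr_half//; field.
    rewrite (_ : a / 2 - 1 = - (1 - a / 2)); last by ring.
    have vs0 : 0 < v s ^+ 2 by rewrite exprn_even_gt0.
    have vr0 : 0 < v s ^+ 2 + r n by rewrite addr_gt0.
    rewrite !powRN lef_pV2 ?posrE ?powR_gt0//.
    by apply: ge0_ler_powR; rewrite ?nnegrE ?(ltW vs0) ?(ltW vr0)// ?lerDl ?(ltW (r0 n))//; lra.
  pose C := `|c| + \int[lseg K]_s `|g s|.
  have vC s : `|v s| <= C by rewrite (le_trans (ler_normD _ _))// lerD2l prim_norm_le.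
  exists (fun s => (a * (C ^+ 2 + 1) `^ (a / 2 - 1) * C) * `|g s|) => [|n s].
    exact/IntZ/Int_norm.
  rewrite normrM ler_wpM2r// /dH !normrM (ger0_norm (powR_ge0 _ _)) (gtr0_norm a0).
  rewrite ler_pM// ?mulr_ge0 ?powR_ge0// ?(ltW a0)// ler_wpM2l ?(ltW a0)//.
  have vC2 : v s ^+ 2 <= C ^+ 2 by rewrite -real_normK ?num_real// lerXn2r ?nnegrE ?(le_trans _ (vC s)).
  apply: ge0_ler_powR; first lra.
  - by rewrite nnegrE addr_ge0 ?sqr_ge0 ?(ltW (r0 n)).
  - by rewrite nnegrE addr_ge0 ?sqr_ge0.
  - by rewrite lerD.
have idH n : Int (lseg K) (fun s => dH n (v s) * g s).
  by apply: (@Int_le _ TR R (lseg K) G) => //; apply: aeT => s; exact: dHG.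
have dHh s : dH n (v s) * g s @[n --> \oo] --> h s.
  rewrite /dH /h; apply: cvgM; last exact: cvg_cst.
  have [->|v0] := eqVneq (v s) 0; first by under eq_fun do rewrite mulr0; rewrite !mulr0; exact: cvg_cst.
  rewrite mulrA; apply: cvgM; last exact: cvg_cst.
  apply: cvgM; first exact: cvg_cst.
  have -> : `|v s| `^ (a - 2) = (v s ^+ 2) `^ (a / 2 - 1).
    by rewrite (_ : a / 2 - 1 = (a - 2) / 2) ?powR_sqr_half//; field.
  by apply: cvg_powR_harmonic; rewrite ?sqr_ge0// sqrf_eq0 (negbTE v0).
pose D n := \int[lseg K]_s `|dH n (v s) * g s - h s|.
have D0 : D n @[n --> \oo] --> (0 : R).
  have [] := @dominated_convergence _ TR R (lseg K) setT measurableT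
      (fun n => EFin \o (fun s => dH n (v s) * g s)) (EFin \o h) (EFin \o G).
  - by move=> n; exact: measurable_int (idH n).
  - exact: measurable_int ih.
  - by apply: aeT => s _; apply: cvg_EFin; [exact: nearW|exact: dHh].
  - exact: iG.
  - by apply: aeT => s n _ /=; rewrite lee_fin dHG.
  - by move=> _ + _; move/fine_cvg.
have cvgA : (v t ^+ 2 + r n) `^ (a / 2) - (c ^+ 2 + r n) `^ (a / 2) @[n --> \oo] -->
    `|v t| `^ a - `|c| `^ a.
  rewrite -!powR_sqr_half.
  by apply: cvgB; apply: cvg_powR_harmonic; rewrite ?sqr_ge0 ?a20 ?implybT.
have cvgB : (v t ^+ 2 + r n) `^ (a / 2) - (c ^+ 2 + r n) `^ (a / 2) @[n --> \oo] -->
    prim K h t.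
  by apply: (cvg_dist_le _ D0) => n; rewrite chain; exact: prim_diff.
have := cvg_unique _ cvgA cvgB.
by move=> /(_ (@Rhausdorff R)) <-; rewrite subrKC.
Qed.

End chain_rule.

(** * Smooth functions on the line *)

Section smooth_line.
Context (R : realType).
Implicit Types (f g : R -> R) (K a b t : R).

(** The derivative is an existential witness rather than derive1 f, so that
    closure under sums and products needs no computation of derivatives. *)
Fixpoint Ck1 (k : nat) f : Prop :=
  if k is l.+1 then
    exists2 df : R -> R, (forall x : R, is_derive x 1 f (df x)) & Ck1 l df
  else continuous f.

Definition smooth1 f := forall k, Ck1 k f.

Lemma Ck1S k f : Ck1 k.+1 f -> Ck1 k f.
Proof.
elim: k f => [|k IH] f [df fdf Cdf]; last by exists df => //; exact: IH.
by move=> x; exact: is_derive_continuous (fdf x).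
Qed.

Lemma Ck1D k f g : Ck1 k f -> Ck1 k g -> Ck1 k (fun x => f x + g x).
Proof.
elim: k f g => [|k IH] f g; first by move=> cf cg x; apply: cvgD; [exact: cf|exact: cg].
move=> [df fdf Cdf] [dg gdg Cdg]; exists (fun x => df x + dg x); last exact: IH.
by move=> x; apply: is_deriveD.
Qed.

Lemma Ck1M k f g : Ck1 k f -> Ck1 k g -> Ck1 k (fun x => f x * g x).
Proof.
elim: k f g => [|k IH] f g; first by move=> cf cg x; apply: cvgM; [exact: cf|exact: cg].
move=> Cf Cg; have Cf0 := Ck1S Cf; have Cg0 := Ck1S Cg.
case: Cf Cg => [df fdf Cdf] [dg gdg Cdg].
exists (fun x => f x * dg x + g x * df x); last by apply: Ck1D; exact: IH.
by move=> x; apply: is_deriveM.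
Qed.

Lemma Ck1_cst k (c : R) : Ck1 k (fun=> c).
Proof.
elim: k c => [|k IH] c; first by move=> x; exact: cvg_cst.
by exists (fun=> 0) => // x; exact: is_derive_cst.
Qed.

Lemma Ck1_affine k f (a b : R) : Ck1 k f -> Ck1 k (fun x => f (a * x + b)).
Proof.
elim: k f => [|k IH] f.
  move=> cf x; apply: (@continuous_comp _ _ _ (fun x : R => a * x + b)); last exact: cf.
  apply: cvgD; last exact: cvg_cst.
  by apply: cvgM; [exact: cvg_cst|exact: cvg_id].
move=> [df fdf Cdf]; exists (fun x => df (a * x + b) * a).
  move=> x; apply: (is_derive1_comp (f := f) (g := fun x => a * x + b)).
  have := is_deriveD (is_deriveM (is_derive_cst a x 1) (is_derive_id x 1)) (is_derive_cst b x 1).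
  by rewrite /GRing.scale/= mulr1 mulr0 !addr0.
by apply: Ck1M; [exact: IH|exact: Ck1_cst].
Qed.

Lemma smooth1_derive f : smooth1 f ->
  (forall x : R, is_derive x 1 f (derive1 f x)) /\ smooth1 (derive1 f).
Proof.
move=> sf; have [df fdf _] := sf 1%N.
have dfE g : (forall x : R, is_derive x 1 f (g x)) -> g = derive1 f.
  by move=> fg; apply/funext => x; rewrite derive1E; have [_ ->] := fg x.
split=> [x|k]; first by rewrite -(dfE _ fdf).
by have [g fg Cg] := sf k.+1; rewrite -(dfE _ fg).
Qed.

Lemma smooth1_primitive f g : (forall x : R, is_derive x 1 f (g x)) -> smooth1 g ->
  smooth1 f.
Proof.
move=> fg sg [|k]; last by exists g => //; exact: sg.
by move=> x; exact: is_derive_continuous (fg x).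
Qed.

Lemma smooth1_continuous f : smooth1 f -> continuous f.
Proof. by move/(_ 0%N). Qed.

(** The functions P(1/t) exp(-1/t), extended by 0 to t <= 0: this class is
    closed under derivation. *)
Definition flat (P : {poly R}) (t : R) : R :=
  if 0 < t then P.[t^-1] * expR (- t^-1) else 0.

(** Each monomial is bounded by one term of the exponential series. *)
Lemma poly_expR_bound (P : {poly R}) : exists2 C : R, 0 <= C &
  forall x, 0 < x -> `|P.[x] * expR (- x)| <= C * x^-1.
Proof.
exists (\sum_(i < size P) `|P`_i| * i.+1`!%:R).
  by apply: sumr_ge0 => i _; rewrite mulr_ge0.
move=> x x0; rewrite horner_coef mulr_suml mulr_suml (le_trans (ler_norm_sum _ _ _))//.
apply: ler_sum => i _.
rewrite -mulrA normrM -mulrA ler_wpM2l// ger0_norm ?mulr_ge0 ?exprn_ge0 ?(ltW x0) ?expR_ge0//.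
rewrite ler_pdivlMr// mulrAC -exprSr expRN ler_pdivrMr ?expR_gt0//.
rewrite mulrC -ler_pdivrMr ?ltr0n ?fact_gt0//.
have := expR_ge1Dxn i (ltW x0); apply: le_trans.
by rewrite lerDr.
Qed.

Lemma is_derive_flat (P : {poly R}) (x : R) : is_derive x 1 (flat P) (flat ('X^2 * (P - deriv P)) x).
Proof.
have [x0|x0|<-] := ltgtP 0 x.
- have dinv : is_derive x 1 (fun t : R => t^-1) (- x ^- 2).
    have := is_deriveV (f := id) (lt0r_neq0 x0) (is_derive_id x 1).
    by rewrite /GRing.scale/= mulr1.
  have dP : is_derive x 1 (fun t : R => P.[t^-1]) ((deriv P).[x^-1] * - x ^- 2).
    exact: (is_derive1_comp (f := horner P) (g := fun t : R => t^-1) (is_derive_poly P x^-1) dinv).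
  have dE : is_derive x 1 (fun t : R => expR (- t^-1)) (expR (- x^-1) * x ^- 2).
    have := is_derive1_comp (f := expR) (g := fun t : R => - t^-1)
      (is_derive_expR (- x^-1)) (is_deriveN dinv).
    by rewrite opprK.
  have dM := is_deriveM dP dE.
  have nE : \near x, P.[x^-1] * expR (- x^-1) = flat P x.
    by near=> t; rewrite /flat; have -> : 0 < t by near: t; exact: lt_nbhsr.
  apply: is_derive_eq; first exact: (near_eq_is_derive nE dM).
  rewrite /flat x0 hornerM hornerXn hornerD hornerN /GRing.scale/= exprVn.
  by field; rewrite lt0r_neq0.
- have nE : \near x, 0 = flat P x.
    near=> t; rewrite /flat; have /ltW/le_gtF -> // : t < 0 by near: t; exact: lt_nbhsl.
  rewrite /flat (le_gtF (ltW x0)).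
  exact: (near_eq_is_derive nE (is_derive_cst (0 : R) x 1)).
- (* at h > 0 the difference quotient is flat ('X * P) h *)
  have [C C0 HC] := poly_expR_bound ('X * P).
  have flat0 Q : flat Q 0 = 0 by rewrite /flat ltxx.
  have lim0 : h^-1 *: (flat P (h *: 1 + 0) - flat P 0) @[h --> 0^'] --> (0 : R).
    apply/cvgrPdist_lt => e e0; near=> h.
    have hC : `|h| < e / (C + 1) by near: h; apply: dnbhs0_lt; rewrite divr_gt0// ltr_wpDl.
    rewrite flat0 subr0 sub0r normrN addr0 /GRing.scale/= mulr1 /flat.
    have [h0|h0] := ltP 0 h; last by rewrite mulr0 normr0.
    have hV0 : 0 < h^-1 by rewrite invr_gt0.
    rewrite mulrA -[h^-1 * _](_ : ('X * P).[h^-1] = _) ?hornerM ?hornerX//.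
    have := HC _ hV0; rewrite hornerM hornerX invrK => /le_lt_trans; apply.
    move: hC; rewrite gtr0_norm// ltr_pdivlMr ?ltr_wpDl// => /le_lt_trans; apply => //.
    by rewrite mulrC ler_wpM2l ?(ltW h0)// lerDl.
  rewrite flat0; apply: DeriveDef; first by apply/cvg_ex; exists 0.
  exact: (cvg_lim (@Rhausdorff R) lim0).
Unshelve. all: by end_near. Qed.

Lemma smooth1_flat P : smooth1 (flat P).
Proof.
move=> k; elim: k P => [|k IH] P.
  by move=> x; exact: is_derive_continuous (is_derive_flat P x).
by exists (flat ('X^2 * (P - deriv P))) => // x; exact: is_derive_flat.
Qed.

Definition bump (K : R) f := smooth1 f /\ forall t, K <= `|t| -> f t = 0.

Lemma smooth1M f g : smooth1 f -> smooth1 g -> smooth1 (fun x => f x * g x).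
Proof. by move=> sf sg k; exact: Ck1M. Qed.

Lemma bumpM K f (c : R) : bump K f -> bump K (fun x => f x * c).
Proof.
move=> [sf f0]; split; first by apply: smooth1M => // k; exact: Ck1_cst.
by move=> t Kt; rewrite f0// mul0r.
Qed.

Lemma bumpB K f g : bump K f -> bump K g -> bump K (fun x => f x - g x).
Proof.
move=> bf /(@bumpM _ _ (-1))[sg g0]; case: bf => sf f0; split.
  by move=> k; have := Ck1D (sf k) (sg k); under eq_fun do rewrite mulrN1.
by move=> t Kt; rewrite f0// sub0r; have := g0 _ Kt; rewrite mulrN1.
Qed.

(** The zero integral makes the primitive vanish to the right of K. *)
Lemma bump_primitive K f : 0 <= K -> bump K f ->
  \int[lebesgue_measure]_(t in `[- K, K]) f t = 0 ->
  exists2 psi, bump K psi & forall x : R, is_derive x 1 psi (f x).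
Proof.
move=> K0 [sf f0] intf; have cf := smooth1_continuous sf.
pose psi (y : R) := \int[lebesgue_measure]_(t in `[- K - 1, y]) f t.
have psiN (y : R) : y <= - K -> psi y = 0.
  move=> yK; rewrite /psi (@eq_Rintegral _ _ _ _ _ (cst 0)) ?Rintegral_cst ?mul0r//.
  move=> t; rewrite inE/= in_itv/= => /andP[_ ty]; apply: f0.
  by rewrite ler_normr lerNr (le_trans ty)// orbT.
have psiK (y : R) : K <= y -> psi y = 0.
  move=> Ky; rewrite -[RHS]intf /psi Rintegral_mkcond [RHS]Rintegral_mkcond.
  apply: eq_Rintegral => t _; rewrite !patchE !mem_setE !in_itv/=.
  have [tK|Kt] := ltP `|t| K.
    move: (tK); rewrite ltr_norml => /andP[/ltW Kt /ltW tK'].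
    by rewrite Kt tK' (le_trans tK' Ky) (le_trans _ Kt)// lerBlDr lerDl.
  by rewrite f0// !if_same.
have dpsi (x : R) : is_derive x 1 psi (f x).
  have [xK|Kx] := ltP x (- K).
    have -> : f x = 0 by apply: f0; rewrite ler_normr lerNr (ltW xK) orbT.
    have nE : \near x, 0 = psi x.
      by near=> t; rewrite psiN//; apply/ltW; near: t; exact: lt_nbhsl.
    exact: (near_eq_is_derive nE (is_derive_cst (0 : R) x 1)).
  have [||||H1 H2] := @continuous_FTC1 R f (BLeft (- K - 1)) x (x + 1).
  - by rewrite ltrDl.
  - apply: continuous_compact_integrable; first exact: segment_compact.
    exact: continuous_subspaceT.
  - by rewrite /Order.lt/=; lra.
  - exact: cf.
  - by apply: DeriveDef; [exact: H1|rewrite -derive1E; exact: H2].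
exists psi => //; split; first exact: smooth1_primitive sf.
move=> t; rewrite ler_normr => /orP[|]; first exact: psiK.
by rewrite lerNr; exact: psiN.
Unshelve. all: by end_near. Qed.

(** Smooth functions supported in [a, b], with values in [0, 1], converging to
    the indicator function of the open interval. *)
Definition plateau (a b : R) (n : nat) (t : R) : R :=
  flat 1 (n.+1%:R * (t - a)) * flat 1 (n.+1%:R * (b - t)).

Lemma bump_plateau K a b n : - K <= a -> b <= K -> bump K (plateau a b n).
Proof.
move=> Ka bK; split.
  apply: smooth1M => k.
    under eq_fun do rewrite mulrBr.
    exact: (Ck1_affine _ (- _) (smooth1_flat 1 k)).
  under eq_fun do rewrite mulrBr addrC -mulNr.
  exact: (Ck1_affine _ _ (smooth1_flat 1 k)).
move=> t; rewrite ler_normr => /orP[Kt|Kt].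
  rewrite /plateau [X in _ * X]/flat pmulr_rgt0// subr_gt0.
  by rewrite ltNge (le_trans bK)// mulr0.
rewrite /plateau [X in X * _]/flat pmulr_rgt0// subr_gt0.
by rewrite ltNge (le_trans _ Ka) ?mul0r// lerNr.
Qed.

Lemma flat1_ge0 t : 0 <= flat 1 t.
Proof. by rewrite /flat; case: ifP => // _; rewrite hornerE mul1r expR_ge0. Qed.

Lemma flat1_le1 t : flat 1 t <= 1.
Proof.
rewrite /flat; case: ifP => // t0; rewrite hornerE mul1r -expR0 ler_expR.
by rewrite oppr_le0 invr_ge0 ltW.
Qed.

Lemma plateau_ge0 a b n t : 0 <= plateau a b n t.
Proof. by rewrite mulr_ge0 ?flat1_ge0. Qed.

Lemma plateau_le1 a b n t : plateau a b n t <= 1.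
Proof. by rewrite mulr_ile1 ?flat1_ge0 ?flat1_le1. Qed.

Lemma cvg_plateau a b t : plateau a b n t @[n --> \oo] --> ((a < t < b)%R%:R : R).
Proof.
have cvg1 (s : R) : flat 1 (n.+1%:R * s) @[n --> \oo] --> ((0 < s)%R%:R : R).
  rewrite /flat; have [s0|s0] := ltP 0 s.
    under eq_fun do rewrite pmulr_rgt0// s0 hornerE mul1r invfM.
    have h0 : (- (n.+1%:R^-1 / s) : R) @[n --> \oo] --> (0 : R).
      rewrite -oppr0 -(mul0r s^-1).
      by apply: cvgN; apply: cvgM; [exact: cvg_harmonic|exact: cvg_cst].
    have := cvg_comp _ _ h0 (@continuous_expR R 0).
    by rewrite expR0.
  by under eq_fun do rewrite pmulr_rgt0// ltNge s0/=; exact: cvg_cst.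
have := cvgM (cvg1 (t - a)) (cvg1 (b - t)).
by rewrite !subr_gt0 -natrM mulnb; apply.
Qed.

End smooth_line.

(** * Test functions *)

Section test_functions.
Context (R : realType) (m n : nat).
Local Notation M := 'M[R]_(m, n).

Lemma continuous_mxP (T : topologicalType) (f : T -> M) :
  (forall i j, continuous (fun x => f x i j)) -> continuous f.
Proof.
move=> cf x; apply/cvg_ballP => e e0.
pose P (p : 'I_m * 'I_n) y := ball (f x p.1 p.2) e (f y p.1 p.2).
suff: \forall y \near x, forall p, P p y.
  by apply: filterS => y Py; split => // i j; exact: (Py (i, j)).
apply: filter_forall => -[k l]; rewrite /P/=.
by have /cvg_ballP/(_ _ e0) := cf k l x.
Qed.

Lemma compact_cube (K : R) : compact (@cube R m n K).
Proof.
pose A := [set v : 'rV[R]_(m * n) | forall k, `[- K, K]%classic (v ord0 k)].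
have cA : compact A by apply: (@rV_compact _ _ (fun=> `[- K, K]%classic)) => k; exact: segment_compact.
have -> : cube K = (vec_mx : 'rV[R]_(m * n) -> M) @` A.
  apply/seteqP; split => [X QX|_ [v Av <-]].
    by exists (mxvec X); [move=> k; case/mxvec_indexP: k => i j; rewrite mxvecE; exact: QX|exact: mxvecK].
  by move=> i j; rewrite mxE; exact: Av.
apply: continuous_compact cA; apply: continuous_subspaceT.
apply: continuous_mxP => i j.
under eq_fun do rewrite mxE.
exact: coord_continuous.
Qed.

Lemma compact_sub_cube (A : set M) : compact A -> exists2 K : nat, (0 < K)%N & A `<=` cube K%:R.
Proof.
move=> /compact_bounded[B [_ HB]].
exists (Num.truncn (B + 1)).+1 => // X AX i j /=.
rewrite in_itv/= -ler_norml; apply: le_trans (ltW (truncnS_gt _)).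
have := HB (B + 1); rewrite ltrDl ltr01 => /(_ isT X AX).
move=> /=; apply: le_trans; rewrite [leRHS]/Num.norm/= mx_normrE.
by apply/bigmax_geP; right; exists (i, j).
Qed.

Section slice_derivative.
Variables (i : 'I_m) (j : 'I_n).

Lemma upd_shift (X : M) (h t : R) : upd i j X (h + t) = h *: delta_mx i j + upd i j X t.
Proof.
apply/matrixP => k l; rewrite !mxE.
by case: ifP => _; rewrite ?mulr1 ?mulr0 ?add0r.
Qed.

Lemma slice_quotient (phi : M -> R) X t :
  (fun h : R => h^-1 *: (((fun s => phi (upd i j X s)) \o shift t) (h *: (1 : R)) - phi (upd i j X t))) =
  (fun h : R => h^-1 *: ((phi \o shift (upd i j X t)) (h *: delta_mx i j) - phi (upd i j X t))).
Proof. by apply/funext => h /=; rewrite -upd_shift /GRing.scale/= mulr1. Qed.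

Lemma is_derive_upd (phi : M -> R) X (t : R) : derivable phi (upd i j X t) (delta_mx i j) ->
  is_derive t 1 (fun s => phi (upd i j X s)) ('D_(delta_mx i j) phi (upd i j X t)).
Proof.
move=> dphi; apply: DeriveDef; first by rewrite /derivable slice_quotient.
by rewrite /derive slice_quotient.
Qed.

Lemma is_derive_of_upd (phi : M -> R) (X : M) (df : R) :
  is_derive (X i j) 1 (fun s => phi (upd i j X s)) df ->
  is_derive X (delta_mx i j) phi df.
Proof.
move=> [H1 H2]; apply: DeriveDef.
  by move: H1; rewrite /derivable slice_quotient upd_id.
by move: H2; rewrite /derive slice_quotient upd_id.
Qed.

Lemma continuous_upd (X : M) : continuous (upd i j X).
Proof.
apply: continuous_mxP => k l; under eq_fun do rewrite mxE.
by case: (_ && _); [move=> t; exact: cvg_id|exact: cst_continuous].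
Qed.

End slice_derivative.

Definition tprod (b : 'I_m -> 'I_n -> R -> R) (X : M) : R :=
  \prod_p b p.1 p.2 (X p.1 p.2).

Definition subst_entry (b : 'I_m -> 'I_n -> R -> R) i j (f : R -> R) k l :=
  if (k == i) && (l == j) then f else b k l.

Lemma tprod_upd b i j X t : tprod b (upd i j X t) =
  b i j t * \prod_(p | p != (i, j)) b p.1 p.2 (X p.1 p.2).
Proof.
rewrite /tprod (bigD1 (i, j))//= upd_same; congr (_ * _).
by apply: eq_bigr => -[k l] /negbTE; rewrite mxE /= -xpair_eqE => ->.
Qed.

Lemma tprod_subst b i j f X :
  tprod (subst_entry b i j f) X = f (X i j) * \prod_(p | p != (i, j)) b p.1 p.2 (X p.1 p.2).
Proof.
rewrite /tprod (bigD1 (i, j))//= /subst_entry !eqxx; congr (_ * _).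
by apply: eq_bigr => -[k l] /negbTE; rewrite /= -xpair_eqE => ->.
Qed.

Lemma is_derive_tprod b i j X : (forall k l, smooth1 (b k l)) ->
  is_derive X (delta_mx i j) (tprod b) (tprod (subst_entry b i j (derive1 (b i j))) X).
Proof.
move=> sb; apply: is_derive_of_upd; rewrite tprod_subst.
under eq_fun do rewrite tprod_upd.
have [db _] := smooth1_derive (sb i j).
set C := \prod_(p | _) _.
have -> : derive1 (b i j) (X i j) * C =
    b i j (X i j) *: 0 + cst C (X i j) *: derive1 (b i j) (X i j).
  by rewrite scaler0 add0r /GRing.scale/= mulrC.
exact: is_deriveM (db (X i j)) (is_derive_cst C (X i j) 1).
Qed.

Lemma continuous_tprod (b : 'I_m -> 'I_n -> R -> R) : (forall k l, continuous (b k l)) -> continuous (tprod b).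
Proof.
move=> cb; rewrite /tprod; elim: (index_enum _) => [|p s IH].
  by under eq_fun do rewrite big_nil; exact: cst_continuous.
under eq_fun do rewrite big_cons.
move=> X; have cX : {for X, continuous (fun X : M => b p.1 p.2 (X p.1 p.2))}.
  apply: (@continuous_comp _ _ _ (fun X : M => X p.1 p.2)); last exact: cb.
  exact: coord_continuous.
exact: cvgM cX (IH X).
Qed.

Lemma is_Ck_tprod k b : (forall i j, smooth1 (b i j)) -> is_Ck k (tprod b).
Proof.
elim: k b => [|k IH] b sb.
  by split => //; apply: continuous_tprod => i j; exact: smooth1_continuous.
split; first by apply: continuous_tprod => i j; exact: smooth1_continuous.
move=> i j; split => [X|]; first by have [] := is_derive_tprod i j X sb.
rewrite (_ : 'D__ _ = tprod (subst_entry b i j (derive1 (b i j)))).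
  apply: IH => k' l'; rewrite /subst_entry; case: ifP => // _.
  by have [] := smooth1_derive (sb i j).
by apply/funext => X; have [] := is_derive_tprod i j X sb.
Qed.

Lemma test_tprod (K : R) b : (forall i j, bump K (b i j)) -> test_function (tprod b).
Proof.
move=> bb; split; first by move=> k; apply: is_Ck_tprod => i j; have [] := bb i j.
have clT := @closed_closure _ [set X | tprod b X != 0].
apply: (subclosed_compact clT (@compact_cube K)).
apply: (subset_trans _ (compact_closed (@norm_hausdorff _ _) (@compact_cube K))).
apply: closure_subset => X /= X0 i j /=; rewrite in_itv/= -ler_norml leNgt.
apply/negP => /ltW KX; move/negP: X0; apply.
rewrite /tprod (bigD1 (i, j))//=.
by have [_ ->] := bb i j; rewrite ?mul0r.
Qed.

(** The margin 1 makes the partial derivatives vanish outside the cube too. *)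
Lemma test_function_support (phi : M -> R) : test_function phi ->
  exists2 K : nat, (0 < K)%N & forall X, phi X != 0 -> cube (K%:R - 1) X.
Proof.
move=> [_ /compact_sub_cube[K K0 QK]]; exists K.+1 => // X phiX.
by rewrite -natr1 addrK; apply: QK; exact: subset_closure.
Qed.

Lemma support_vanish (K : R) (phi : M -> R) :
  (forall X, phi X != 0 -> cube (K - 1) X) -> forall X, ~ cube K X -> phi X = 0.
Proof.
move=> phiK X nQ; apply/eqP/negPn/negP => /phiK QX; apply: nQ => k l.
have := QX k l; rewrite /= !in_itv/=; lra.
Qed.

End test_functions.

(** * The fundamental lemma of the calculus of variations *)

Section fundamental_lemma.
Context (R : realType) (m n : nat).
Let TR : measurableType _ := measurableTypeR R.
Local Notation M := 'M[R]_(m, n).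

Lemma measurable_continuous_mx (f : M -> R) : continuous f -> measurable_fun setT f.
Proof.
move=> cf; apply: (measurability _ (RGenOpens.measurableE R)) => //.
move=> _ [_ [a [b ->] <-]]; rewrite setTI; apply: sub_sigma_algebra => /=.
by apply: open_comp => [X _|]; [exact: cf|exact: interval_open].
Qed.

Lemma ae_lcube K (P : M -> Prop) : (forall X, cube K X -> P X) -> {ae lcube m n K, forall X, P X}.
Proof.
move=> QP; apply: aeS (ae_mfrestrD (measurable_cube K) (lebesgue_mx_cube_lty m n K)).
exact: QP.
Qed.

Lemma continuous_bounded_cube K (f : M -> R) : continuous f ->
  exists B : R, forall X, cube K X -> `|f X| <= B.
Proof.
move=> cf; have : compact (f @` cube K).
  by apply: continuous_compact; [exact: continuous_subspaceT|exact: compact_cube].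
move=> /compact_bounded[M' [_ HM]]; exists (M' + 1) => X QX.
by apply: (HM (M' + 1)); [rewrite ltrDl|exists X].
Qed.

Lemma IntM_continuous_mx K (f h : M -> R) : Int (lcube m n K) f -> continuous h ->
  Int (lcube m n K) (fun X => f X * h X).
Proof.
move=> intf ch; have [B hB] := continuous_bounded_cube K ch.
apply: (@IntM_bnd _ _ _ _ B) => //; first exact: measurable_continuous_mx.
exact: ae_lcube.
Qed.

(** The faces of a cube are negligible. *)
Lemma ae_open_cube (K : R) : {ae lcube m n K, forall X : M, forall i j, - K < X i j < K}.
Proof.
apply: filter_forall => i; apply: filter_forall => j.
pose S : set TR := [set - K] `|` [set K].
pose A k l : set TR := if (k == i) && (l == j) then S else `[- K, K]%classic.
have mA k l : measurable (A k l).
  rewrite /A; case: ifP => _; last exact: measurable_itv.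
  by apply: measurableU; exact: measurable_set1.
have mS : measurable_fun [set: M] (fun X : M => X i j : TR) by exact: measurable_entry.
exists ((fun X : M => X i j) @^-1` S `|` ~` cube K); split.
- apply: measurableU; last by apply: measurableC; exact: measurable_cube.
  rewrite -[X in measurable X]setTI; apply: mS => //.
  by apply: measurableU; exact: measurable_set1.
- rewrite lcubeE; apply: (@subset_measure0 _ _ _ _ _ (box A)) => //.
  + apply: measurableI; last exact: measurable_cube.
    apply: measurableU; last by apply: measurableC; exact: measurable_cube.
    rewrite -[X in measurable X]setTI; apply: mS => //.
    by apply: measurableU; exact: measurable_set1.
  + exact: measurable_box.
  + move=> X [[XS|//] QX] k l; rewrite /A; case: ifP => [/andP[/eqP-> /eqP->]//|_].
    exact: QX.
  + transitivity (lebesgue_mx (box A)); first by [].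
    rewrite lebesgue_box// pair_bigA (bigD1 (i, j))//= /A !eqxx/=.
    rewrite (_ : lebesgue_measure S = 0%E) ?mul0e//.
    by apply: null_set_setU; [exact: measurable_set1|exact: measurable_set1|
      exact: lebesgue_measure_set1|exact: lebesgue_measure_set1].
- move=> X /= nX; have [QX|] := pselect (cube K X); last by right.
  left; have := QX i j; rewrite /= in_itv/= !le_eqVlt => /andP[/orP[/eqP <-|KX]]; first by left.
  by move=> /orP[/eqP ->|XK]; [right|exfalso; apply: nX; rewrite KX].
Qed.

Lemma measurable_bigprod d (T : measurableType d) I (s : seq I) (F : I -> T -> R) :
  (forall i, measurable_fun setT (F i)) ->
  measurable_fun setT (fun x => \prod_(i <- s) F i x).
Proof.
move=> mF; elim: s => [|a s IH].
  by under eq_fun do rewrite big_nil; exact: measurable_cst.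
by under eq_fun do rewrite big_cons; exact: measurable_funM.
Qed.

Lemma cvg_bigprod I (s : seq I) (F : I -> R^nat) (l : I -> R) :
  (forall i, F i k @[k --> \oo] --> l i) ->
  \prod_(i <- s) F i k @[k --> \oo] --> \prod_(i <- s) l i.
Proof.
move=> Fl; elim: s => [|a s IH].
  by under eq_fun do rewrite big_nil; rewrite big_nil; exact: cvg_cst.
by under eq_fun do rewrite big_cons; rewrite big_cons; exact: cvgM.
Qed.

Lemma indic_box (A : 'I_m -> 'I_n -> set TR) (X : M) :
  \1_(box A) X = \prod_p \1_(A p.1 p.2) (X p.1 p.2) :> R.
Proof.
rewrite indicE; have [XA|nXA] := boolP (X \in box A).
  rewrite big1// => -[i j] _; rewrite indicE mem_set//.
  by move: XA; rewrite inE; exact.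
rewrite notin_setE in nXA; have /existsNP[i /existsNP[j nAij]] := nXA.
by rewrite (bigD1 (i, j))//= indicE memNset// mul0r.
Qed.

Lemma Rint_indic (mu : {measure set M -> \bar R}) (f : M -> R) (A : set M) :
  measurable A -> Int mu f -> (forall X, 0 <= f X) ->
  (\int[mu]_(X in A) (f X)%:E)%E = (\int[mu]_X (f X * \1_A X))%:E.
Proof.
move=> mA intf f0; rewrite -RintE; last first.
  apply: (@IntM_bnd _ _ _ _ 1) => //.
  by apply: aeT => X; rewrite indicE; case: (_ \in _); rewrite ?normr1// normr0.
rewrite [LHS]integral_mkcond; apply: eq_integral => X _; rewrite patchE indicE.
by case: ifP => _; rewrite ?mulr1// mulr0.
Qed.

(** Products of plateau functions converge to indicators of open boxes, so e
    has integral 0 on open boxes: its positive and negative parts are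
    densities of measures that agree on them, hence everywhere. *)
Theorem fundamental_lemma (K : R) (e : M -> R) : Int (lcube m n K) e ->
  (forall b, (forall i j, bump K (b i j)) -> \int[lcube m n K]_X (e X * tprod b X) = 0) ->
  {ae lcube m n K, forall X, e X = 0}.
Proof.
move=> inte e0; have me := Int_meas inte.
pose ep X := Num.max (e X) 0; pose en X := Num.max (- e X) 0.
have mep : measurable_fun setT ep by exact: measurable_maxr.
have men : measurable_fun setT en by apply: measurable_maxr => //; exact: measurableT_comp.
have ep0 X : 0 <= ep X by rewrite le_max lexx orbT.
have en0 X : 0 <= en X by rewrite le_max lexx orbT.
have epn X : ep X - en X = e X.
  rewrite /ep /en; have /orP[eX|eX] := le_total 0 (e X).
    by rewrite max_l// max_r ?subr0// oppr_le0.
  by rewrite max_r// max_l ?oppr_ge0// sub0r opprK.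
have iep : Int (lcube m n K) ep.
  apply: (Int_le (Int_norm inte)) => //; apply: aeT => X.
  by rewrite ger0_norm// ge_max ler_norm normr_ge0.
have ien : Int (lcube m n K) en.
  apply: (Int_le (Int_norm inte)) => //; apply: aeT => X.
  by rewrite ger0_norm// ge_max -normrN ler_norm normr_ge0.
have norm_indic (A : set M) (X : M) : `|\1_A X : R| <= 1.
  by rewrite indicE; case: (_ \in _); rewrite ?normr1// normr0.
have obox (a b : 'I_m -> 'I_n -> R) :
    \int[lcube m n K]_X (e X * \1_(box (fun i j => `]a i j, b i j[%classic)) X) = 0.
  (* the box is cut down to the cube, in which the bumps have to be supported *)
  pose a' i j := Num.max (a i j) (- K); pose b' i j := Num.min (b i j) K.
  pose pl k i j := plateau (a' i j) (b' i j) k.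
  have bpl k i j : bump K (pl k i j).
    by apply: bump_plateau; rewrite ?le_max ?ge_min lexx orbT.
  have cpl k : continuous (tprod (pl k)).
    by apply: continuous_tprod => i j; apply: smooth1_continuous; have [] := bpl k i j.
  have mB : measurable (box (fun i j => `]a i j, b i j[%classic) : set M).
    by apply: measurable_box => i j; exact: measurable_itv.
  have ieB : Int (lcube m n K) (fun X => e X * \1_(box (fun i j => `]a i j, b i j[%classic)) X).
    by apply: (@IntM_bnd _ _ _ _ 1) => //; exact: aeT.
  have [] := @dominated_convergence _ M R (lcube m n K) setT measurableT
      (fun k => EFin \o (fun X => e X * tprod (pl k) X))
      (EFin \o (fun X => e X * \1_(box (fun i j => `]a i j, b i j[%classic)) X))
      (EFin \o (fun X => `|e X|)).
  - by move=> k; apply: measurable_int (IntM_continuous_mx inte (cpl k)).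
  - exact: measurable_int ieB.
  - apply: aeS (ae_open_cube K) => X KXK _; apply: cvg_EFin; first exact: nearW.
    apply: cvgM; first exact: cvg_cst.
    rewrite indic_box; apply: cvg_bigprod => -[i j] /=.
    rewrite [X in _ --> X](_ : _ = (a' i j < X i j < b' i j)%R%:R); first exact: cvg_plateau.
    rewrite indicE mem_setE in_itv/= /a' /b' gt_max lt_min.
    by have /andP[-> ->] := KXK i j; rewrite !andbT.
  - exact: Int_norm.
  - apply: aeT => X k _ /=; rewrite lee_fin normrM ler_piMr// normr_prod.
    apply: prodr_ile1 => -[i j] _; rewrite normr_ge0 ger0_norm ?plateau_ge0//.
    exact: plateau_le1.
  - move=> _ _.
    have ex0 k : (\int[lcube m n K]_X (EFin \o (fun X => (e X * tprod (pl k) X)%R)) X = 0)%E.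
      by rewrite [LHS]RintE ?e0//; exact: IntM_continuous_mx.
    rewrite (_ : [sequence _]_n = cst 0%E); last by apply/funext => k; exact: ex0.
    move/cvg_lim => /(_ (@ereal_hausdorff R)); rewrite lim_cst//.
    by rewrite [X in _ = X -> _]RintE// => -[].
pose m1 := mdensity (lcube m n K) mep ep0.
pose m2 := mdensity (lcube m n K) men en0.
have m12 A : measurable A -> m1 A = m2 A.
  apply: measure_unique_itv => [a b|k].
    rewrite -[LHS]/(\int[lcube m n K]_(X in _) (ep X)%:E)%E -[RHS]/(\int[lcube m n K]_(X in _) (en X)%:E)%E.
    have mB : measurable (box (fun i j => `]a i j, b i j[%classic) : set M).
      by apply: measurable_box => i j; exact: measurable_itv.
    rewrite !Rint_indic//; congr EFin; apply/eqP; rewrite -subr_eq0 -RintegralB//.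
    + apply/eqP; rewrite -[RHS](obox a b); apply: eq_Rintegral => X _.
      by rewrite -mulrBl epn.
    + by apply: (@IntM_bnd _ _ _ _ 1) => //; exact: aeT.
    + by apply: (@IntM_bnd _ _ _ _ 1) => //; exact: aeT.
  rewrite -[X in (X < _)%E]/(\int[lcube m n K]_(X in _) (ep X)%:E)%E.
  rewrite Rint_indic ?ltry//; exact: measurable_cube.
have : ae_eq (lcube m n K) setT (EFin \o ep) (EFin \o en).
  apply: integral_ae_eq => //; first exact/measurable_EFinP.
  by move=> A _ mA; exact: m12.
by apply: aeS => X /(_ I)[] epen; rewrite -epn epen subrr.
Qed.

End fundamental_lemma.

(** * Weak partial derivatives and lines *)

Section weak_partial.
Context (R : realType) (m n : nat).
Let TR : measurableType _ := measurableTypeR R.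
Local Notation M := 'M[R]_(m, n).
Local Notation leb := (@lebesgue_mx R m n).

Lemma closed_measurable_mx (A : set M) : closed A -> measurable A.
Proof.
move=> cA; rewrite -[A]setCK; apply: measurableC; apply: sub_sigma_algebra.
exact: closed_openC.
Qed.

Lemma Int_lcube (K : R) (u : M -> R) : measurable_fun setT u ->
  Int (lcube m n K) u <-> leb.-integrable (cube K) (EFin \o u).
Proof. by move=> mu; apply: integrable_mfrestr; exact/measurable_EFinP. Qed.

Lemma loc_integrableP (u : M -> R) : loc_integrable u <->
  measurable_fun setT u /\ forall K : nat, Int (lcube m n K%:R) u.
Proof.
split=> -[mu lu]; split=> // K; first by apply/(Int_lcube _ mu); apply: lu; exact: compact_cube.
move=> cK; have [N _ KN] := compact_sub_cube cK.
apply: (@integrableS _ _ _ _ (cube N%:R)) => //.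
- exact: measurable_cube.
- by apply: closed_measurable_mx; apply: compact_closed => //; exact: norm_hausdorff.
- exact/(Int_lcube _ mu).
Qed.

Lemma Rint_lcube (K : R) (f : M -> R) : measurable_fun setT f ->
  (forall X, ~ cube K X -> f X = 0) -> \int[leb]_X f X = \int[lcube m n K]_X f X.
Proof.
move=> mf f0; rewrite /Rintegral; congr fine.
rewrite [RHS]integral_mfrestr; last exact/measurable_EFinP.
rewrite [RHS]integral_mkcond; apply: eq_integral => X _; rewrite patchE.
by case: ifPn => // /negP; rewrite inE => /f0 ->.
Qed.

Section direction.
Variables (i : 'I_m) (j : 'I_n).
Local Notation upd := (upd i j).
Local Notation d_ := (delta_mx i j).

Lemma derive_support (K : R) (phi : M -> R) : (forall X, phi X != 0 -> cube (K - 1) X) ->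
  forall X, ~ cube K X -> 'D_d_ phi X = 0.
Proof.
move=> phiK X nQX.
have {nQX}/existsNP[k /existsNP[l nXkl]] := nQX.
have KX : K < `|X k l|.
  by rewrite ltNge; apply/negP; rewrite ler_norml => XK; apply: nXkl; rewrite /= in_itv.
have nE : \near X, phi X = cst 0 X.
  apply/nbhs_ballP; exists 1 => //= Y [_ XY].
  apply/eqP/negPn/negP => /phiK/(_ k l) /=; rewrite in_itv/= -ler_norml => YK.
  have := XY k l; rewrite -ball_normE/= => XY1.
  have : `|X k l| <= `|X k l - Y k l| + `|Y k l| by rewrite -{1}[X k l](subrK (Y k l)) ler_normD.
  lra.
by rewrite (near_eq_derive _ nE); have [_ ->] := is_derive_cst (0 : R) X d_.
Qed.

Lemma Rslice (K : R) (F : M -> R) : 0 <= K -> Int (lcube m n K) F ->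
  [/\ {ae lcube m n K, forall X, Int (lseg K) (fun t => F (upd X t))},
      Int (lcube m n K) (fun X => \int[lseg K]_t F (upd X t)) &
      \int[lcube m n K]_X \int[lseg K]_t F (upd X t) = (K *+ 2) * \int[lcube m n K]_X F X].
Proof.
move=> K0 iF; have iFu := integrable_slice i j K0 iF.
pose f (p : M * TR) := F (upd p.1 p.2).
have iff : Int (lcube m n K \x lseg K)%E f by exact: iFu.
split; first exact: (ae_Int1 iff).
  by have [] := Rfubini1 iff.
have [i1 E] := Rfubini1 iff.
have := integral_slice i j K0 iF.
have -> : (\int[lcube m n K]_X \int[lseg K]_t (EFin \o F) (upd X t) =
    \int[lcube m n K]_X (\int[lseg K]_t F (upd X t))%:E)%E.
  apply: ae_eq_integral => //.
  - by apply: (measurable_fubini_F iff).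
  - exact: measurable_int i1.
  - by apply: aeS (ae_Int1 iff) => X iX _; exact: RintE.
by rewrite !RintE// -EFinM => -[].
Qed.

(** Absolute continuity of u along almost every segment in the direction (i, j),
    with derivative g. The equality is required for almost every t only, so that
    the notion depends on u and g up to null sets. *)
Definition ac_on_lines (u g : M -> R) := forall K : nat, (0 < K)%N ->
  {ae lcube m n K%:R, forall X, exists c : R, {ae lseg K%:R, forall t,
    u (upd X t) = c + prim K%:R (fun s => g (upd X s)) t}}.

Lemma measurable_upd_line (u : M -> R) X : measurable_fun setT u ->
  measurable_fun [set: TR] (fun t => u (upd X t)).
Proof.
move=> mu; apply: (measurableT_comp mu).
exact: (measurableT_comp (measurable_updp i j) (pair1_measurable X)).
Qed.

(** Integrating over the lines first, the identity that defines weak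
    derivatives becomes an integration by parts on each line. *)
Theorem ac_on_lines_weak (u g : M -> R) : loc_integrable u -> loc_integrable g ->
  ac_on_lines u g -> is_weak_partial i j u g.
Proof.
move=> lu lg ac; split => // phi tphi.
have [mu iu] := (loc_integrableP u).1 lu; have [mg ig] := (loc_integrableP g).1 lg.
have [K K0 phiK] := test_function_support tphi.
have [sphi _] := tphi.
have cphi : continuous phi by have [] := sphi 0%N.
have [_ /(_ i j)[dphi [cdphi _]]] := sphi 1%N.
have mphi := measurable_continuous_mx cphi; have mdphi := measurable_continuous_mx cdphi.
have phi0 := support_vanish phiK.
rewrite (@Rint_lcube K%:R); last 2 first.
- exact: measurable_funM.
- by move=> X nQ; rewrite (derive_support phiK)// mulr0.
rewrite [in RHS](@Rint_lcube K%:R); last 2 first.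
- exact: measurable_funM.
- by move=> X nQ; rewrite phi0// mulr0.
have iud := IntM_continuous_mx (iu K) cdphi; have igp := IntM_continuous_mx (ig K) cphi.
have KR : 0 <= K%:R :> R by [].
have [_ ii isl] := Rslice KR (IntD iud igp).
have : \int[lcube m n K%:R]_X \int[lseg K%:R]_t
    (u (upd X t) * 'D_d_ phi (upd X t) + g (upd X t) * phi (upd X t)) = 0.
  rewrite (@Rint_ae _ _ _ (lcube m n K%:R) _ (cst 0)) ?Rintegral_cst ?mul0r//.
    exact: (Int_meas ii).
  have [ug _ _] := Rslice KR (iu K); have [gg _ _] := Rslice KR (ig K).
  have := ac K K0; apply: aeS2 (aeS2 (fun X a b => conj a b) ug gg) => X [iuX igX] [c uE].
  have cdl : continuous (fun t => 'D_d_ phi (upd X t)).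
    by move=> t; apply: (@continuous_comp _ _ _ (upd X) (fun Z => 'D_d_ phi Z)); [exact: continuous_upd|exact: cdphi].
  have cl : continuous (fun t => phi (upd X t)).
    by move=> t; apply: (@continuous_comp _ _ _ (upd X) phi); [exact: continuous_upd|exact: cphi].
  have endp t : `|t| = K%:R -> phi (upd X t) = 0.
    move=> tK; apply/eqP/negPn/negP => /phiK/(_ i j); rewrite /= in_itv/= -ler_norml upd_same tK; lra.
  rewrite RintegralD//; last 2 first.
  - exact: IntM_continuous.
  - exact: IntM_continuous.
  have -> : \int[lseg K%:R]_t (u (upd X t) * 'D_d_ phi (upd X t)) =
      - \int[lseg K%:R]_t (g (upd X t) * phi (upd X t)).
    apply: (@ac_by_parts R K%:R c (fun t => u (upd X t)) (fun t => g (upd X t))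
      (fun t => phi (upd X t)) (fun t => 'D_d_ phi (upd X t))) => //.
    - exact: measurable_upd_line.
    - by move=> t _; exact: is_derive_upd.
    - by rewrite endp// normrN ger0_norm.
    - by rewrite endp// ger0_norm.
  exact: addNr.
rewrite isl RintegralD// => /eqP; rewrite mulf_eq0 mulrn_eq0/= pnatr_eq0 -leqn0 leqNgt K0/=.
by rewrite addr_eq0 => /eqP.
Qed.

Lemma tprod_support (K : R) (b : 'I_m -> 'I_n -> R -> R) (X : M) :
  (forall k l, bump K (b k l)) -> ~ cube K X -> tprod b X = 0.
Proof.
move=> bb nQ; have {nQ}/existsNP[k /existsNP[l nXkl]] := nQ.
rewrite /tprod (bigD1 (k, l))//= (bb k l).2 ?mul0r//.
by rewrite leNgt; apply/negP => /ltW; rewrite ler_norml => XK; apply: nXkl; rewrite /= in_itv.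
Qed.

Lemma derive_tprod_subst (b : 'I_m -> 'I_n -> R -> R) (psi dpsi : R -> R) (X : M) :
  (forall k l, smooth1 (b k l)) -> smooth1 psi ->
  (forall x : R, is_derive x 1 psi (dpsi x)) ->
  'D_d_ (tprod (subst_entry b i j psi)) X = tprod (subst_entry b i j dpsi) X.
Proof.
move=> sb spsi dpsiE; set b' := subst_entry b i j psi.
have sb' k l : smooth1 (b' k l) by rewrite /b' /subst_entry; case: ifP.
have [_ ->] := is_derive_tprod i j X sb'.
have b'ij : b' i j = psi by rewrite /b' /subst_entry !eqxx.
rewrite !tprod_subst b'ij derive1E; have [_ ->] := dpsiE (X i j); congr (_ * _).
apply: eq_bigr => -[k l]; rewrite xpair_eqE /b' /subst_entry /=.
by case: ifP.
Qed.

Lemma plateau_gt0 (a b t : R) : a < t < b -> 0 < plateau a b 0 t.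
Proof.
move=> /andP[at_ tb]; rewrite /plateau /flat !mul1r !subr_gt0 at_ tb.
by rewrite mulr_gt0// hornerC mul1r expR_gt0.
Qed.

Lemma ex_unit_bump (K : R) : 0 < K ->
  exists2 rho : R -> R, bump K rho & \int[lseg K]_t rho t = 1.
Proof.
move=> K0; have bp : bump K (plateau (- K) K 0) by exact: bump_plateau.
have cp : continuous (plateau (- K) K 0) by apply: smooth1_continuous; case: bp.
have ip : Int (lseg K) (plateau (- K) K 0) := Int_continuous K cp.
set I := \int[lseg K]_t plateau (- K) K 0 t.
have I0 : I != 0.
  apply/eqP => IE.
  have : (\int[lseg K]_t `|(plateau (- K) K 0 t)%:E| = 0)%E.
    under eq_integral do rewrite gee0_abs ?lee_fin ?plateau_ge0//.
    by rewrite RintE// -/I IE.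
  move=> /(ae_eq_integral_abs (lseg K) measurableT (measurable_int _ ip)) p0.
  case: p0 => A [mA A0 sA].
  have sub : `]- K, K[%classic `<=` A.
    move=> t; rewrite /= in_itv/= => /plateau_gt0 pt; apply: sA => /(_ Logic.I)[] p0.
    by move: pt; rewrite p0 ltxx.
  have : (lseg K (`]((- K)%R), K[%classic : set TR) <= lseg K A)%E by apply: le_measure; rewrite ?inE//.
  rewrite lsegE setIidl; last by apply: subset_itv_oo_cc.
  rewrite lebesgue_measure_itv/= lte_fin A0.
  by case: ifPn => [_|]; rewrite -?EFinB ?lee_fin; lra.
exists (fun t => plateau (- K) K 0 t * I^-1); first exact: bumpM.
by rewrite RintegralZr// -/I divff.
Qed.

(** Let v be the primitive of g along the lines. Then w = u - v has weak
    derivative 0, so it should be constant along the lines, equal to its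
    average c against a unit bump rho. Testing w - c against a product b of
    bumps amounts to testing w against b with b i j replaced by b i j - (int b
    i j) rho; the latter has integral 0, so it is the derivative of a bump
    psi, and b with b i j replaced by psi is a test function. *)
Theorem weak_ac_on_lines (u g : M -> R) : is_weak_partial i j u g -> ac_on_lines u g.
Proof.
move=> [lu lg weak] K K0.
have [mu iu] := (loc_integrableP u).1 lu; have [mg ig] := (loc_integrableP g).1 lg.
have KR : 0 <= K%:R :> R by [].
have K0R : 0 < K%:R :> R by rewrite ltr0n.
pose k : R := K%:R.
have [rho brho rho1] := ex_unit_bump K0R.
have crho : continuous rho := smooth1_continuous brho.1.
have mrho : measurable_fun setT rho by exact: continuous_measurable_fun.
have [Brho rhoB] := continuous_bounded_seg k crho.
pose v X := prim k (fun s => g (upd X s)) (X i j).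
pose w X := u X - v X.
pose c X := \int[lseg k]_s (w (upd X s) * rho s).
have vupd X t : v (upd X t) = prim k (fun s => g (upd X s)) t.
  by rewrite /v upd_same; congr prim; apply/funext => s; rewrite upd_upd.
have cupd X t : c (upd X t) = c X.
  by rewrite /c; apply: eq_Rintegral => s _; rewrite upd_upd.
have iv : Int (lcube m n k) v.
  pose f (p : M * TR) : R := g (upd p.1 p.2) * ((p.2 : R) <= p.1 i j)%R%:R.
  suff iff : Int (lcube m n k \x lseg k)%E f by have [] := Rfubini1 iff.
  apply: (@IntM_bnd _ _ R _ 1 (fun p : M * TR => g (upd p.1 p.2))).
  - exact: (integrable_slice i j KR (ig K)).
  - apply: measurable_step; first exact: measurable_snd.
    exact: (measurableT_comp (@measurable_entry R m n i j) measurable_fst).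
  - by apply: aeT => p; exact: step_le1.
have iw : Int (lcube m n k) w := IntB (iu K) iv.
have ic : Int (lcube m n k) c.
  pose f (p : M * TR) : R := w (upd p.1 p.2) * rho p.2.
  suff iff : Int (lcube m n k \x lseg k)%E f by have [] := Rfubini1 iff.
  apply: (@IntM_bnd _ _ R _ Brho (fun p : M * TR => w (upd p.1 p.2))).
  - exact: (integrable_slice i j KR iw).
  - exact: (measurableT_comp mrho measurable_snd).
  - by apply: (@ae_snd _ _ _ _ R (lcube m n k) (lseg k) (fun t => `|rho t| <= Brho)); exact: ae_seg.
have main b : (forall p q, bump k (b p q)) ->
    \int[lcube m n k]_X ((w X - c X) * tprod b X) = 0.
  move=> bb; have sb p q : smooth1 (b p q) by have [] := bb p q.
  have cb p q : continuous (b p q) := smooth1_continuous (sb p q).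
  pose b0 := \int[lseg k]_t b i j t.
  pose dpsi t := b i j t - rho t * b0.
  have bdpsi : bump k dpsi by apply: bumpB; [exact: bb|exact: bumpM].
  have cdpsi : continuous dpsi := smooth1_continuous bdpsi.1.
  have ib : Int (lseg k) (b i j) := Int_continuous k (cb i j).
  have irho : Int (lseg k) rho := Int_continuous k crho.
  have [psi bpsi dpsiE] : exists2 psi, bump k psi & forall x : R, is_derive x 1 psi (dpsi x).
    apply: bump_primitive => //; rewrite -Rint_lseg; last exact: continuous_measurable_fun.
    rewrite /dpsi RintegralB//; last first.
      by apply: IntM_continuous => // t; exact: cvg_cst.
    by rewrite RintegralZr// rho1 mul1r subrr.
  have cpsi : continuous psi := smooth1_continuous bpsi.1.
  pose Psi := tprod (subst_entry b i j psi).
  pose DPsi := tprod (subst_entry b i j dpsi).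
  have bPsi p q : bump k (subst_entry b i j psi p q) by rewrite /subst_entry; case: ifP.
  have bDPsi p q : bump k (subst_entry b i j dpsi p q) by rewrite /subst_entry; case: ifP.
  have cPsi : continuous Psi by apply: continuous_tprod => p q; apply: smooth1_continuous; case: (bPsi p q).
  have cDPsi : continuous DPsi by apply: continuous_tprod => p q; apply: smooth1_continuous; case: (bDPsi p q).
  have iDPsi : Int (lcube m n k) (fun X => u X * DPsi X) := IntM_continuous_mx (iu K) cDPsi.
  have iPsi : Int (lcube m n k) (fun X => g X * Psi X) := IntM_continuous_mx (ig K) cPsi.
  have weak0 : \int[lcube m n k]_X (u X * DPsi X + g X * Psi X) = 0.
    rewrite RintegralD//.
    have := weak Psi (test_tprod bPsi).
    have -> : \int[leb]_X (u X * 'D_d_ Psi X) = \int[leb]_X (u X * DPsi X).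
      by apply: eq_Rintegral => X _; rewrite [in LHS](derive_tprod_subst _ sb bpsi.1 dpsiE).
    rewrite !(@Rint_lcube k); first by move=> ->; rewrite addNr.
    - by apply: measurable_funM => //; exact: measurable_continuous_mx.
    - by move=> X nQ; rewrite /Psi (tprod_support bPsi)// mulr0.
    - by apply: measurable_funM => //; exact: measurable_continuous_mx.
    - by move=> X nQ; rewrite /DPsi (tprod_support bDPsi)// mulr0.
  have iF : Int (lcube m n k) (fun X => (w X - c X) * tprod b X).
    by apply: IntM_continuous_mx; [exact: IntB|exact: continuous_tprod].
  have [_ iF1 EF] := Rslice KR iF.
  have [_ iG1 EG] := Rslice KR (IntD iDPsi iPsi).
  have k2 : (k *+ 2) != 0 by rewrite mulrn_eq0/= gt_eqF.
  apply: (mulfI k2); rewrite mulr0 -EF.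
  transitivity ((k *+ 2) * \int[lcube m n k]_X (u X * DPsi X + g X * Psi X)); last first.
    by rewrite weak0 mulr0.
  rewrite -EG; apply: Rint_ae; [exact: Int_meas iF1|exact: Int_meas iG1|].
  have [ug _ _] := Rslice KR (iu K); have [gg _ _] := Rslice KR (ig K).
  have [wg _ _] := Rslice KR iw.
  apply: aeS2 (aeS2 (fun X a b => conj a b) ug gg) wg => X [iuX igX] iwX.
  pose B := \prod_(p | p != (i, j)) b p.1 p.2 (X p.1 p.2).
  transitivity (B * \int[lseg k]_t (u (upd X t) * dpsi t + g (upd X t) * psi t)); last first.
    rewrite -RintegralZl//; last by apply: IntD; exact: IntM_continuous.
    apply: eq_Rintegral => t _; rewrite /Psi /DPsi !tprod_subst upd_same.
    have -> : \prod_(p | p != (i, j)) b p.1 p.2 (upd X t p.1 p.2) = B.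
      by apply: eq_bigr => -[p q]; rewrite mxE xpair_eqE => /negbTE ->.
    by ring.
  transitivity (B * \int[lseg k]_t (w (upd X t) * dpsi t)).
    transitivity (B * (\int[lseg k]_t (w (upd X t) * b i j t) - c X * b0)).
      rewrite /b0 -RintegralZl//; last first.
      rewrite -RintegralB//; last 2 first.
      - exact: IntM_continuous.
      - exact: IntZ.
      rewrite -RintegralZl//; last by apply: IntB; [exact: IntM_continuous|exact: IntZ].
      by apply: eq_Rintegral => t _; rewrite tprod_upd cupd -/B; ring.
    congr (_ * _); rewrite /c -RintegralZr//; last exact: IntM_continuous.
    rewrite -RintegralB//; last 2 first.
    - exact: IntM_continuous.
    - by apply: IntM_continuous; [exact: IntM_continuous|move=> t; exact: cvg_cst].
    by apply: eq_Rintegral => t _; rewrite /dpsi; ring.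
  congr (_ * _).
  have psik : psi k = 0 by apply: bpsi.2; rewrite ger0_norm.
  have := @prim_by_parts R k (fun t => g (upd X t)) psi dpsi KR igX cdpsi (fun t _ => dpsiE t) cpsi psik.
  rewrite RintegralD//; last 2 first.
  - exact: IntM_continuous.
  - exact: IntM_continuous.
  move=> /(congr1 -%R); rewrite opprK => <-.
  have iprim : Int (lseg k) (fun t => prim k (fun s => g (upd X s)) t * dpsi t).
    by apply: IntM_continuous => //; exact: Int_prim.
  rewrite -RintegralB//; last exact: IntM_continuous.
  by apply: eq_Rintegral => t _; rewrite /w vupd; ring.
have wc0 := fundamental_lemma (IntB iw ic) main.
apply: aeS (ae_slice i j KR wc0) => X wcX; exists (c X).
by apply: aeS wcX => t; rewrite cupd /w vupd; lra.
Qed.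

End direction.
End weak_partial.

(** * Calculus of weak partial derivatives *)

Section weak_calculus.
Context (R : realType) (m n : nat).
Local Notation M := 'M[R]_(m, n).
Local Notation leb := (@lebesgue_mx R m n).

Lemma ae_leb_lcube (P : M -> Prop) (K : R) :
  {ae leb, forall X, P X} -> {ae lcube m n K, forall X, P X}.
Proof. by move=> aeP; apply/ae_mfrestr; apply: aeS aeP. Qed.

Lemma ae_lcube_leb (P : M -> Prop) :
  (forall K : nat, {ae lcube m n K%:R, forall X, P X}) -> {ae leb, forall X, P X}.
Proof.
move=> aeP.
have H (K : nat) : {ae leb, forall X, cube K%:R X -> P X}.
  by have /ae_mfrestr := aeP K.
have /ae_foralln := H.
by apply: aeS => X PX; have [K [XK _]] := cubeP X; exact: PX XK.
Qed.

Lemma loc_integrable_ae (u v : M -> R) : loc_integrable u -> measurable_fun setT v ->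
  {ae leb, forall X, u X = v X} -> loc_integrable v.
Proof.
move=> /loc_integrableP[mu iu] mv uv; apply/loc_integrableP; split => // K.
exact: Int_ae (iu K) mv (ae_leb_lcube _ uv).
Qed.

Lemma Int_loc_integrable (u : M -> R) : Int leb u -> loc_integrable u.
Proof.
move=> iu; have mu := Int_meas iu; apply/loc_integrableP; split => // K.
by apply/(Int_lcube _ mu); apply: integrableS iu => //; exact: measurable_cube.
Qed.

Section partial.
Variables (i : 'I_m) (j : 'I_n).
Local Notation upd := (upd i j).

Lemma weak_partial_ae (u v g h : M -> R) : is_weak_partial i j u g ->
  measurable_fun setT v -> measurable_fun setT h ->
  {ae leb, forall X, u X = v X} -> {ae leb, forall X, g X = h X} ->
  is_weak_partial i j v h.
Proof.
move=> [lu lg weak] mv mh uv gh; split.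
- exact: loc_integrable_ae uv.
- exact: loc_integrable_ae gh.
move=> phi tphi; have [sphi _] := tphi.
have cphi : continuous phi by have [] := sphi 0%N.
have [_ /(_ i j)[dphi [cdphi _]]] := sphi 1%N.
have mphi := measurable_continuous_mx cphi; have mdphi := measurable_continuous_mx cdphi.
rewrite (@Rint_ae _ _ _ leb _ (fun X => u X * 'D_(delta_mx i j) phi X)); last 3 first.
- exact: measurable_funM.
- by apply: measurable_funM => //; case: lu.
- by apply: aeS uv => X ->.
rewrite weak//; congr (- _); apply: Rint_ae.
- by apply: measurable_funM => //; case: lg.
- exact: measurable_funM.
- by apply: aeS gh => X ->.
Qed.

Lemma weak_partial_unique (u g h : M -> R) :
  is_weak_partial i j u g -> is_weak_partial i j u h -> {ae leb, forall X, g X = h X}.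
Proof.
move=> [_ lg wg] [_ lh wh]; apply: ae_lcube_leb => K.
have [mg ig] := (loc_integrableP g).1 lg; have [mh ih] := (loc_integrableP h).1 lh.
suff : {ae lcube m n K%:R, forall X, g X - h X = 0}.
  by apply: aeS => X /eqP; rewrite subr_eq0 => /eqP.
apply: fundamental_lemma (IntB (ig K) (ih K)) _.
move=> b bb; have tb := test_tprod bb.
have sb k l : smooth1 (b k l) by have [] := bb k l.
have cb : continuous (tprod b) by apply: continuous_tprod => k l; exact: smooth1_continuous.
have mb := measurable_continuous_mx cb.
have E (f : M -> R) : measurable_fun setT f ->
    \int[lcube m n K%:R]_X (f X * tprod b X) = \int[leb]_X (f X * tprod b X).
  move=> mf; rewrite (@Rint_lcube _ _ _ K%:R)//; first exact: measurable_funM.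
  by move=> X nQ; rewrite (tprod_support bb nQ) mulr0.
transitivity (\int[lcube m n K%:R]_X (g X * tprod b X) - \int[lcube m n K%:R]_X (h X * tprod b X)).
  rewrite -RintegralB//; last 2 first.
  - exact: IntM_continuous_mx.
  - exact: IntM_continuous_mx.
  by apply: eq_Rintegral => X _; rewrite mulrBl.
by rewrite !E// -[X in X - _]opprK -wg// wh// opprK subrr.
Qed.

(** On almost every line u agrees with an absolutely continuous function, to
    which ac_power applies. The factor u^(a-2) u is u^(a-1) with the value 0
    on {u = 0}. *)
Lemma weak_partial_power (a : R) (u g : M -> R) : 0 < a -> (forall X, 0 <= u X) ->
  is_weak_partial i j u g ->
  let h X := a * (u X `^ (a - 2) * u X) * g X in
  loc_integrable (fun X => u X `^ a) -> loc_integrable h ->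
  is_weak_partial i j (fun X => u X `^ a) h.
Proof.
move=> a0 u0 wug h lua lh; apply: ac_on_lines_weak => // K K0.
have ac := weak_ac_on_lines wug K0; have [lu lg _] := wug.
have [mu iu] := (loc_integrableP u).1 lu; have [mg ig] := (loc_integrableP g).1 lg.
have [mh ih] := (loc_integrableP h).1 lh.
have KR : 0 <= K%:R :> R by [].
have [gg _ _] := Rslice i j KR (ig K); have [hh _ _] := Rslice i j KR (ih K).
apply: aeS2 (aeS2 (fun X a b => conj a b) gg hh) ac => X [igX ihX] [c uE].
pose v s := c + prim K%:R (fun s => g (upd X s)) s.
pose hv s := a * (`|v s| `^ (a - 2) * v s) * g (upd X s).
have mv : measurable_fun setT v.
  by apply: measurable_funD => //; exact: Int_meas (Int_prim igX).
have mhv : measurable_fun setT hv.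
  apply: measurable_funM; last exact: measurable_upd_line.
  apply: measurable_funM => //; apply: measurable_funM => //.
  by apply: (measurableT_comp (measurable_powR _)); exact: measurableT_comp.
have hhv : {ae lseg K%:R, forall s, h (upd X s) = hv s}.
  by apply: aeS uE => s uE; rewrite /h /hv /v -uE ger0_norm.
have ihv : Int (lseg K%:R) hv := Int_ae ihX mhv hhv.
exists (`|c| `^ a).
have aeK : {ae lseg K%:R, forall t : R, - K%:R <= t <= K%:R} by exact: ae_seg.
apply: aeS2 uE aeK => t uE tK.
rewrite -[LHS](_ : `|v t| `^ a = _); last by rewrite /v -uE ger0_norm.
rewrite /v (ac_power a0 igX ihv tK); congr (_ + _).
apply: Rint_ae.
- by apply: measurable_funM => //; exact: measurable_step.
- apply: measurable_funM; last exact: measurable_step.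
  exact: measurable_upd_line.
- by apply: aeS hhv => s ->.
Qed.

End partial.
End weak_calculus.

(** * The Gaussian kernel *)

Section gauss.
Context (R : realType).
Let TR : measurableType _ := measurableTypeR R.

(** The one-dimensional factor of eta. *)
Definition gauss (v t : R) : R := (2 * pi * v) `^ (- 2^-1) * expR (- t ^+ 2 / (2 * v)).

Lemma gauss_gt0 v t : 0 < v -> 0 < gauss v t.
Proof. by move=> v0; rewrite mulr_gt0 ?expR_gt0// powR_gt0// !mulr_gt0// pi_gt0. Qed.

Lemma gaussN v t : gauss v (- t) = gauss v t.
Proof. by rewrite /gauss sqrrN. Qed.

Lemma gauss_normal_pdf v m t : 0 < v -> gauss v (t - m) = normal_pdf m (Num.sqrt v) t.
Proof.
move=> v0; rewrite normal_pdfE ?gt_eqF ?sqrtr_gt0// /gauss /normal_peak /normal_fun.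
rewrite sqr_sqrtr ?ltW// powRN powR12_sqrt; last by rewrite !mulr_ge0 ?pi_ge0// ltW.
by congr (_^-1 * expR (_ / _)); [congr Num.sqrt|]; rewrite -mulr_natl; ring.
Qed.

Lemma integral_gauss v m : 0 < v ->
  (\int[lebesgue_measure]_(t in [set: TR]) (gauss v (t - m))%:E = 1)%E.
Proof.
move=> v0; under eq_integral do rewrite gauss_normal_pdf//.
by apply: integral_normal_pdf; rewrite gt_eqF// sqrtr_gt0.
Qed.

Lemma is_derive_gauss v (x : R) : v != 0 ->
  is_derive x 1 (gauss v) (- (x / v) * gauss v x).
Proof.
move=> v0; rewrite /gauss.
apply: is_derive_eq; rewrite !scaler0 ?add0r ?addr0 /GRing.scale /= ?mulr0 ?mulr1 ?addr0 ?add0r.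
by field.
Qed.

Lemma smooth1_gauss v : v != 0 -> smooth1 (gauss v).
Proof.
move=> v0 k; elim: k => [|k IH].
  by move=> x; apply: is_derive_continuous (is_derive_gauss x v0).
exists (fun x => - (x / v) * gauss v x) => [x|]; first exact: is_derive_gauss.
apply: Ck1M => //.
have Cid : Ck1 k (fun x : R => x).
  case: k {IH} => [x|k]; first exact: cvg_id.
  by exists (cst 1) => [x|]; [exact: is_derive_id|exact: Ck1_cst].
rewrite (_ : (fun x : R => _) = (fun x => - v^-1 * x + 0)); last first.
  by apply/funext => x; rewrite addr0 mulNr mulrC.
exact: (Ck1_affine (- v^-1) 0 Cid).
Qed.

Lemma measurable_gauss v : v != 0 -> measurable_fun [set: TR] (gauss v).
Proof.
by move=> v0; apply: continuous_measurable_fun; exact: smooth1_continuous (smooth1_gauss v0).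
Qed.

(** The factor |t|^q is absorbed by doubling the variance, up to a constant. *)
Lemma gauss_moment_le (v q : R) : 0 < v -> 0 <= q ->
  exists2 C : R, 0 <= C & forall t, `|t| `^ q * gauss v t <= C * gauss (v * 2) t.
Proof.
move=> v0 q0.
pose n := (Num.truncn q).+1.
have qn : q <= n%:R by apply: ltW; exact: truncnS_gt.
have [A A0 hA] := poly_expR_bound (('X : {poly R}) ^+ n).
pose c := 2 * (v * 2); have c0 : 0 < c by rewrite !mulr_gt0.
pose B := 1 + c ^+ n * (1 + A).
have main t : `|t| `^ q * expR (- t ^+ 2 / c) <= B.
  pose x := t ^+ 2 / c.
  have x0 : 0 <= x by rewrite divr_ge0 ?sqr_ge0// ltW.
  have ex1 : expR (- x) <= 1 by rewrite -expR0 ler_expR oppr_le0.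
  have xn : x ^+ n * expR (- x) <= 1 + A.
    have /orP[x1|x1] := le_total x 1.
      have : x ^+ n * expR (- x) <= 1 * 1.
        by apply: ler_pM; rewrite ?exprn_ge0 ?expR_ge0// exprn_ile1.
      lra.
    have x0' : 0 < x by lra.
    have := hA x x0'; rewrite hornerXn => /(le_trans (ler_norm _)).
    have : A * x^-1 <= A by rewrite ler_piMr// invf_le1.
    lra.
  have tq : `|t| `^ q <= 1 + (t ^+ 2) ^+ n.
    have /orP[t1|t1] := le_total `|t| 1.
      have : `|t| `^ q <= 1.
        have -> : (1 : R) = 1 `^ q by rewrite powR1.
        by rewrite ge0_ler_powR ?nnegrE.
      have : 0 <= (t ^+ 2) ^+ n by rewrite exprn_ge0// sqr_ge0.
      lra.
    have : `|t| `^ q <= `|t| `^ n%:R by rewrite ler_powR.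
    rewrite powR_mulrn//.
    have : `|t| ^+ n <= (t ^+ 2) ^+ n.
      rewrite lerXn2r ?nnegrE ?sqr_ge0// -real_normK ?num_real// expr2 ler_peMr//.
    lra.
  rewrite mulNr -/x.
  apply: (@le_trans _ _ ((1 + (t ^+ 2) ^+ n) * expR (- x))).
    by rewrite ler_wpM2r ?expR_ge0.
  have -> : (t ^+ 2) ^+ n = c ^+ n * x ^+ n.
    by rewrite -exprMn /x mulrCA divff ?mulr1// gt_eqF.
  rewrite mulrDl mul1r -mulrA; apply: lerD => //.
  by rewrite ler_wpM2l// exprn_ge0// ltW.
pose N := (2 * pi * v) `^ (- 2^-1); pose N' := (2 * pi * (v * 2)) `^ (- 2^-1).
have N0 : 0 < N by rewrite powR_gt0// !mulr_gt0// pi_gt0.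
have N'0 : 0 < N' by rewrite powR_gt0// !mulr_gt0// pi_gt0.
have B0 : 0 <= B by rewrite addr_ge0// mulr_ge0 ?addr_ge0// exprn_ge0// ltW.
exists (N / N' * B) => [|t]; first by rewrite mulr_ge0// divr_ge0// ltW.
rewrite /gauss -/N -/N' -/c.
have -> : expR (- t ^+ 2 / (2 * v)) = expR (- t ^+ 2 / c) * expR (- t ^+ 2 / c).
  by rewrite -expRD; congr expR; rewrite /c; field; rewrite gt_eqF.
have -> : `|t| `^ q * (N * (expR (- t ^+ 2 / c) * expR (- t ^+ 2 / c))) =
  N * (`|t| `^ q * expR (- t ^+ 2 / c)) * expR (- t ^+ 2 / c) by ring.
have -> : N / N' * B * (N' * expR (- t ^+ 2 / c)) = N * B * expR (- t ^+ 2 / c).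
  by field; rewrite gt_eqF.
by rewrite ler_wpM2r ?expR_ge0// ler_wpM2l// ltW.
Qed.

Lemma gauss_moment (v q : R) : 0 < v -> 0 <= q -> exists C : R, forall m : R,
  (\int[lebesgue_measure]_(t in [set: TR]) (`|t - m| `^ q * gauss v (t - m))%:E <= C%:E)%E.
Proof.
move=> v0 q0; have [C C0 hC] := gauss_moment_le v0 q0; exists C => m.
have v20 : 0 < v * 2 by rewrite mulr_gt0.
have mg w : 0 < w -> measurable_fun [set: TR] (fun t : TR => gauss w (t - m)).
  move=> w0; apply: (measurableT_comp (measurable_gauss (lt0r_neq0 w0))).
  exact: measurable_funB.
rewrite -[leRHS]mule1 -(integral_gauss m v20) -ge0_integralZl//; last 2 first.
- by apply/measurable_EFinP; exact: mg.
- by move=> t _; rewrite lee_fin ltW// gauss_gt0.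
apply: ge0_le_integral => //.
- by move=> t _; rewrite lee_fin mulr_ge0 ?powR_ge0// ltW// gauss_gt0.
- apply/measurable_EFinP; apply: measurable_funM; last exact: mg.
  apply: (measurableT_comp (measurable_powR _)); apply: measurableT_comp => //.
  exact: measurable_funB.
- apply: measurable_funeM; apply/measurable_EFinP; exact: mg.
- by move=> t _; rewrite -EFinM lee_fin.
Qed.

End gauss.

Local Notation eta := Defs.eta.

Section eta_facts.
Context (R : realType) (d : nat) (v : R).
Hypothesis v0 : 0 < v.
Let TR : measurableType _ := measurableTypeR R.
Local Notation V := 'rV[R]_d.
Local Notation leb := (@lebesgue_mx R 1 d).

Lemma etaE (z : V) : eta v z = \prod_l gauss v (z 0 l).
Proof.
rewrite /eta /gauss big_split/= -expR_sum -mulr_suml sumrN; congr (_ * _).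
rewrite prodr_const card_ord -powR_mulrn ?powR_ge0// -powRrM.
by congr (_ `^ _); ring.
Qed.

Lemma eta_gt0 (z : V) : 0 < eta v z.
Proof. by rewrite etaE prodr_gt0// => l _; exact: gauss_gt0. Qed.

Lemma grad_etaE (z : V) i : grad_eta v z 0 i = - (z 0 i / v) * eta v z.
Proof.
rewrite mxE; have v1 : v != 0 by rewrite gt_eqF.
pose B := \prod_(l | l != i) gauss v (z 0 l).
have E (t : R) : eta v (upd 0 i z t) = gauss v t * B.
  rewrite etaE (bigD1 i)//= upd_same; congr (_ * _).
  by apply: eq_bigr => l /negbTE li; rewrite mxE li andbF.
have D : is_derive (z 0 i) 1 (fun s => eta v (upd 0 i z s)) (- (z 0 i / v) * eta v z).
  have -> : (fun s => eta v (upd 0 i z s)) = (fun s => gauss v s * B) by exact/funext.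
  have -> : eta v z = gauss v (z 0 i) * B by rewrite -E upd_id.
  have H := is_derive_gauss (z 0 i) v1.
  rewrite mulrA mulrC (_ : (fun s : R => _) = (fun s : R => B *: gauss v s)); last first.
    by apply/funext => s; rewrite mulrC.
  exact: is_deriveZ.
by have [_ ->] := is_derive_of_upd D.
Qed.

Lemma measurable_eta d' (T : measurableType d') (h : T -> V) :
  measurable_fun setT h -> measurable_fun setT (fun x => eta v (h x)).
Proof.
move=> mh; under eq_fun do rewrite etaE.
apply: measurable_bigprod => l.
apply: (measurableT_comp (measurable_gauss (lt0r_neq0 v0))).
exact: (measurableT_comp (@measurable_entry R 1 d 0 l) mh).
Qed.

Lemma integral_eta (x : V) : (\int[leb]_y (eta v (y - x))%:E = 1)%E.
Proof.
transitivity (\int[leb]_y \prod_(k < 1) \prod_l (gauss v (y k l - x 0 l))%:E)%E.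
  apply: eq_integral => y _; rewrite big_ord1 etaE prodEFin; congr EFin; apply: eq_bigr => l _.
  by rewrite !mxE.
rewrite (integral_mx_entries (g := fun _ l t => (gauss v (t - x 0 l))%:E)).
- by rewrite big_ord1 big1// => l _; exact: integral_gauss.
- move=> _ l; apply/measurable_EFinP.
  apply: (measurableT_comp (measurable_gauss (lt0r_neq0 v0))); exact: measurable_funB.
- by move=> _ l t; rewrite lee_fin ltW// gauss_gt0.
Qed.

Lemma eta_moment (q : R) : 0 <= q -> exists C : R, forall (i : 'I_d) (x : V),
  (\int[leb]_y (`|(y - x) 0 i| `^ q * eta v (y - x))%:E <= C%:E)%E.
Proof.
move=> q0; have [C hC] := gauss_moment v0 q0; exists C => i x.
pose g (_ : 'I_1) (l : 'I_d) (t : TR) : \bar R :=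
  (if l == i then `|t - x 0 l| `^ q * gauss v (t - x 0 l) else gauss v (t - x 0 l))%:E.
have -> : (\int[leb]_y (`|(y - x) 0 i| `^ q * eta v (y - x))%:E =
   \int[leb]_y \prod_(k < 1) \prod_l g k l (y k l))%E.
  apply: eq_integral => y _; rewrite big_ord1 /g prodEFin; congr EFin.
  rewrite etaE (bigD1 i)//= [RHS](bigD1 i)//= eqxx mulrA !mxE; congr (_ * _).
  by apply: eq_bigr => l /negbTE ->; rewrite !mxE.
have mB c : measurable_fun [set: TR] (fun t : TR => t - c) by exact: measurable_funB.
have mg c : measurable_fun [set: TR] (fun t : TR => gauss v (t - c)).
  exact: (measurableT_comp (measurable_gauss (lt0r_neq0 v0)) (mB c)).
rewrite (integral_mx_entries (g := g)).
- rewrite big_ord1 (bigD1 i)//= big1 => [|l /negbTE li].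
    by rewrite mule1 /g eqxx; exact: hC.
  by rewrite /g li; exact: integral_gauss.
- move=> k l; rewrite /g; case: (l == i); apply/measurable_EFinP; last exact: mg.
  apply: measurable_funM; last exact: mg.
  apply: (measurableT_comp (measurable_powR _)).
  exact: (measurableT_comp (@normr_measurable R setT) (mB (x 0 l))).
- by move=> k l t; rewrite /g lee_fin; case: ifP => _; rewrite ?mulr_ge0 ?powR_ge0// ltW// gauss_gt0.
Qed.

End eta_facts.

(** * The coupling density *)

Section density_integral.
Import HBNNSimple.
Context d (T : measurableType d) (R : realType).
Variables (mu P : {measure set T -> \bar R}) (f : T -> R).
Hypotheses (mf : measurable_fun setT f) (f0 : forall x, 0 <= f x).
Hypothesis Pf : forall A, measurable A -> P A = (\int[mu]_(x in A) (f x)%:E)%E.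

Lemma ge0_integral_density (h : T -> \bar R) :
  measurable_fun setT h -> (forall x, 0 <= h x)%E ->
  (\int[P]_x h x = \int[mu]_x (h x * (f x)%:E))%E.
Proof.
move=> mh h0.
pose g := nnsfun_approx measurableT mh.
have cvg_g (x : T) : (fun k => (g k x)%:E) @ \oo --> h x.
  exact: (cvg_nnsfun_approx measurableT mh).
have nd_g := nd_nnsfun_approx measurableT mh.
have mEf : measurable_fun setT (EFin \o f) by exact/measurable_EFinP.
transitivity (limn (fun n => \int[P]_x (g n x)%:E))%E.
  rewrite -monotone_convergence//.
  - by apply: eq_integral => x _; apply/esym/cvg_lim => //; exact: cvg_g.
  - by move=> n; exact/measurable_EFinP/measurable_funP.
  - by move=> n x _; rewrite lee_fin.
  - by move=> x _ k l kl; rewrite lee_fin; exact/lefP/nd_g.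
rewrite [X in limn X](_ : _ = (fun n => \int[mu]_x ((g n x)%:E * (f x)%:E))%E).
  rewrite -monotone_convergence//.
  - apply: eq_integral => x _; apply/cvg_lim => //.
    by apply: cvgeZr => //; exact: cvg_g.
  - by move=> n; apply: emeasurable_funM => //; exact/measurable_EFinP/measurable_funP.
  - by move=> n x _; rewrite mule_ge0// lee_fin.
  - by move=> x _ k l kl; rewrite lee_wpmul2r// lee_fin//; exact/lefP/nd_g.
apply/funext => n.
transitivity (\sum_(r \in range (g n)) \int[P]_x (r * \1_(g n @^-1` [set r]) x)%:E)%E.
  under eq_integral do rewrite fimfunE -fsumEFin//.
  rewrite ge0_integral_fsum//.
  - by move=> y; exact/measurable_EFinP/measurable_funM.
  - by move=> y x _; rewrite nnfun_muleindic_ge0.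
transitivity (\sum_(r \in range (g n)) \int[mu]_x ((r * \1_(g n @^-1` [set r]) x)%:E * (f x)%:E))%E.
  apply: eq_fsbigr => r /[!inE] -[x _ gxr].
  have r0 : 0 <= r by rewrite -gxr.
  have mgr : measurable (g n @^-1` [set r]) by rewrite -[X in measurable X]setTI; exact: measurable_funP.
  rewrite integralZl_indic_nnsfun// integral_indic// setIT Pf//.
  under [RHS]eq_integral do rewrite EFinM -muleA.
  rewrite ge0_integralZl_EFin//; last 2 first.
  - by move=> y _; rewrite mule_ge0// lee_fin.
  - by apply: emeasurable_funM => //; exact/measurable_EFinP.
  congr (_ * _)%E; rewrite [LHS]integral_mkcond; apply: eq_integral => y _.
  by rewrite patchE indicE; case: ifP => _; rewrite ?mul1e ?mul0e.
rewrite -ge0_integral_fsum//.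
- apply: eq_integral => x _; rewrite [in RHS]fimfunE -fsumEFin// ge0_mule_fsuml//.
  by move=> r; rewrite nnfun_muleindic_ge0.
- move=> r; apply: emeasurable_funM => //; exact/measurable_EFinP/measurable_funM.
- move=> r x _; apply: mule_ge0; last by rewrite lee_fin.
  by rewrite EFinM nnfun_muleindic_ge0.
Qed.

End density_integral.

Section rows.
Context (R : realType) (m n : nat).
Local Notation leb := (@lebesgue_mx R m n).

(** The preimage of a null set is a product of sets, one factor of which is
    null. *)
Lemma ae_row (j : 'I_m) (P : 'rV[R]_n -> Prop) : {ae @lebesgue_mx R 1 n, forall x, P x} ->
  {ae leb, forall X, P (row j X)}.
Proof.
move=> [A [mA A0 AP]]; exists (row j @^-1` A); split.
- by rewrite -[X in measurable X]setTI; exact: measurable_row.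
- have mrA : measurable (@row R m n j @^-1` A).
    by rewrite -[X in measurable X]setTI; exact: measurable_row.
  pose h (k : 'I_m) (x : 'rV[R]_n) : \bar R := if k == j then (\1_A x)%:E else 1%E.
  transitivity (\int[leb]_X \prod_k h k (row k X))%E.
    rewrite -[X in leb X = _]setIT -integral_indic//; apply: eq_integral => X _.
    rewrite (bigD1 j)//= big1 => [|k /negbTE kj]; last by rewrite /h kj.
    by rewrite mule1 /h eqxx.
  rewrite integral_mx_rows.
  + have A1 : (\int[@lebesgue_mx R 1 n]_x (\1_A x)%:E = 0)%E.
      by rewrite integral_indic// setIT; exact: A0.
    by rewrite (bigD1 j)//= /h eqxx A1 mul0e.
  + by move=> k; rewrite /h; case: (k == j) => //; exact/measurable_EFinP.
  + by move=> k x; rewrite /h; case: (k == j); rewrite ?lee_fin.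
- by move=> X nP; apply: AP.
Qed.

End rows.

Lemma measurable_inv_ge0 d (T : measurableType d) (R : realType) (h : T -> R) :
  measurable_fun setT h -> (forall x, 0 <= h x) -> measurable_fun setT (fun x => (h x)^-1).
Proof.
move=> mh h0; under eq_fun do rewrite -powR_inv1//.
exact: (measurableT_comp (measurable_powR _) mh).
Qed.

Section coupling.
Context (R : realType) (d N : nat) (eps : R) (mu : probability 'M[R]_(N, d) R).
Hypothesis eps0 : 0 < eps.
Local Notation V := 'rV[R]_d.
Local Notation M := 'M[R]_(N, d).
Local Notation lebV := (@lebesgue_mx R 1 d).
Local Notation lebM := (@lebesgue_mx R N d).

Lemma eta_le (z : V) : eta eps z <= (2 * pi * eps) `^ (- (d%:R / 2)).
Proof.
rewrite /eta ler_piMr ?powR_ge0// -expR0 ler_expR mulNr oppr_le0 divr_ge0//.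
  by apply: sumr_ge0 => i _; exact: sqr_ge0.
by rewrite mulr_ge0// ltW.
Qed.

Lemma measurable_rowB (k : 'I_N) :
  measurable_fun setT (fun p : M * M => row k p.2 - row k p.1).
Proof.
apply: measurable_mxP => i l; rewrite (_ : (fun _ => _) = (fun p : M * M => p.2 k l - p.1 k l)).
  apply: measurable_funB.
    exact: (measurableT_comp (@measurable_entry R N d k l) measurable_snd).
  exact: (measurableT_comp (@measurable_entry R N d k l) measurable_fst).
by apply/funext => p; rewrite !mxE.
Qed.

Lemma measurable_subV : measurable_fun setT (fun p : V * V => p.2 - p.1).
Proof.
apply: measurable_mxP => i l; rewrite (_ : (fun _ => _) = (fun p : V * V => p.2 i l - p.1 i l)).
  apply: measurable_funB.
    exact: (measurableT_comp (@measurable_entry R 1 d i l) measurable_snd).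
  exact: (measurableT_comp (@measurable_entry R 1 d i l) measurable_fst).
by apply/funext => p; rewrite !mxE.
Qed.

(** The kernels are taken as functions of a pair (x, y), the form required by
    Tonelli's theorem. *)
Definition ker_eta (p : V * V) : R := eta eps (p.2 - p.1).

Lemma measurable_ker_eta : measurable_fun setT ker_eta.
Proof. by apply: measurable_eta => //; exact: measurable_subV. Qed.

Lemma ker_eta_ge0 p : 0 <= ker_eta p.
Proof. by rewrite ltW// eta_gt0. Qed.

Definition ker_etas (p : M * M) : R := \prod_k eta eps (row k p.2 - row k p.1).

Lemma measurable_ker_etas : measurable_fun setT ker_etas.
Proof.
by apply: measurable_bigprod => k; apply: measurable_eta => //; exact: measurable_rowB.
Qed.

Lemma ker_etas_ge0 p : 0 <= ker_etas p.
Proof. by apply: prodr_ge0 => k _; rewrite ltW// eta_gt0. Qed.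

Lemma Int_bounded d' (T : measurableType d') (P : probability T R) (h : T -> R) (B : R) :
  measurable_fun setT h -> (forall x, 0 <= h x) -> (forall x, h x <= B) -> Int P h.
Proof.
move=> mh h0 hB; apply: (@Int_le _ _ _ P (cst B)) => //.
  by apply/finite_measure_integrable_cst.
by apply: aeT => x; rewrite ger0_norm.
Qed.

Lemma conv_etaE k y : (\int[marginal mu k]_x (ker_eta (x, y))%:E = (conv_eta eps mu k y)%:E)%E.
Proof.
apply: RintE; apply: (@Int_bounded _ _ _ _ ((2 * pi * eps) `^ (- (d%:R / 2)))) => x.
- exact: (measurableT_comp measurable_ker_eta (pair2_measurable y)).
- exact: ker_eta_ge0.
- exact: eta_le.
Qed.

Lemma LambdaE Y : (\int[mu]_X (ker_etas (X, Y))%:E = (Lambda eps mu Y)%:E)%E.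
Proof.
apply: RintE; apply: (@Int_bounded _ _ _ _ (\prod_(k < N) (2 * pi * eps) `^ (- (d%:R / 2)))) => X.
- exact: (measurableT_comp measurable_ker_etas (pair2_measurable Y)).
- exact: ker_etas_ge0.
- by apply: ler_prod => k _; rewrite eta_le ltW// eta_gt0.
Qed.

Lemma measurable_conv_eta k : measurable_fun setT (conv_eta eps mu k).
Proof.
apply/measurable_EFinP.
have := @measurable_fun_fubini_tonelli_G _ _ _ _ R (marginal mu k) (EFin \o ker_eta).
rewrite (_ : fubini_G _ _ = EFin \o conv_eta eps mu k); last first.
  by apply/funext => y; exact: conv_etaE.
apply; first by apply/measurable_EFinP; exact: measurable_ker_eta.
by move=> p; rewrite lee_fin ker_eta_ge0.
Qed.

Lemma measurable_Lambda : measurable_fun setT (Lambda eps mu).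
Proof.
apply/measurable_EFinP.
have := @measurable_fun_fubini_tonelli_G _ _ _ _ R mu (EFin \o ker_etas).
rewrite (_ : fubini_G _ _ = EFin \o Lambda eps mu); last first.
  by apply/funext => Y; exact: LambdaE.
apply; first by apply/measurable_EFinP; exact: measurable_ker_etas.
by move=> p; rewrite lee_fin ker_etas_ge0.
Qed.

Lemma Lambda_ge0 Y : 0 <= Lambda eps mu Y.
Proof.
by rewrite -lee_fin -LambdaE; apply: integral_ge0 => X _; rewrite lee_fin ker_etas_ge0.
Qed.

Lemma conv_eta_gt0 k y : 0 < conv_eta eps mu k y.
Proof.
have c0 : 0 <= conv_eta eps mu k y.
  by rewrite -lee_fin -conv_etaE; apply: integral_ge0 => X _; rewrite lee_fin ker_eta_ge0.
rewrite lt_neqAle c0 andbT eq_sym; apply/eqP => cE.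
have : (\int[marginal mu k]_x `|(ker_eta (x, y))%:E| = 0)%E.
  under eq_integral do rewrite gee0_abs ?lee_fin ?ker_eta_ge0//.
  by rewrite conv_etaE cE.
have mk : measurable_fun setT (fun x => (ker_eta (x, y))%:E).
  by apply/measurable_EFinP; exact: (measurableT_comp measurable_ker_eta (pair2_measurable y)).
move=> /(ae_eq_integral_abs _ measurableT mk)[A [mA A0 sA]].
have AT : A = setT.
  rewrite -subTset => x _; apply: sA => /(_ Logic.I)[]/eqP.
  by rewrite gt_eqF// eta_gt0.
have : marginal mu k A = 1%E by rewrite AT; exact: probability_setT.
by rewrite A0 => /esym/eqP; rewrite onee_eq0.
Qed.

Variable f : 'I_N -> V -> R.
Hypothesis fd : forall k, is_density (marginal mu k) (f k).

Let mf k : measurable_fun setT (f k). Proof. by have [] := fd k. Qed.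
Let f0 k x : 0 <= f k x. Proof. by have [] := fd k. Qed.

Lemma integral_conv k y : (\int[lebV]_x (f k x * ker_eta (x, y))%:E = (conv_eta eps mu k y)%:E)%E.
Proof.
have [_ _ Pf] := fd k.
rewrite -conv_etaE (ge0_integral_density (mf k) (f0 k) Pf).
- by apply: eq_integral => x _; rewrite -EFinM mulrC.
- by apply/measurable_EFinP; exact: (measurableT_comp measurable_ker_eta (pair2_measurable y)).
- by move=> x; rewrite lee_fin ker_eta_ge0.
Qed.

Local Notation P := (Pdens eps mu f).

Lemma measurable_Pdens : measurable_fun setT (fun p : M * M => P p.1 p.2).
Proof.
apply: measurable_funM; last exact: (measurableT_comp measurable_Lambda measurable_snd).
apply: measurable_bigprod => k; apply: measurable_funM.
  apply: measurable_funM; first by apply: measurable_eta => //; exact: measurable_rowB.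
  apply: measurable_inv_ge0; last by move=> p; rewrite ltW// conv_eta_gt0.
  apply: (measurableT_comp (measurable_conv_eta k)).
  exact: (measurableT_comp (@measurable_row R N d k) measurable_snd).
apply: (measurableT_comp (mf k)).
exact: (measurableT_comp (@measurable_row R N d k) measurable_fst).
Qed.

Lemma Pdens_ge0 X Y : 0 <= P X Y.
Proof.
rewrite mulr_ge0 ?Lambda_ge0//; apply: prodr_ge0 => k _.
by rewrite mulr_ge0// divr_ge0// ltW ?eta_gt0 ?conv_eta_gt0.
Qed.

Section weighted.
Variables (j : 'I_N) (q : V * V -> R).
Hypotheses (mq : measurable_fun setT q) (q0 : forall p, 0 <= q p).

Let qker (p : V * V) : R := q p * (f j p.1 * ker_eta p).

Let mqker : measurable_fun setT qker.
Proof.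
apply: measurable_funM => //; apply: measurable_funM; last exact: measurable_ker_eta.
exact: (measurableT_comp (mf j) measurable_fst).
Qed.

Let qker0 p : 0 <= qker p.
Proof. by rewrite /qker mulr_ge0// mulr_ge0// ker_eta_ge0. Qed.

(** For k <> j the integral over x_k is conv_eta / conv_eta = 1. *)
Lemma Pdens_integral_fst (Y : M) :
  (\int[lebM]_X (q (row j X, row j Y) * P X Y)%:E =
   (Lambda eps mu Y)%:E * ((conv_eta eps mu j (row j Y))^-1%:E *
     \int[lebV]_x (qker (x, row j Y))%:E))%E.
Proof.
pose c k := (conv_eta eps mu k (row k Y))^-1.
have c0 k : 0 <= c k by rewrite invr_ge0 ltW// conv_eta_gt0.
pose g k x : R := (if k == j then q (x, row j Y) else 1) * (f k x * ker_eta (x, row k Y)).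
have g0 k x : 0 <= g k x.
  by rewrite /g mulr_ge0 ?(mulr_ge0 _ (ker_eta_ge0 _))//; case: (k == j).
have mg k : measurable_fun setT (g k).
  apply: measurable_funM.
    by case: (k == j) => //; exact: (measurableT_comp mq (pair2_measurable (row j Y))).
  apply: measurable_funM => //.
  exact: (measurableT_comp measurable_ker_eta (pair2_measurable (row k Y))).
pose h k x := (c k * g k x)%:E.
transitivity (\int[lebM]_X ((Lambda eps mu Y)%:E * \prod_k h k (row k X)))%E.
  apply: eq_integral => X _; rewrite /h prodEFin -EFinM; congr EFin.
  rewrite /Pdens mulrA [in RHS]mulrC; congr (_ * _).
  rewrite (bigD1 j)//= [RHS](bigD1 j)//= [LHS]mulrA /g eqxx /c /ker_eta /=; congr (_ * _); first by ring.
  by apply: eq_bigr => k /negbTE ->; ring.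
have mh k : measurable_fun setT (h k).
  by apply/measurable_EFinP; exact: measurable_funM.
have h0 k x : (0 <= h k x)%E by rewrite lee_fin mulr_ge0.
rewrite ge0_integralZl_EFin ?Lambda_ge0//; last 2 first.
- by move=> X _; apply: prode_ge0.
- apply: measurable_eprod => k; apply: (measurableT_comp (mh k)).
  exact: measurable_row.
congr (_ * _)%E; rewrite integral_mx_rows// (bigD1 j)//= big1 ?mule1.
  rewrite /h; under eq_integral do rewrite EFinM.
  rewrite ge0_integralZl_EFin//; last 2 first.
  - by move=> x _; rewrite lee_fin.
  - exact/measurable_EFinP.
  by congr (_ * _)%E; apply: eq_integral => x _; rewrite /g eqxx.
move=> k kj; rewrite /h; under eq_integral do rewrite EFinM.
rewrite ge0_integralZl_EFin//; last 2 first.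
- by move=> x _; rewrite lee_fin.
- exact/measurable_EFinP.
under eq_integral do rewrite /g (negbTE kj) mul1r.
by rewrite integral_conv -EFinM mulVf// gt_eqF// conv_eta_gt0.
Qed.

(** Lambda is an average over mu of products of Gaussian factors; those with k
    <> j integrate to 1, and what remains depends on mu through its j-th
    marginal only. *)
Lemma Lambda_integral (T : V -> \bar R) : measurable_fun setT T -> (forall y, 0 <= T y)%E ->
  (\int[lebM]_Y ((Lambda eps mu Y)%:E * T (row j Y)) =
   \int[lebV]_y ((conv_eta eps mu j y)%:E * T y))%E.
Proof.
move=> mT T0.
have mTrow : measurable_fun setT (fun Y : M => T (row j Y)).
  exact: (measurableT_comp mT (@measurable_row R N d j)).
pose F (p : M * M) := ((ker_etas p)%:E * T (row j p.2))%E.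
have mF : measurable_fun setT F.
  apply: emeasurable_funM; first by apply/measurable_EFinP; exact: measurable_ker_etas.
  exact: (measurableT_comp mTrow measurable_snd).
have F0 p : (0 <= F p)%E by rewrite mule_ge0// lee_fin ker_etas_ge0.
pose G (p : V * V) := ((ker_eta p)%:E * T p.2)%E.
have mG : measurable_fun setT G.
  apply: emeasurable_funM; first by apply/measurable_EFinP; exact: measurable_ker_eta.
  exact: (measurableT_comp mT measurable_snd).
have G0 p : (0 <= G p)%E by rewrite mule_ge0// lee_fin ker_eta_ge0.
transitivity (\int[lebM]_Y \int[mu]_X F (X, Y))%E.
  apply: eq_integral => Y _; rewrite -LambdaE -ge0_integralZr//.
  - apply/measurable_EFinP.
    exact: (measurableT_comp measurable_ker_etas (pair2_measurable Y)).
  - by move=> X _; rewrite lee_fin ker_etas_ge0.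
rewrite -(@fubini_tonelli _ _ _ _ R mu lebM F)//.
transitivity (\int[mu]_X \int[lebV]_y G (row j X, y))%E.
  apply: eq_integral => X _.
  pose h k y := ((ker_eta (row k X, y))%:E * (if k == j then T y else 1))%E.
  have mk k : measurable_fun setT (fun y => (ker_eta (row k X, y))%:E).
    apply/measurable_EFinP.
    exact: (measurableT_comp measurable_ker_eta (pair1_measurable (row k X))).
  transitivity (\int[lebM]_Y \prod_k h k (row k Y))%E.
    apply: eq_integral => Y _; rewrite /F /ker_etas/= (bigD1 j)//= [RHS](bigD1 j)//=.
    rewrite /h eqxx EFinM -!muleA; congr (_ * _)%E; rewrite muleC; congr (_ * _)%E.
    by rewrite -prodEFin; apply: eq_bigr => k /negbTE ->; rewrite mule1.
  rewrite integral_mx_rows.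
  - rewrite (bigD1 j)//= big1 ?mule1; first by apply: eq_integral => y _; rewrite /h eqxx.
    move=> k kj; rewrite /h (negbTE kj); under eq_integral do rewrite mule1.
    exact: integral_eta.
  - move=> k; apply: emeasurable_funM => //.
    by case: (k == j).
  - move=> k y; rewrite mule_ge0 ?lee_fin ?ker_eta_ge0//.
    by case: (k == j).
transitivity (\int[marginal mu j]_x \int[lebV]_y G (x, y))%E.
  rewrite [RHS](@ge0_integral_pushforward _ _ _ _ R)//; last first.
    by move=> x _; apply: integral_ge0 => y _; exact: G0.
  exact: (measurable_fun_fubini_tonelli_F).
transitivity (\int[lebV]_y \int[marginal mu j]_x G (x, y))%E.
  exact: (@fubini_tonelli _ _ _ _ R (marginal mu j) lebV G mG G0).
apply: eq_integral => y _; rewrite -conv_etaE -ge0_integralZr//.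
- apply/measurable_EFinP.
  exact: (measurableT_comp measurable_ker_eta (pair2_measurable y)).
- by move=> x _; rewrite lee_fin ker_eta_ge0.
Qed.

(** The denominator conv_eta left by the integration over X is the weight
    produced by the integration of Lambda over Y. *)
Theorem Pdens_integral :
  (\int[lebM]_Y \int[lebM]_X (q (row j X, row j Y) * P X Y)%:E =
   \int[lebV]_x ((f j x)%:E * \int[lebV]_y (q (x, y) * ker_eta (x, y))%:E))%E.
Proof.
pose S y := (\int[lebV]_x (qker (x, y))%:E)%E.
have mS : measurable_fun setT S.
  apply: (@measurable_fun_fubini_tonelli_G _ _ _ _ R lebV (EFin \o qker)).
    exact/measurable_EFinP.
  by move=> p; rewrite lee_fin.
have S0 y : (0 <= S y)%E by apply: integral_ge0 => x _; rewrite lee_fin.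
under eq_integral do rewrite Pdens_integral_fst.
rewrite (Lambda_integral (T := fun y => ((conv_eta eps mu j y)^-1%:E * S y)%E)); last 2 first.
- apply: emeasurable_funM => //; apply/measurable_EFinP; apply: measurable_inv_ge0.
    exact: measurable_conv_eta.
  by move=> y; rewrite ltW// conv_eta_gt0.
- by move=> y; rewrite mule_ge0// lee_fin invr_ge0 ltW// conv_eta_gt0.
transitivity (\int[lebV]_y S y)%E.
  apply: eq_integral => y _; rewrite muleA -EFinM divff ?mul1e// gt_eqF//.
  exact: conv_eta_gt0.
rewrite -(@fubini_tonelli _ _ _ _ R lebV lebV (EFin \o qker)); last 2 first.
- exact/measurable_EFinP.
- by move=> p; rewrite lee_fin.
apply: eq_integral => x _; rewrite -ge0_integralZl_EFin//.
- by apply: eq_integral => y _; rewrite -EFinM /qker /= mulrCA.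
- by move=> y _; rewrite lee_fin mulr_ge0// ker_eta_ge0.
- apply/measurable_EFinP; apply: measurable_funM.
    exact: (measurableT_comp mq (pair1_measurable x)).
  exact: (measurableT_comp measurable_ker_eta (pair1_measurable x)).
Qed.

End weighted.

End coupling.

(** * Weak derivative of a weighted product of densities *)

Section products.
Context (R : realType) (m n : nat).
Local Notation M := 'M[R]_(m, n).

Lemma is_CkS k (phi : M -> R) : is_Ck k.+1 phi -> is_Ck k phi.
Proof.
elim: k phi => [|k IH] phi; first by case.
move=> [cphi H]; split => // i j; have [dphi /IH] := H i j.
by split.
Qed.

Lemma is_CkD k (phi psi : M -> R) : is_Ck k phi -> is_Ck k psi ->
  is_Ck k (fun X => phi X + psi X).
Proof.
elim: k phi psi => [|k IH] phi psi [cphi Hphi] [cpsi Hpsi].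
  by split=> // X; exact: (cvgD (cphi X) (cpsi X)).
split; first by move=> X; exact: (cvgD (cphi X) (cpsi X)).
move=> i j; have [dphi kphi] := Hphi i j; have [dpsi kpsi] := Hpsi i j; split.
  by move=> X; exact: derivableD.
rewrite (_ : 'D_(delta_mx i j) _ =
    (fun X => 'D_(delta_mx i j) phi X + 'D_(delta_mx i j) psi X)); first exact: IH.
by apply/funext => X; exact: deriveD.
Qed.

Lemma derive_mulM (phi psi : M -> R) (X v : M) : derivable phi X v -> derivable psi X v ->
  'D_v (fun Z => phi Z * psi Z) X = phi X * 'D_v psi X + psi X * 'D_v phi X.
Proof. by move=> dphi dpsi; have := deriveM dphi dpsi. Qed.

Lemma is_CkM k (phi psi : M -> R) : is_Ck k phi -> is_Ck k psi ->
  is_Ck k (fun X => phi X * psi X).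
Proof.
elim: k phi psi => [|k IH] phi psi sphi spsi.
  have [cphi _] := sphi; have [cpsi _] := spsi.
  by split=> // X; exact: (cvgM (cphi X) (cpsi X)).
have [cphi Hphi] := sphi; have [cpsi Hpsi] := spsi.
split; first by move=> X; exact: (cvgM (cphi X) (cpsi X)).
move=> i j; have [dphi kphi] := Hphi i j; have [dpsi kpsi] := Hpsi i j; split.
  by move=> X; exact: derivableM.
rewrite (_ : 'D_(delta_mx i j) _ =
    (fun X => phi X * 'D_(delta_mx i j) psi X + psi X * 'D_(delta_mx i j) phi X)).
  by apply: is_CkD; apply: IH => //; exact: is_CkS.
by apply/funext => X; exact: derive_mulM.
Qed.

Lemma test_functionM (phi psi : M -> R) : test_function phi -> (forall k, is_Ck k psi) ->
  test_function (fun X => phi X * psi X).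
Proof.
move=> [sphi cphi] spsi; split => [k|]; first exact: is_CkM.
apply: subclosed_compact cphi _; first exact: closed_closure.
by apply: closure_subset => X /=; rewrite mulf_eq0 negb_or => /andP[].
Qed.

End products.

Section rows_product.
Context (R : realType) (N d : nat).
Let TR : measurableType _ := measurableTypeR R.
Local Notation V := 'rV[R]_d.
Local Notation M := 'M[R]_(N, d).
Local Notation lebV := (@lebesgue_mx R 1 d).
Local Notation lebM := (@lebesgue_mx R N d).

Lemma Int_prod_rows (h : 'I_N -> V -> R) : (forall k, Int lebV (h k)) ->
  Int lebM (fun X => \prod_k h k (row k X)).
Proof.
move=> ih; have mh k : measurable_fun setT (h k) := Int_meas (ih k).
apply/integrableP; split.
  apply/measurable_EFinP; apply: measurable_bigprod => k.
  exact: (measurableT_comp (mh k) (@measurable_row R N d k)).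
pose g k x := (`|h k x|)%:E.
suff : (\int[lebM]_X \prod_k g k (row k X) < +oo)%E.
  congr (_ < _)%E; apply: eq_integral => X _.
  by rewrite /g prodEFin -normr_prod.
rewrite integral_mx_rows.
- under eq_bigr do rewrite (RintE (Int_norm (ih _))).
  by rewrite prodEFin ltry.
- by move=> k; apply/measurable_EFinP; exact: measurableT_comp.
- by move=> k x; rewrite lee_fin.
Qed.

Lemma row_upd (j : 'I_N) (i : 'I_d) (X : M) t : row j (upd j i X t) = upd 0 i (row j X) t.
Proof. by apply/rowP => l; rewrite !mxE eqxx. Qed.

Lemma row_upd_neq (j k : 'I_N) (i : 'I_d) (X : M) t : k != j -> row k (upd j i X t) = row k X.
Proof. by move=> /negbTE kj; apply/rowP => l; rewrite !mxE kj. Qed.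

Lemma ae_lcube_row (K : R) (j : 'I_N) (P : V -> Prop) :
  {ae lcube 1 d K, forall x, P x} -> {ae lcube N d K, forall X, P (row j X)}.
Proof.
move=> /ae_mfrestr aeP; apply/ae_mfrestr.
apply: aeS (ae_row j aeP) => X PX QX; apply: PX => k l; rewrite mxE; exact: QX.
Qed.

(** The derivative of a product of densities is again a product over rows. *)
Lemma Int_prod_rows_subst (j : 'I_N) (f : 'I_N -> V -> R) (g : V -> R) :
  (forall k, Int lebV (f k)) -> Int lebV g ->
  Int lebM (fun X => g (row j X) * \prod_(k | k != j) f k (row k X)).
Proof.
move=> fi gi; pose h k := if k == j then g else f k.
have ih k : Int lebV (h k) by rewrite /h; case: (k == j).
have -> : (fun X => g (row j X) * \prod_(k | k != j) f k (row k X)) =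
    (fun X => \prod_k h k (row k X)); last exact: Int_prod_rows.
apply/funext => X; rewrite [RHS](bigD1 j)//= /h eqxx; congr (_ * _).
by apply: eq_bigr => k /negbTE ->.
Qed.

(** Along a line parallel to the (j, i)-axis only the factor of row j varies. *)
Lemma weak_partial_prod_rows (j : 'I_N) (i : 'I_d) (f : 'I_N -> V -> R) (g : V -> R) :
  (forall k, Int lebV (f k)) -> Int lebV g -> is_weak_partial 0 i (f j) g ->
  is_weak_partial j i (fun X => \prod_k f k (row k X))
    (fun X => g (row j X) * \prod_(k | k != j) f k (row k X)).
Proof.
move=> fi gi wfg.
have iF := Int_prod_rows fi; have iG := Int_prod_rows_subst j fi gi.
apply: ac_on_lines_weak; [exact: Int_loc_integrable|exact: Int_loc_integrable|].
move=> K K0; have ac := ae_lcube_row j (weak_ac_on_lines wfg K0).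
have KR : 0 <= K%:R :> R by [].
have [_ lg _] := wfg.
have [gg _ _] := Rslice 0 i KR (((loc_integrableP g).1 lg).2 K).
apply: aeS2 ac (ae_lcube_row j gg) => X [c uE] igX.
pose B := \prod_(k | k != j) f k (row k X).
have BE t : \prod_(k | k != j) f k (row k (upd j i X t)) = B.
  by apply: eq_bigr => k kj; rewrite row_upd_neq.
exists (c * B); apply: aeS uE => t uE.
rewrite (bigD1 j)//= BE row_upd uE mulrDl; congr (_ + _).
rewrite /prim -RintegralZr//; last first.
  apply: (@IntM_bnd _ TR R (lseg K%:R) 1 (fun s => g (upd 0 i (row j X) s)) _ igX).
    exact: measurable_step.
  by apply: aeT => s; exact: step_le1.
by apply: eq_Rintegral => s _; rewrite BE row_upd; ring.
Qed.

End rows_product.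

Section gaussian_weight.
Context (R : realType) (N d : nat) (eps : R).
Hypothesis eps0 : 0 < eps.
Local Notation M := 'M[R]_(N, d).

Lemma ker_etasE (Y X : M) :
  ker_etas eps (X, Y) = tprod (fun k l t => gauss eps (Y k l - t)) X.
Proof.
rewrite /ker_etas /tprod -(pair_bigA _ (fun k l => gauss eps (Y k l - X k l)))/=.
by apply: eq_bigr => k _; rewrite etaE; apply: eq_bigr => l _; rewrite !mxE.
Qed.

Let b (Y : M) k l (t : R) := gauss eps (Y k l - t).

Let sb Y k l : smooth1 (b Y k l).
Proof.
move=> r; have := Ck1_affine (-1) (Y k l) (smooth1_gauss (lt0r_neq0 eps0) r).
by congr Ck1; apply/funext => t; rewrite /b mulN1r addrC.
Qed.

Lemma is_Ck_ker_etas k (Y : M) : is_Ck k (fun X => ker_etas eps (X, Y)).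
Proof.
rewrite (_ : (fun X => _) = tprod (b Y)); last by apply/funext => X; exact: ker_etasE.
by apply: is_Ck_tprod => i j; exact: sb.
Qed.

Lemma derive_ker_etas (Y X : M) j i : 'D_(delta_mx j i) (fun X => ker_etas eps (X, Y)) X =
  (Y j i - X j i) / eps * ker_etas eps (X, Y).
Proof.
rewrite (_ : (fun X => _) = tprod (b Y)); last by apply/funext => Z; exact: ker_etasE.
have [_ ->] := is_derive_tprod j i X (sb Y).
have E := tprod_upd (b Y) j i X (X j i); rewrite upd_id in E.
rewrite ker_etasE [X in _ = _ * X]E tprod_subst mulrA derive1E; congr (_ * _).
have D : is_derive (X j i) 1 (b Y j i) ((Y j i - X j i) / eps * b Y j i (X j i)).
  have H : is_derive (X j i - Y j i) 1 (gauss eps) (- ((X j i - Y j i) / eps) * gauss eps (X j i - Y j i)).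
    by apply: is_derive_gauss; rewrite gt_eqF.
  have H2 : is_derive (X j i) 1 (fun t : R => t - Y j i) 1.
    have := is_deriveB (is_derive_id (X j i) 1) (is_derive_cst (Y j i) (X j i) 1).
    by rewrite subr0.
  have := is_derive1_comp (f := gauss eps) (g := fun t => t - Y j i) H H2.
  rewrite mulr1 -mulNr opprB /b -gaussN opprB.
  congr is_derive; apply/funext => t; by rewrite /= -gaussN opprB.
by have [_ ->] := D.
Qed.

End gaussian_weight.

(** * Densities whose root is a Sobolev function *)

Section sobolev_density.
Context (R : realType) (m n : nat).
Local Notation M := 'M[R]_(m, n).
Local Notation leb := (@lebesgue_mx R m n).

Lemma Lfun_Int (p : R) (u : M -> R) : 1 <= p ->
  u \in Lfun leb p%:E <-> measurable_fun setT u /\ Int leb (fun X => `|u X| `^ p).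
Proof.
move=> p1; split.
  move=> uL; split; last exact: Lfun_integrable.
  by have /andP[] := uL; rewrite inE.
move=> [mu iu]; apply/andP; split; first by rewrite inE.
rewrite inE /finite_norm unlock /Lnorm.
rewrite /= poweR_lty//.
have /integrableP[_] := iu; apply: le_lt_trans.
rewrite le_eqVlt; apply/orP; left; apply/eqP/eq_integral => X _.
by rewrite gee0_abs ?lee_fin ?powR_ge0.
Qed.

Lemma Int_density (P : probability M R) (f : M -> R) : is_density P f -> Int leb f.
Proof.
move=> [mf f0 Pf]; apply: ge0_Int => //.
by rewrite -Pf// probability_setT ltry.
Qed.

Lemma density_unique (P : probability M R) (f f' : M -> R) :
  is_density P f -> is_density P f' -> {ae leb, forall X, f X = f' X}.
Proof.
move=> df df'; have [mf f0 Pf] := df; have [mf' f'0 Pf'] := df'.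
have : ae_eq leb setT (EFin \o f) (EFin \o f').
  apply: integral_ae_eq => //.
  - exact: Int_density df.
  - exact/measurable_EFinP.
  - by move=> E _ mE; rewrite -[LHS]Pf// -[RHS]Pf'.
by apply: aeS => X /(_ Logic.I)[].
Qed.

(** The larger of w and y dominates both factors; w^(p-2) w is w^(p-1), with the
    value 0 at w = 0. *)
Lemma powR_mul_le (p w y : R) : 1 <= p -> 0 <= w -> 0 <= y ->
  w `^ (p - 2) * w * y <= w `^ p + y `^ p.
Proof.
move=> p1 w0 y0; have [->|wn0] := eqVneq w 0.
  by rewrite mulr0 mul0r addr_ge0// powR_ge0.
have wp : w `^ (p - 2) * w = w `^ (p - 1).
  rewrite -[X in _ * X]powRr1// -powRD; first by congr (_ `^ _); ring.
  by rewrite wn0 implybT.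
have E x : 0 <= x -> x `^ (p - 1) * x = x `^ p.
  move=> x0; rewrite -{2}(powRr1 x0) -powRD; first by congr (_ `^ _); ring.
  by rewrite subrK; apply/implyP => /eqP p0; move: p1; rewrite p0 ler10.
rewrite wp; have /orP[wy|yw] := le_total w y.
  apply: (@le_trans _ _ (y `^ p)); last by rewrite lerDr powR_ge0.
  by rewrite -(E y)// ler_wpM2r// ge0_ler_powR ?nnegrE// subr_ge0.
apply: (@le_trans _ _ (w `^ p)); last by rewrite lerDl powR_ge0.
by rewrite -(E w)// ler_wpM2l// powR_ge0.
Qed.

(** Let w be the p-th root of f and W its weak gradient. The power rule gives
    the weak gradient p w^(p-1) W of f, and g agrees with it almost
    everywhere. It vanishes where w does, and elsewhere f |g / f|^p = p^p
    |W|^p. *)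
Theorem density_weak_grad (p : R) (P : probability M R) (f : M -> R) :
  1 <= p -> P1p p P -> is_density P f ->
  (exists g, is_weak_grad f g) /\
  forall g, is_weak_grad f g -> forall i j,
    {ae leb, forall X, f X = 0 -> g X i j = 0} /\
    Int leb (fun X => f X * `|g X i j / f X| `^ p).
Proof.
move=> p1 [_ [f' df' [_ [W wW WL]]]] df; have [mf f0 _] := df; have [mf' _ _] := df'.
have p0 : 0 < p by rewrite (lt_le_trans _ p1).
have pn0 : p != 0 by rewrite gt_eqF.
pose w X := f X `^ p^-1.
have mw : measurable_fun setT w by exact: (measurableT_comp (measurable_powR _) mf).
have w0 X : 0 <= w X by exact: powR_ge0.
have wpE X : w X `^ p = f X by rewrite /w -powRrM mulVf// powRr1.
have iW i j : measurable_fun setT (fun X => W X i j) /\ Int leb (fun X => `|W X i j| `^ p).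
  exact/(Lfun_Int _ p1).
have fE := density_unique df' df.
have wpw i j : is_weak_partial i j w (fun X => W X i j).
  apply: (weak_partial_ae (wW i j)) => //; first by case: (iW i j).
    by apply: aeS fE => X; rewrite /w => ->.
  exact: aeT.
pose g0 i j X := p * (w X `^ (p - 2) * w X) * W X i j.
have if_ := Int_density df.
have mg0 i j : measurable_fun setT (g0 i j).
  apply: measurable_funM; last by case: (iW i j).
  apply: measurable_funM => //; apply: measurable_funM => //.
  exact: (measurableT_comp (measurable_powR _) mw).
have ig0 i j : Int leb (g0 i j).
  have [_ iWp] := iW i j.
  apply: (Int_le (IntZ p (IntD if_ iWp))) => //.
  apply: aeT => X; rewrite /g0 !normrM (ger0_norm (ltW p0)) -!mulrA ler_wpM2l ?(ltW p0)//.
  rewrite (ger0_norm (powR_ge0 _ _)) (ger0_norm (w0 X)) mulrA -wpE.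
  exact: powR_mul_le.
have wg0 i j : is_weak_partial i j f (g0 i j).
  have -> : f = (fun X => w X `^ p) by apply/funext => X; rewrite wpE.
  apply: weak_partial_power => //; last exact: (Int_loc_integrable (ig0 i j)).
  by under eq_fun do rewrite wpE; exact: Int_loc_integrable.
split.
  exists (fun X => \matrix_(i, j) g0 i j X) => i j.
  by under [X in is_weak_partial _ _ _ X]eq_fun do rewrite mxE.
move=> g wg i j; have gE := weak_partial_unique (wg i j) (wg0 i j).
have [_ [mg _] _] := wg i j.
split.
  apply: aeS gE => X -> fX; rewrite /g0 /w fX powR0 ?mulr0 ?mul0r//.
  by rewrite invr_eq0.
have [_ iWp] := iW i j.
apply: (Int_le (IntZ (p `^ p) iWp)).
  apply: measurable_funM => //; apply: (measurableT_comp (measurable_powR _)).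
  apply: measurableT_comp => //; apply: measurable_funM => //.
  exact: measurable_inv_ge0.
apply: aeS gE => X ->; rewrite ger0_norm ?mulr_ge0 ?powR_ge0//.
have [fX|fX] := eqVneq (f X) 0; first by rewrite fX mul0r mulr_ge0 ?powR_ge0.
have wX : 0 < w X by rewrite lt_neqAle w0 andbT eq_sym /w powR_eq0 negb_and fX.
have -> : g0 i j X / f X = p * W X i j / w X.
  rewrite -wpE.
  have -> : w X `^ p = w X `^ (p - 2) * w X * w X.
    rewrite -mulrA -expr2 -powR_mulrn// -powRD; first by congr (_ `^ _); ring.
    by rewrite (gt_eqF wX) implybT.
  have wpX : w X `^ (p - 2) != 0 by rewrite gt_eqF// powR_gt0.
  by rewrite /g0; field; rewrite wpX gt_eqF.
rewrite normrM normrM normfV (ger0_norm (ltW p0)) (ger0_norm (w0 X)).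
rewrite powRM ?mulr_ge0 ?invr_ge0 ?(ltW p0)// powRM ?(ltW p0)//.
have wV : w X `^ p * (w X)^-1 `^ p = 1.
  by rewrite -powRM ?invr_ge0// divff ?gt_eqF// powR1.
by rewrite -[X in X * _]wpE mulrCA wV mulr1.
Qed.

End sobolev_density.

(** * Powers and weighted averages *)

Section powers.
Context (R : realType).

(** Young's inequality t * 1 <= t^p / p + 1 / q for conjugate exponents p, q. *)
Lemma powR_tangent (p t : R) : 1 <= p -> 0 <= t -> p * t - (p - 1) <= t `^ p.
Proof.
move=> p1 t0; have [->|pn1] := eqVneq p 1; first by rewrite powRr1//; lra.
have p0 : 0 < p by lra.
have p10 : 0 < p - 1 by rewrite subr_gt0 lt_neqAle eq_sym pn1.
have pq : p^-1 + (p / (p - 1))^-1 = 1 by field; rewrite !gt_eqF.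
have := @conjugate_powR R t 1 p (p / (p - 1)) t0 ler01 p0 (divr_gt0 p0 p10) pq.
rewrite mulr1 powR1 => H.
have : p * t <= p * (t `^ p / p + 1 / (p / (p - 1))) by rewrite ler_wpM2l// ltW.
have -> : p * (t `^ p / p + 1 / (p / (p - 1))) = t `^ p + (p - 1) by field; rewrite !gt_eqF.
lra.
Qed.

Lemma powR_normD_le (p a b : R) : 0 <= p ->
  `|a + b| `^ p <= 2 `^ p * (`|a| `^ p + `|b| `^ p).
Proof.
move=> p0.
have key x y : 0 <= x -> x <= y -> (x + y) `^ p <= 2 `^ p * (x `^ p + y `^ p).
  move=> x0 xy; have y0 : 0 <= y := le_trans x0 xy.
  apply: (@le_trans _ _ ((2 * y) `^ p)).
    by rewrite ge0_ler_powR ?nnegrE ?addr_ge0 ?mulr_ge0//; lra.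
  by rewrite powRM// ler_wpM2l ?powR_ge0// lerDr powR_ge0.
apply: (@le_trans _ _ ((`|a| + `|b|) `^ p)).
  by rewrite ge0_ler_powR ?nnegrE ?addr_ge0// ler_normD.
have /orP[ab|ba] := le_total `|a| `|b|; first exact: key.
by rewrite addrC [X in _ * X]addrC; exact: key.
Qed.

Lemma norm_le_powR (p t : R) : 1 <= p -> `|t| <= 1 + `|t| `^ p.
Proof.
move=> p1; have /orP[t1|t1] := le_total `|t| 1.
  by apply: (le_trans t1); rewrite lerDl powR_ge0.
have : `|t| `^ 1 <= `|t| `^ p by rewrite ler_powR.
rewrite powRr1//; lra.
Qed.

(** Jensen's inequality for the probability density w / (int w): the graph of
    t |-> t^p lies above its tangent at the mean. *)
Lemma jensen_weighted d (T : measurableType d) (m : {measure set T -> \bar R})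
    (p : R) (w q : T -> R) : 1 <= p -> (forall x, 0 <= w x) ->
  Int m w -> Int m (fun x => q x * w x) -> Int m (fun x => `|q x| `^ p * w x) ->
  (\int[m]_x w x) * `|(\int[m]_x (q x * w x)) / (\int[m]_x w x)| `^ p <= \int[m]_x (`|q x| `^ p * w x).
Proof.
move=> p1 w0 iw iqw iqpw; set theta := \int[m]_x w x; set D := \int[m]_x (q x * w x).
have p0 : 0 < p by lra.
have I0 : 0 <= \int[m]_x (`|q x| `^ p * w x).
  by apply: Rintegral_ge0 => x _; rewrite mulr_ge0// powR_ge0.
have theta0 : 0 <= theta by apply: Rintegral_ge0 => x _.
have [->|thetan0] := eqVneq theta 0; first by rewrite mul0r.
have theta_gt0 : 0 < theta by rewrite lt_neqAle eq_sym thetan0.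
set a := `|D / theta|.
have [a0|an0] := eqVneq a 0; first by rewrite a0 powR0 ?gt_eqF// mulr0.
have a0 : 0 < a by rewrite lt_neqAle eq_sym an0 normr_ge0.
have iqw' : Int m (fun x => `|q x| * w x).
  apply: Int_ae (Int_norm iqw) _ _; last by apply: aeT => x; rewrite normrM (ger0_norm (w0 x)).
  rewrite (_ : (fun x => _) = (fun x => `|q x * w x|)).
    exact: Int_meas (Int_norm iqw).
  by apply/funext => x; rewrite normrM (ger0_norm (w0 x)).
have Dle : `|D| <= \int[m]_x (`|q x| * w x).
  apply: le_trans (le_normr_Rintegral _ _) _ => //.
  rewrite le_eqVlt; apply/orP; left; apply/eqP/eq_Rintegral => x _.
  by rewrite normrM (ger0_norm (w0 x)).
have low : a `^ p * (p / a * \int[m]_x (`|q x| * w x) - (p - 1) * theta) <=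
    \int[m]_x (`|q x| `^ p * w x).
  rewrite /theta -!RintegralZl//.
  rewrite -RintegralB//; last 2 first.
  - exact: IntZ.
  - exact: IntZ.
  rewrite -RintegralZl//; last by apply: IntB; exact: IntZ.
  apply: le_Rintegral => //; first by apply: IntZ; apply: IntB; exact: IntZ.
  move=> x _.
  have t0 : 0 <= `|q x| / a by rewrite divr_ge0// ltW.
  have -> : a `^ p * (p / a * (`|q x| * w x) - (p - 1) * w x) =
    a `^ p * (p * (`|q x| / a) - (p - 1)) * w x by ring.
  rewrite ler_wpM2r//; apply: (@le_trans _ _ (a `^ p * (`|q x| / a) `^ p)).
    by rewrite ler_wpM2l ?powR_ge0// powR_tangent.
  by rewrite -powRM ?(ltW a0)// mulrC divfK.
apply: le_trans low; rewrite mulrC ler_wpM2l ?powR_ge0//.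
have aD : p / a * `|D| = p * theta.
  rewrite /a normrM normfV (ger0_norm theta0); field; rewrite thetan0 /=.
  by apply/eqP => D0; move: an0; rewrite /a; move/eqP: D0; rewrite normr_eq0 => /eqP ->; rewrite mul0r normr0 eqxx.
have : p / a * `|D| <= p / a * \int[m]_x (`|q x| * w x).
  by rewrite ler_wpM2l// divr_ge0// ltW.
rewrite aD; lra.
Qed.

End powers.

Section local_integrability.
Context (R : realType) (m n : nat).
Local Notation M := 'M[R]_(m, n).
Local Notation leb := (@lebesgue_mx R m n).

Lemma loc_integrable_powR (p : R) (u : M -> R) : 1 <= p -> measurable_fun setT u ->
  Int leb (fun X => `|u X| `^ p) -> loc_integrable u.
Proof.
move=> p1 mu iu; apply/loc_integrableP; split => // K.
have ip : Int (lcube m n K%:R) (fun X => `|u X| `^ p).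
  by have [_] := (loc_integrableP _).1 (Int_loc_integrable iu); exact.
have i1 : Int (lcube m n K%:R) (fun=> 1 : R).
  exact: (finite_measure_integrable_cst (lcube m n K%:R) 1 measurableT).
apply: (Int_le (IntD i1 ip)) => //; apply: aeT => X; exact: norm_le_powR.
Qed.

Lemma continuous_support_bounded (K : nat) (psi : M -> R) : continuous psi ->
  (forall X, ~ cube K%:R X -> psi X = 0) -> exists B : R, forall X, `|psi X| <= B.
Proof.
move=> cpsi psi0; have [B hB] := continuous_bounded_cube K%:R cpsi.
exists (Num.max B 0) => X; have [QX|nQX] := pselect (cube K%:R X).
  by rewrite le_max hB.
by rewrite psi0// normr0 le_max lexx orbT.
Qed.

Lemma IntM_support (K : nat) (F psi : M -> R) : Int leb F -> continuous psi ->
  (forall X, ~ cube K%:R X -> psi X = 0) -> Int leb (fun X => F X * psi X).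
Proof.
move=> iF cpsi /(continuous_support_bounded cpsi)[B hB].
apply: (IntM_bnd (B := B)) => //; first exact: measurable_continuous_mx.
exact: aeT.
Qed.

End local_integrability.

(** * The smoothed coupling *)

Section theta.
Context (R : realType) (d N : nat) (p eps : R) (mu : probability 'M[R]_(N, d) R).
Variable f : 'I_N -> 'rV[R]_d -> R.
Hypotheses (p1 : 1 <= p) (eps0 : 0 < eps).
Hypothesis fd : forall k, is_density (marginal mu k) (f k).
Local Notation V := 'rV[R]_d.
Local Notation M := 'M[R]_(N, d).
Local Notation lebV := (@lebesgue_mx R 1 d).
Local Notation lebM := (@lebesgue_mx R N d).
Local Notation leb2 := (@lebesgue_mx R N d \x @lebesgue_mx R N d)%E.
Local Notation P := (Pdens eps mu f).
Local Notation Theta := (Theta eps mu f).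

Let p0 : 0 <= p. Proof. by rewrite (le_trans _ p1). Qed.
Let mf k : measurable_fun setT (f k). Proof. by have [] := fd k. Qed.
Let f0 k x : 0 <= f k x. Proof. by have [] := fd k. Qed.
Let P0 X Y : 0 <= P X Y. Proof. exact: Pdens_ge0. Qed.
Let mP : measurable_fun setT (fun z : M * M => P z.1 z.2).
Proof. exact: measurable_Pdens. Qed.

Lemma integral_f k : (\int[lebV]_x (f k x)%:E = 1)%E.
Proof. by have [_ _ <-] := fd k => //; exact: probability_setT. Qed.

Section weighted_integrability.
Variables (j : 'I_N) (q : V * V -> R).
Hypotheses (mq : measurable_fun setT q) (q0 : forall x, 0 <= q x).

Let qP (z : M * M) := q (row j z.1, row j z.2) * P z.1 z.2.

Lemma measurable_qrow : measurable_fun setT (fun z : M * M => q (row j z.1, row j z.2)).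
Proof.
apply: (measurableT_comp mq); apply: measurable_fun_pair.
- exact: (measurableT_comp (@measurable_row R N d j) measurable_fst).
- exact: (measurableT_comp (@measurable_row R N d j) measurable_snd).
Qed.

Lemma integral_weighted : (\int[leb2]_z (qP z)%:E =
  \int[lebV]_x ((f j x)%:E * \int[lebV]_y (q (x, y) * ker_eta eps (x, y))%:E))%E.
Proof.
rewrite (@fubini_tonelli2 _ _ _ _ R lebM lebM (EFin \o qP)).
- have H := @Pdens_integral R d N eps mu eps0 f fd j q mq q0.
  by rewrite -H.
- by apply/measurable_EFinP; apply: measurable_funM => //; exact: measurable_qrow.
- by move=> z; rewrite lee_fin mulr_ge0.
Qed.

Lemma Int_weighted (C : \bar R) : (C < +oo)%E ->
  (\int[lebV]_x ((f j x)%:E * \int[lebV]_y (q (x, y) * ker_eta eps (x, y))%:E) <= C)%E ->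
  Int leb2 qP.
Proof.
move=> Coo HC; apply: ge0_Int.
- by apply: measurable_funM => //; exact: measurable_qrow.
- by move=> z; rewrite mulr_ge0.
- by rewrite integral_weighted (le_lt_trans HC).
Qed.

End weighted_integrability.

Lemma integral_ker_eta x : (\int[lebV]_y (ker_eta eps (x, y))%:E = 1)%E.
Proof. exact: integral_eta. Qed.

Lemma integral_Pdens (j : 'I_N) : (\int[leb2]_z (P z.1 z.2)%:E = 1)%E.
Proof.
have := @integral_weighted j (cst 1) (measurable_cst _) (fun=> ler01).
under eq_integral do rewrite mul1r.
move=> ->; rewrite -(integral_f j); apply: eq_integral => x _.
by under eq_integral do rewrite mul1r; rewrite integral_ker_eta mule1.
Qed.

Lemma Int_Pdens (j : 'I_N) : Int leb2 (fun z => P z.1 z.2).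
Proof.
by apply: ge0_Int => //; rewrite (integral_Pdens j) ltry.
Qed.

Section gradient.
Variables (j : 'I_N) (i : 'I_d) (g : V -> V).
Hypothesis wg : is_weak_partial 0 i (f j) (fun x => g x 0 i).
Hypothesis g0 : {ae lebV, forall x, f j x = 0 -> g x 0 i = 0}.
Hypothesis ig : Int lebV (fun x => f j x * `|g x 0 i / f j x| `^ p).

Let mg : measurable_fun setT (fun x => g x 0 i). Proof. by case: wg => _ []. Qed.

(** The logarithmic derivatives of the two factors of P that depend on x_j. *)
Definition score_f (x : V) := g x 0 i / f j x.
Definition score_eta (z : M * M) := (z.2 j i - z.1 j i) / eps.
Definition score (z : M * M) := score_f (row j z.1) + score_eta z.

Let msf : measurable_fun setT score_f.
Proof. by apply: measurable_funM => //; exact: measurable_inv_ge0. Qed.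

Let mse : measurable_fun setT score_eta.
Proof.
apply: measurable_funM => //; apply: measurable_funB.
- exact: (measurableT_comp (@measurable_entry R N d j i) measurable_snd).
- exact: (measurableT_comp (@measurable_entry R N d j i) measurable_fst).
Qed.

Let mrow1 : measurable_fun setT (fun z : M * M => score_f (row j z.1)).
Proof.
apply: (measurableT_comp msf).
exact: (measurableT_comp (@measurable_row R N d j) measurable_fst).
Qed.

Let ms : measurable_fun setT score. Proof. exact: measurable_funD. Qed.

Lemma Int_score_f : Int leb2 (fun z => `|score_f (row j z.1)| `^ p * P z.1 z.2).
Proof.
apply: (@Int_weighted j (fun x => `|score_f x.1| `^ p) _ _
  (\int[lebV]_x (f j x * `|score_f x| `^ p)%:E)).
- apply: (measurableT_comp (measurable_powR _)); apply: measurableT_comp => //.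
  exact: (measurableT_comp msf measurable_fst).
- by move=> x; exact: powR_ge0.
- by rewrite RintE// ltry.
rewrite le_eqVlt; apply/orP; left; apply/eqP/eq_integral => x _.
rewrite EFinM; congr (_ * _)%E; under eq_integral do rewrite EFinM /=.
rewrite ge0_integralZl_EFin ?powR_ge0//.
- by rewrite integral_ker_eta mule1.
- by move=> y _; rewrite lee_fin ker_eta_ge0.
- apply/measurable_EFinP.
  exact: (measurableT_comp (measurable_ker_eta eps0) (pair1_measurable x)).
Qed.

Lemma Int_score_eta : Int leb2 (fun z => `|score_eta z| `^ p * P z.1 z.2).
Proof.
have [C HC] := @eta_moment R d eps eps0 p p0.
pose q (x : V * V) := `|(x.2 - x.1) 0 i / eps| `^ p.
have mq : measurable_fun setT q.
  apply: (measurableT_comp (measurable_powR _)); apply: measurableT_comp => //.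
  apply: measurable_funM => //.
  exact: (measurableT_comp (@measurable_entry R 1 d 0 i) (@measurable_subV R d)).
have -> : (fun z => `|score_eta z| `^ p * P z.1 z.2) =
    (fun z : M * M => q (row j z.1, row j z.2) * P z.1 z.2).
  by apply/funext => z; rewrite /q /score_eta !mxE.
pose D := eps^-1 `^ p * C.
have HD x : (\int[lebV]_y (q (x, y) * ker_eta eps (x, y))%:E <= D%:E)%E.
  have mh : measurable_fun setT (fun y : V => `|(y - x) 0 i| `^ p * eta eps (y - x)).
    have msub : measurable_fun setT (fun y : V => y - x).
      exact: (measurableT_comp (@measurable_subV R d) (pair1_measurable x)).
    apply: measurable_funM; last exact: measurable_eta.
    apply: (measurableT_comp (measurable_powR _)); apply: measurableT_comp => //.
    exact: (measurableT_comp (@measurable_entry R 1 d 0 i) msub).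
  rewrite (_ : (\int[lebV]_y _ = \int[lebV]_y ((eps^-1 `^ p)%:E *
      (`|(y - x) 0 i| `^ p * eta eps (y - x))%:E))%E); last first.
    apply: eq_integral => y _; rewrite -EFinM; congr EFin.
    rewrite /q /ker_eta/= normrM normfV (gtr0_norm eps0) powRM ?invr_ge0 ?(ltW eps0)//.
    by ring.
  rewrite ge0_integralZl_EFin ?powR_ge0//.
  - by rewrite /D EFinM lee_wpmul2l ?lee_fin ?powR_ge0.
  - by move=> y _; rewrite lee_fin mulr_ge0 ?powR_ge0// ltW// eta_gt0.
  - exact/measurable_EFinP.
apply: (@Int_weighted j q mq _ D%:E); first by move=> x; exact: powR_ge0.
  by rewrite ltry.
apply: (@le_trans _ _ (\int[lebV]_x ((f j x)%:E * D%:E))%E); last first.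
  rewrite ge0_integralZr//.
  - by rewrite integral_f mul1e.
  - exact/measurable_EFinP.
  - by move=> x _; rewrite lee_fin.
  - by apply: le_trans (HD 0); apply: integral_ge0 => y _; rewrite lee_fin mulr_ge0 ?powR_ge0 ?ker_eta_ge0.
apply: ge0_le_integral => //.
- move=> x _; rewrite mule_ge0 ?lee_fin//; apply: integral_ge0 => y _.
  by rewrite lee_fin mulr_ge0 ?powR_ge0 ?ker_eta_ge0.
- apply: emeasurable_funM; first exact/measurable_EFinP.
  apply: (@measurable_fun_fubini_tonelli_F _ _ _ _ R lebV (EFin \o (fun x => q x * ker_eta eps x))).
    by apply/measurable_EFinP; apply: measurable_funM => //; exact: measurable_ker_eta.
  by move=> x; rewrite lee_fin mulr_ge0 ?powR_ge0 ?ker_eta_ge0.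
- by apply: emeasurable_funM => //; exact/measurable_EFinP.
- by move=> x _; rewrite lee_wpmul2l// lee_fin.
Qed.

Lemma Int_score_powR : Int leb2 (fun z => `|score z| `^ p * P z.1 z.2).
Proof.
apply: (Int_le (IntZ (2 `^ p) (IntD Int_score_f Int_score_eta))).
  apply: measurable_funM => //; apply: (measurableT_comp (measurable_powR _)).
  exact: measurableT_comp.
apply: aeT => z; rewrite (ger0_norm (mulr_ge0 (powR_ge0 _ _) (P0 _ _))).
by rewrite -mulrDl mulrA ler_wpM2r//; exact: powR_normD_le.
Qed.

Lemma Int_of_powR (s : M * M -> R) : measurable_fun setT s ->
  Int leb2 (fun z => `|s z| `^ p * P z.1 z.2) -> Int leb2 (fun z => s z * P z.1 z.2).
Proof.
move=> ms' isp; apply: (Int_le (IntD (Int_Pdens j) isp)); first exact: measurable_funM.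
apply: aeT => z; rewrite normrM (ger0_norm (P0 _ _)) -{2}[P z.1 z.2]mul1r -mulrDl.
by rewrite ler_wpM2r// norm_le_powR.
Qed.

Let iP := Int_Pdens j.
Let isP : Int leb2 (fun z => score z * P z.1 z.2).
Proof. exact: Int_of_powR Int_score_powR. Qed.
Let iseP : Int leb2 (fun z => score_eta z * P z.1 z.2).
Proof. exact: Int_of_powR Int_score_eta. Qed.

Lemma Int_Theta : Int lebM Theta.
Proof. by have [] := Rfubini1 iP. Qed.

(** Almost everywhere equal to grad_Theta; as an average of the score it is
    the form to which Fubini's theorem and Jensen's inequality apply. *)
Definition mean_score (X : M) := \int[lebM]_Y (score (X, Y) * P X Y).

Lemma Int_mean_score : Int lebM mean_score.
Proof. by have [] := Rfubini1 isP. Qed.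

(** Division by 0 gives 0, in agreement with the convention on {f j = 0}. *)
Lemma grad_ThetaE X : grad_Theta eps mu f j g X 0 i =
  Theta X * score_f (row j X) - \int[lebM]_Y (- score_eta (X, Y) * P X Y).
Proof.
rewrite /grad_Theta !mxE; congr (_ - _).
  rewrite /score_f; case: ifPn => [/eqP ->|_]; first by rewrite mxE invr0 !mulr0.
  by rewrite mxE mulrAC mulrA.
apply: eq_Rintegral => Y _; congr (_ * _); rewrite grad_etaE// /score_eta !mxE.
by rewrite mulfK// gt_eqF// eta_gt0.
Qed.

Lemma measurable_grad_Theta : measurable_fun setT (fun X => grad_Theta eps mu f j g X 0 i).
Proof.
under eq_fun do rewrite grad_ThetaE.
apply: measurable_funB.
  apply: measurable_funM; first exact: Int_meas Int_Theta.
  exact: (measurableT_comp msf (@measurable_row R N d j)).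
have iNseP : Int leb2 (fun z => - score_eta z * P z.1 z.2).
  by under [X in Int _ X]eq_fun do rewrite mulNr; exact: IntN.
by have [H _] := Rfubini1 iNseP; exact: Int_meas H.
Qed.

Lemma mean_scoreE : {ae lebM, forall X, mean_score X = grad_Theta eps mu f j g X 0 i}.
Proof.
apply: aeS2 (ae_Int1 iP) (ae_Int1 iseP) => X iPX isX; rewrite grad_ThetaE.
have -> : mean_score X =
    \int[lebM]_Y (score_f (row j X) * P X Y) + \int[lebM]_Y (score_eta (X, Y) * P X Y).
  rewrite -(RintegralD measurableT (IntZ (score_f (row j X)) iPX) isX).
  by apply: eq_Rintegral => Y _; rewrite /score mulrDl.
rewrite RintegralZl// mulrC; congr (_ + _).
under [in RHS]eq_Rintegral do rewrite mulNr -mulN1r.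
by rewrite RintegralZl// mulN1r opprK.
Qed.

(** Since g vanishes where f j does, |g| = f j |g / f j| <= f j (1 + |g / f
    j|^p). *)
Lemma Int_g : Int lebV (fun x => g x 0 i).
Proof.
apply: (Int_le (IntD (Int_density (fd j)) ig)) => //.
apply: aeS g0 => x gx0; have [fx|fx] := eqVneq (f j x) 0.
  by rewrite gx0// fx normr0 mul0r addr0.
rewrite -{1}[g x 0 i](divfK fx) normrM (ger0_norm (f0 j x)) mulrC.
by rewrite -[X in X + _]mulr1 -mulrDr ler_wpM2l// norm_le_powR.
Qed.

(** For fixed Y the density P is a product of densities times a smooth function,
    and the smooth function can be moved to the test function. *)
Lemma weak_partial_Pdens (Y : M) phi : test_function phi ->
  \int[lebM]_X (P X Y * 'D_(delta_mx j i) phi X) =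
  - \int[lebM]_X (score (X, Y) * P X Y * phi X).
Proof.
move=> tphi.
pose F X := \prod_k f k (row k X).
pose Fg X := g (row j X) 0 i * \prod_(k | k != j) f k (row k X).
pose s X := ker_etas eps (X, Y).
pose c := Lambda eps mu Y * \prod_k (conv_eta eps mu k (row k Y))^-1.
have PE X : P X Y = c * (F X * s X).
  rewrite /Pdens /c /F /s /ker_etas !big_split/=; ring.
have if_ k : Int lebV (f k) := Int_density (fd k).
have [lF lFg weakF] : is_weak_partial j i F Fg := weak_partial_prod_rows if_ Int_g wg.
have iF : Int lebM F := Int_prod_rows if_.
have FgE : {ae lebM, forall X, Fg X = score_f (row j X) * F X}.
  apply: aeS (ae_row j g0) => X gX0; rewrite /Fg /F [in RHS](bigD1 j)//= mulrA; congr (_ * _).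
  rewrite /score_f; have [fX|fX] := eqVneq (f j (row j X)) 0; last by rewrite divfK.
  by rewrite gX0// fX mulr0.
have [K K0 phiK] := test_function_support tphi.
have [sphi _] := tphi.
have cphi : continuous phi by have [] := sphi 0%N.
have [_ /(_ j i)[dphi [cdphi _]]] := sphi 1%N.
have phi0 := support_vanish phiK.
have dphi0 X := @derive_support R N d j i K%:R phi phiK X.
have ss k : is_Ck k s := is_Ck_ker_etas eps0 k Y.
have cs : continuous s by have [] := ss 0%N.
have [_ /(_ j i)[ds [cds _]]] := ss 1%N.
have dsE X : 'D_(delta_mx j i) s X = score_eta (X, Y) * s X := derive_ker_etas eps0 Y X j i.
have tpsi := test_functionM tphi ss.
have i1 : Int lebM (fun X => F X * (phi X * 'D_(delta_mx j i) s X)).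
  apply: (IntM_support (K := K)) => //; first by move=> X; exact: (cvgM (cphi X) (cds X)).
  by move=> X nQ; rewrite phi0// mul0r.
have i2 : Int lebM (fun X => F X * (s X * 'D_(delta_mx j i) phi X)).
  apply: (IntM_support (K := K)) => //; first by move=> X; exact: (cvgM (cs X) (cdphi X)).
  by move=> X nQ; rewrite dphi0// mulr0.
have iFg : Int lebM Fg := Int_prod_rows_subst j if_ Int_g.
have i3 : Int lebM (fun X => Fg X * (phi X * s X)).
  apply: (IntM_support (K := K)) => //; first by move=> X; exact: (cvgM (cphi X) (cs X)).
  by move=> X nQ; rewrite phi0// mul0r.
have := weakF _ tpsi.
have -> : \int[lebM]_X (F X * 'D_(delta_mx j i) (fun Z => phi Z * s Z) X) =
    \int[lebM]_X (F X * (phi X * 'D_(delta_mx j i) s X)) +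
    \int[lebM]_X (F X * (s X * 'D_(delta_mx j i) phi X)).
  rewrite -RintegralD//; apply: eq_Rintegral => X _.
  by rewrite derive_mulM ?mulrDr.
move=> /(congr1 (fun t => t - \int[lebM]_X (F X * (phi X * 'D_(delta_mx j i) s X)))).
rewrite addrAC subrr add0r -opprD -RintegralD// => /(congr1 (fun t => c * t)).
rewrite mulrN -!RintegralZl//; last by exact: IntD.
move=> E; transitivity (\int[lebM]_X (c * (F X * (s X * 'D_(delta_mx j i) phi X)))).
  by apply: eq_Rintegral => X _; rewrite PE; ring.
rewrite E; congr (- _); apply: Rint_ae.
- by have := Int_meas (IntZ c (IntD i3 i1)).
- apply: measurable_funM; last exact: measurable_continuous_mx.
  apply: measurable_funM.
    exact: (measurableT_comp ms (pair2_measurable Y)).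
  exact: (measurableT_comp mP (pair2_measurable Y)).
- by apply: aeS FgE => X ->; rewrite dsE PE /score /=; ring.
Qed.

(** The weak derivative of P(., Y), averaged over Y. *)
Lemma weak_partial_mean_score : is_weak_partial j i Theta mean_score.
Proof.
split.
- exact: Int_loc_integrable Int_Theta.
- exact: Int_loc_integrable Int_mean_score.
move=> phi tphi.
have [K K0 phiK] := test_function_support tphi.
have [sphi _] := tphi.
have cphi : continuous phi by have [] := sphi 0%N.
have [_ /(_ j i)[dphi [cdphi _]]] := sphi 1%N.
have phi0 := support_vanish phiK.
have [B hB] := continuous_support_bounded cphi phi0.
have [B' hB'] := continuous_support_bounded cdphi (@derive_support R N d j i K%:R phi phiK).
have mphi := measurable_continuous_mx cphi; have mdphi := measurable_continuous_mx cdphi.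
have i1 : Int leb2 (fun z => P z.1 z.2 * 'D_(delta_mx j i) phi z.1).
  apply: (IntM_bnd (B := B')) => //; first exact: (measurableT_comp mdphi measurable_fst).
  by apply: aeT => z; exact: hB'.
have i2 : Int leb2 (fun z => score z * P z.1 z.2 * phi z.1).
  apply: (IntM_bnd (B := B)) => //; first exact: (measurableT_comp mphi measurable_fst).
  by apply: aeT => z; exact: hB.
have [j1 E1] := Rfubini1 i1; have [k1 F1] := Rfubini2 i1.
have [j2 E2] := Rfubini1 i2; have [k2 F2] := Rfubini2 i2.
transitivity (\int[lebM]_X \int[lebM]_Y (P X Y * 'D_(delta_mx j i) phi X)).
  apply: Rint_ae; [|exact: Int_meas j1|].
    by apply: measurable_funM => //; exact: Int_meas Int_Theta.
  by apply: aeS (ae_Int1 iP) => X iPX; rewrite RintegralZr.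
rewrite E1 -F1.
transitivity (\int[lebM]_Y (-1 * \int[lebM]_X (score (X, Y) * P X Y * phi X))).
  by apply: eq_Rintegral => Y _; rewrite mulN1r; exact: weak_partial_Pdens.
rewrite RintegralZl// mulN1r; congr (- _); rewrite F2 -E2.
apply: Rint_ae; [exact: Int_meas j2| |].
  by apply: measurable_funM => //; exact: Int_meas Int_mean_score.
apply: aeS (ae_Int1 isP) => X isX.
exact: (RintegralZr (phi X) measurableT isX).
Qed.

Theorem weak_partial_Theta :
  is_weak_partial j i Theta (fun X => grad_Theta eps mu f j g X 0 i).
Proof.
apply: (weak_partial_ae weak_partial_mean_score).
- exact: Int_meas Int_Theta.
- exact: measurable_grad_Theta.
- exact: aeT.
- exact: mean_scoreE.
Qed.

Lemma Theta_ge0 X : 0 <= Theta X.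
Proof. by apply: Rintegral_ge0 => Y _. Qed.

(** This is (1/p) Theta^((1-p)/p) grad_Theta, with the value 0 on {Theta = 0}. *)
Definition root_grad (X : M) :=
  p^-1 * (Theta X `^ (p^-1 - 2) * Theta X) * grad_Theta eps mu f j g X 0 i.

Lemma Theta_root X : (Theta X `^ p^-1) `^ p = Theta X.
Proof. by rewrite -powRrM mulVf ?powRr1 ?Theta_ge0// gt_eqF// (lt_le_trans _ p1). Qed.

Lemma measurable_Theta_root : measurable_fun setT (fun X => Theta X `^ p^-1).
Proof. exact: (measurableT_comp (measurable_powR _) (Int_meas Int_Theta)). Qed.

Lemma Int_Theta_root : Int lebM (fun X => `|Theta X `^ p^-1| `^ p).
Proof.
under [X in Int _ X]eq_fun do rewrite ger0_norm ?powR_ge0// Theta_root.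
exact: Int_Theta.
Qed.

Lemma measurable_root_grad : measurable_fun setT root_grad.
Proof.
apply: measurable_funM; last exact: measurable_grad_Theta.
have mT := Int_meas Int_Theta.
apply: measurable_funM => //; apply: measurable_funM => //.
exact: (measurableT_comp (measurable_powR _) mT).
Qed.

Lemma root_grad_powR X : `|root_grad X| `^ p =
  p^-1 `^ p * (Theta X * `|grad_Theta eps mu f j g X 0 i / Theta X| `^ p).
Proof.
have p0' : 0 < p by rewrite (lt_le_trans _ p1).
rewrite /root_grad; set D := grad_Theta _ _ _ _ _ _ _ _; set t := Theta X.
have [->|tn0] := eqVneq t 0.
  by rewrite !mulr0 !mul0r mulr0 normr0 powR0// gt_eqF.
have t0 : 0 < t by rewrite lt_neqAle eq_sym tn0 Theta_ge0.
have -> : t `^ (p^-1 - 2) * t = t `^ p^-1 / t.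
  have -> : t `^ p^-1 = t `^ (p^-1 - 2) * t * t.
    rewrite -mulrA -expr2 -powR_mulrn ?(ltW t0)// -powRD; first by congr (_ `^ _); ring.
    by rewrite tn0 implybT.
  by rewrite mulfK.
have -> : p^-1 * (t `^ p^-1 / t) * D = p^-1 * (t `^ p^-1 * (D / t)) by ring.
rewrite normrM normfV (gtr0_norm p0') powRM ?invr_ge0 ?(ltW p0')//; congr (_ * _).
by rewrite normrM ger0_norm ?powR_ge0// powRM ?powR_ge0// Theta_root.
Qed.

(** By Jensen's inequality the L^p norm of the gradient of the root is at most
    the L^p norm of the score under P. *)
Lemma Int_root_grad : Int lebM (fun X => `|root_grad X| `^ p).
Proof.
have [isc _] := Rfubini1 Int_score_powR.
apply: (Int_le (IntZ (p^-1 `^ p) isc)).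
  apply: (measurableT_comp (measurable_powR _)); apply: measurableT_comp => //.
  exact: measurable_root_grad.
have aeI := ae_Int1 iP; have aeS1 := ae_Int1 isP; have aeSp := ae_Int1 Int_score_powR.
apply: aeS2 (aeS2 (fun X a b => conj a b) aeI aeS1) (aeS2 (fun X a b => conj a b) aeSp mean_scoreE).
move=> X [iX isX] [ispX DE].
rewrite ger0_norm ?powR_ge0// root_grad_powR ler_wpM2l ?powR_ge0// -DE.
exact: (jensen_weighted p1 (P0 X) iX isX ispX).
Qed.

Theorem weak_partial_Theta_root : is_weak_partial j i (fun X => Theta X `^ p^-1) root_grad.
Proof.
have p0' : 0 < p^-1 by rewrite invr_gt0 (lt_le_trans _ p1).
apply: (weak_partial_power p0' Theta_ge0 weak_partial_Theta).
- exact: loc_integrable_powR p1 measurable_Theta_root Int_Theta_root.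
- exact: loc_integrable_powR p1 measurable_root_grad Int_root_grad.
Qed.

End gradient.
End theta.

Section density_probability.
Context d (T : measurableType d) (R : realType) (mu : {measure set T -> \bar R}).
Variable h : T -> R.
Hypotheses (mh : measurable_fun setT h) (h0 : forall x, 0 <= h x).
Hypothesis h1 : (\int[mu]_x (h x)%:E = 1)%E.

Lemma ex_density_probability : exists P : probability T R,
  forall A, measurable A -> P A = (\int[mu]_(x in A) (h x)%:E)%E.
Proof.
pose m : {measure set T -> \bar R} := mdensity mu mh h0.
pose P : probability T R := HB.pack (m : set T -> \bar R)
  (Measure.class m) (Measure_isProbability.Build _ _ _ m h1).
by exists P.
Qed.

End density_probability.

Theorem theorem6p2 (R : realType) (d N : nat) (p eps : R)
    (mu : probability 'M[R]_(N, d) R) :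
  (1 <= d)%N -> (1 <= N)%N -> 1 <= p -> 0 < eps ->
  (forall k : 'I_N, P1p p (marginal mu k)) ->
  forall f : 'I_N -> 'rV[R]_d -> R,
  (forall k, is_density (marginal mu k) (f k)) ->
  (exists2 Th : probability 'M[R]_(N, d) R,
     is_density Th (Theta eps mu f) & P1p p Th) /\
  forall j : 'I_N,
    (exists g, is_weak_grad (f j) g) /\
    forall g, is_weak_grad (f j) g ->
      is_weak_grad_row j (Theta eps mu f) (grad_Theta eps mu f j g) /\
      forall G : 'M[R]_(N, d) -> 'rV[R]_d,
        is_weak_grad_row j (fun X => Theta eps mu f X `^ p^-1) G ->
        {ae @lebesgue_mx R N d, forall X,
          G X = if Theta eps mu f X == 0 then 0 else
            (p^-1 * Theta eps mu f X `^ ((1 - p) / p)) *: grad_Theta eps mu f j g X}.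
Proof.
move=> _ N1 p1 eps0 fP f fd.
have ex_g j := (density_weak_grad p1 (fP j) (fd j)).1.
have root j i g : is_weak_grad (f j) g ->
    {ae @lebesgue_mx R 1 d, forall x, f j x = 0 -> g x 0 i = 0} /\
    Int (@lebesgue_mx R 1 d) (fun x => f j x * `|g x 0 i / f j x| `^ p).
  by move=> wg; exact: (density_weak_grad p1 (fP j) (fd j)).2.
have T0 := @Theta_ge0 R d N eps mu f eps0 fd.
(* the total mass of P can be computed with any index j *)
have iT := @Int_Theta R d N eps mu f eps0 fd (Ordinal N1).
split.
  have T1 : (\int[@lebesgue_mx R N d]_X (Theta eps mu f X)%:E = 1)%E.
    rewrite RintE//; congr EFin.
    have iP := Int_Pdens eps0 fd (Ordinal N1).
    have [_ ->] := Rfubini1 iP.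
    apply: EFin_inj; rewrite -RintE//; exact: (integral_Pdens eps0 fd (Ordinal N1)).
  have [Th ThE] := ex_density_probability (Int_meas iT) T0 T1.
  have dTh : is_density Th (Theta eps mu f) by split => //; exact: Int_meas iT.
  exists Th => //; split.
    apply/null_content_dominatesP => A mA A0; rewrite ThE//.
    apply: null_set_integral => //.
    apply: (@measurable_funS _ _ _ _ setT) => //; apply/measurable_EFinP.
    exact: Int_meas iT.
  exists (Theta eps mu f) => //; split.
    apply/(Lfun_Int _ p1); split; first exact: (measurable_Theta_root p eps0 fd (Ordinal N1)).
    exact: (Int_Theta_root p1 eps0 fd (Ordinal N1)).
  have [g wg] := choice ex_g.
  exists (fun X => \matrix_(j, i) root_grad p eps mu f j i (g j) X) => j i.
    under [X in is_weak_partial _ _ _ X]eq_fun do rewrite mxE.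
    have [g0 ig] := root j i _ (wg j).
    exact: (weak_partial_Theta_root p1 eps0 fd (wg j 0 i) g0 ig).
  under eq_fun do rewrite mxE.
  have [g0 ig] := root j i _ (wg j).
  apply/(Lfun_Int _ p1); split.
    exact: (measurable_root_grad p1 eps0 fd (wg j 0 i)).
  exact: (Int_root_grad p1 eps0 fd (wg j 0 i) ig).
move=> j; split; first exact: ex_g.
move=> g wg; split.
  move=> i; have [g0 ig] := root j i g wg.
  exact: (weak_partial_Theta p1 eps0 fd (wg 0 i) g0 ig).
move=> G wG.
have GE i : {ae @lebesgue_mx R N d, forall X, G X 0 i = root_grad p eps mu f j i g X}.
  have [g0 ig] := root j i g wg.
  apply: (weak_partial_unique (wG i)).
  exact: (weak_partial_Theta_root p1 eps0 fd (wg 0 i) g0 ig).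
have : {ae @lebesgue_mx R N d, forall X, forall i, G X 0 i = root_grad p eps mu f j i g X}.
  exact: filter_forall.
apply: aeS => X GX; apply/rowP => i; rewrite GX /root_grad.
case: ifPn => [/eqP ->|Tn0]; first by rewrite !mulr0 mul0r mxE.
have p0 : p != 0 by rewrite gt_eqF// (lt_le_trans _ p1).
have -> : (1 - p) / p = p^-1 - 2 + 1 by field.
move: (grad_Theta eps mu f j g X) => D; by rewrite mxE (@powRD _ _ (p^-1 - 2) 1) ?Tn0 ?implybT// (powRr1 (T0 X)).
Qed.
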